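(* Let $X$ be a real separable Hilbert space and let $\mu=\mathcal N(0,Q_\mu)$, $\nu=\mathcal N(0,Q_\nu)$ be centered Gaussian measures on $X$ with Cameron–Martin spaces $H_\mu,H_\nu$. For every $T\in\mathscr L(H_\mu,H_\nu)$ with $\|T\|_{\mathscr L(H_\mu,H_\nu)}\le1$ we have $\widetilde\Gamma_{\nu,\mu}(T)=\Gamma_{\nu,\mu}(T)$ on $L^2(X,\mu)$, where $\widetilde\Gamma_{\nu,\mu}(T)$ (defined by a series on the Wiener chaoses) and $\Gamma_{\nu,\mu}(T)$ (defined by an integral formula) are given in the context.
   Context: Cameron–Martin space: for $\gamma=\mathcal N(0,Q_\gamma)$, $H_\gamma=Q_\gamma^{1/2}(X)$ with $\langle h,k\rangle_{H_\gamma}=\langle Q_\gamma^{-1/2}h,Q_\gamma^{-1/2}k\rangle_X$, where $Q_\gamma^{-1/2}h$ is the unique $z\in(\ker Q_\gamma^{1/2})^\perp$ with $Q_\gamma^{1/2}z=h$. Series operator. Let $(f_k^\gamma)$ be an orthonormal basis (finite or countable) of $(\ker Q_\gamma)^\perp$ with $Q_\gamma f^\gamma_k=\lambda_k f^\gamma_k$, $\lambda_k>0$, and $e_k^\gamma=\lambda_k^{1/2}f_k^\gamma=Q_\gamma^{1/2}f^\gamma_k$, an orthonormal basis of $H_\gamma$. For $z\in X$, $W^\gamma_z(x)=\sum_k\lambda_k^{-1/2}\langle x,f_k^\gamma\rangle_X\langle z,f_k^\gamma\rangle_X$ (limit in $L^2(X,\gamma)$). Let $\phi_n(\xi)=\frac{(-1)^n}{n!}e^{\xi^2/2}\frac{d^n}{d\xi^n}e^{-\xi^2/2}$;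 for a multi-index $\alpha$ with finitely many nonzero entries, $\alpha!=\prod_j\alpha_j!$, $|\alpha|=\sum_j\alpha_j$, $\Phi_\alpha^\gamma=\sqrt{\alpha!}\prod_j\phi_{\alpha_j}(W^\gamma_{f_j^\gamma})$. $\mathscr H_n^\gamma$ is the closed span in $L^2(X,\gamma)$ of $\{\Phi_\alpha^\gamma:|\alpha|=n\}$; $L^2(X,\gamma)=\bigoplus_{n\ge0}\mathscr H_n^\gamma$ and $I_n^\gamma$ is the orthogonal projection onto $\mathscr H_n^\gamma$. $H_\gamma^{\odot n}$ is the closed subspace of symmetric tensors of the Hilbert tensor power $H_\gamma^{\otimes n}$. For $n\ge1$, $\Psi_n^\gamma:(H_\gamma^{\odot n},\sqrt{n!}\,\|\cdot\|_{H_\gamma^{\otimes n}})\to\mathscr H_n^\gamma$ is the linear isometric isomorphism with $\Psi_n^\gamma\big(\frac1{n!}\sum_{\sigma}e^\gamma_{i_{\sigma(1)}}\otimes\cdots\otimes e^\gamma_{i_{\sigma(n)}}\big)=\sqrt{\alpha!}\,\Phi_\alpha^\gamma$ for $|\alpha|=n$, where $\sigma$ ranges over all permutations of $\{1,\dots,n\}$ and $i_1\le\dots\le i_n$ is the list in which each $j$ occurs $\alpha_j$ times. For $T\in\mathscr L(H_\mu,H_\nu)$, $T^{\otimes n}(v_1\otimes\cdots\otimes v_n)=Tv_1\otimes\cdots\otimes Tv_n$, $\widetilde\Gamma_{\nu,\mu,n}(T)=\Psi_n^\nu T^{\otimes n}(\Psi_n^\mu)^{-1}:\mathscr H_n^\mu\to\mathscr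 H_n^\nu$ ($n\ge1$), and $\widetilde\Gamma_{\nu,\mu,0}(T)$ is the identity on constants. For $\|T\|\le1$, $\widetilde\Gamma_{\nu,\mu}(T)f=\sum_{n=0}^\infty\widetilde\Gamma_{\nu,\mu,n}(T)(I_n^\mu f)$, $f\in L^2(X,\mu)$. Integral operator. For $T\in\mathscr L(H_\mu,H_\nu)$ let $\pi_m$ be the orthogonal projection of $X$ onto $\mathrm{span}\{f^\mu_1,\dots,f^\mu_m\}\subseteq H_\mu$; $T_\infty^{\nu,\mu}$ is the limit (it exists) of $T\pi_m$ in $L^2(X,\mu;X)$, for which a linear measurable version is fixed; $T_\infty^\mu:=T_\infty^{\mu,\mu}$. For $\|T\|\le1$ and $f:X\to\mathbb R$ measurable with $|f(x)|\le Me^{c\|x\|_X}$ for some $M,c>0$, $(\Gamma_{\nu,\mu}(T)f)(x)=\int_Xf\big[(T^\star)_\infty^{\mu,\nu}x+((I-T^\star T)^{1/2})_\infty^\mu y\big]\mu(dy)$, with $T^\star\in\mathscr L(H_\nu,H_\mu)$ the adjoint; it extends by density to a bounded operator $L^p(X,\mu)\to L^p(X,\nu)$ for every $p\in[1,\infty)$, denoted in the same way. *)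

(* Defs.v *)
From HB Require Import structures.
From mathcomp Require Import all_boot all_order all_algebra all_fingroup finmap.
From mathcomp Require Import all_classical all_reals all_analysis.

Set Implicit Arguments.
Unset Strict Implicit.
Unset Printing Implicit Defensive.
Import Order.TTheory GRing.Theory Num.Theory.
Import numFieldNormedType.Exports.
Local Open Scope classical_set_scope.
Local Open Scope ring_scope.

(* MathComp-Analysis has no inner product spaces: a real Hilbert space is a
   complete normed module whose norm comes from an inner product. *)
Record inner_product (R : realType) (X : normedModType R) := InnerProduct {
  inner :> X -> X -> R;
  innerC : forall x y, inner x y = inner y x;
  innerDl : forall x y z, inner (x + y) z = inner x z + inner y z;
  innerZl : forall a x y, inner (a *: x) y = a * inner x y;
  inner_norm : forall x, inner x x = `|x| ^+ 2 }.

Definition separable_space (T : topologicalType) : Prop :=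
  exists A : set T, countable A /\ dense A.

Section operators.
Context (R : realType) (X : normedModType R).

(* A Hilbert space whose vectors form a linear subspace of X, with an inner
   product of its own (X itself, or the Cameron-Martin spaces). Operators
   between two such spaces are functions X -> X of which only the restriction
   to the source space matters. *)
Record hspace := Hspace { hset :> X -> Prop; hinner : X -> X -> R }.

Implicit Types H K : hspace.

Definition hnorm H (x : X) : R := Num.sqrt (hinner H x x).

Definition bounded_op H K (A : X -> X) : Prop :=
  [/\ forall x, H x -> K (A x),
      forall a x y, H x -> H y -> A (a *: x + y) = a *: A x + A y
    & exists C : R, forall x, H x -> hnorm K (A x) <= C * hnorm H x].

Definition opnorm H K (A : X -> X) : R :=
  sup [set hnorm K (A x) | x in [set x | H x /\ hnorm H x <= 1]].

Definition is_adjoint H K (A B : X -> X) : Prop :=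
  bounded_op K H B /\
  forall x y, H x -> K y -> hinner K (A x) y = hinner H x (B y).

Definition nonneg_selfadjoint H (A : X -> X) : Prop :=
  [/\ bounded_op H H A,
      forall x y, H x -> H y -> hinner H (A x) y = hinner H x (A y)
    & forall x, H x -> 0 <= hinner H (A x) x].

Definition is_sqrt_op H (A S : X -> X) : Prop :=
  nonneg_selfadjoint H S /\ forall x, H x -> S (S x) = A x.

Variable ip : inner_product X.

Definition whole : hspace := Hspace setT ip.

Definition ker_perp (A : X -> X) : set X :=
  [set z | forall y, A y = 0 -> ip z y = 0].

Definition trace_class (Q : X -> X) : Prop :=
  exists M : R, forall n (u : 'I_n -> X),
    (forall i j, ip (u i) (u j) = (i == j)%:R) ->
    \sum_i ip (Q (u i)) (u i) <= M.

(* (f_k), k in D, is orthonormal; this is the orthogonal projection onto the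
   span of the f_k with k < m. *)
Definition proj_span (D : set nat) (f : nat -> X) (m : nat) (x : X) : X :=
  \sum_(k < m | (k : nat) \in D) ip x (f k) *: f k.

Definition orthonormal_basis (V : set X) (D : set nat) (f : nat -> X) : Prop :=
  [/\ forall k, D k -> V (f k),
      forall j k, D j -> D k -> ip (f j) (f k) = (j == k)%:R
    & forall x, V x -> proj_span D f m x @[m --> \oo] --> x].

(* For S = Q^{1/2}: the space Q^{1/2}(X) with
   <h, k> = <Q^{-1/2} h, Q^{-1/2} k>, where Q^{-1/2} h is the unique z in
   (ker Q^{1/2})^perp with Q^{1/2} z = h. *)
Definition perp_inv (S : X -> X) (h : X) : X :=
  xget 0 [set z | ker_perp S z /\ S z = h].

Definition cameron_martin (S : X -> X) : hspace :=
  Hspace (range S) (fun h k => ip (perp_inv S h) (perp_inv S k)).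

End operators.

Notation borel X := (g_sigma_algebraType (@open X)).

(* The library's normal_prob is not a Dirac mass when its standard deviation
   is 0, hence the case distinction; v is the variance. *)
Definition centered_normal (R : realType) (v : R) :
    set (measurableTypeR R) -> \bar R :=
  if v == 0 then \d_(0 : measurableTypeR R) else normal_prob 0 (Num.sqrt v).

(* A centered Gaussian measure N(0, Q): every one-dimensional marginal
   <., h> has law N(0, <Q h, h>). It comes with Q^{1/2} and with a finite or
   countable orthonormal basis of (ker Q)^perp made of eigenvectors, indexed
   by an initial segment gidx of nat. *)
Record gaussian (R : realType) (X : normedModType R) (ip : inner_product X) :=
  Gaussian {
  glaw : probability (borel X) R;
  gcov : X -> X;
  gsqrt : X -> X;
  gidx : set nat;
  gvec : nat -> X;
  geig : nat -> R;
  gcov_nonneg : nonneg_selfadjoint (whole ip) gcov;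
  gcov_trace : trace_class ip gcov;
  glaw_marginal : forall (h : X) (A : set (measurableTypeR R)), measurable A ->
    glaw [set x | A (ip x h)] = centered_normal (ip (gcov h) h) A;
  gsqrtP : is_sqrt_op (whole ip) gcov gsqrt;
  gidx_initial : forall j k, gidx k -> (j <= k)%N -> gidx j;
  gvec_basis : orthonormal_basis ip (ker_perp ip gcov) gidx gvec;
  geig_gt0 : forall k, gidx k -> 0 < geig k;
  gvec_eigen : forall k, gidx k -> gcov (gvec k) = geig k *: gvec k }.

Definition multiindex := {fsfun nat -> nat with 0%N}.
Definition mdeg (alpha : multiindex) : nat :=
  (\sum_(j <- finsupp alpha) alpha j)%N.
Definition mfact (alpha : multiindex) : nat :=
  (\prod_(j <- finsupp alpha) (alpha j)`!)%N.

Definition hermite (R : realType) (n : nat) (xi : R) : R :=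
  (-1) ^+ n / n`!%:R * expR (xi ^+ 2 / 2)
  * derive1n n (fun t : R => expR (- (t ^+ 2) / 2)) xi.

Definition l2 (R : realType) (X : normedModType R) (P : probability (borel X) R)
    (f : X -> R) : Prop := (f : borel X -> R) \in Lfun P 2%:E.

Definition l2norm (R : realType) (X : normedModType R)
    (P : probability (borel X) R) (f : X -> R) : \bar R :=
  Lnorm P 2%:E (EFin \o (f : borel X -> R)).

Section chaos.
Context (R : realType) (X : normedModType R) (ip : inner_product X).
Variable g : gaussian ip.

Local Notation P := (glaw g).

Definition CM : hspace X := cameron_martin ip (gsqrt g).

Definition cmvec (k : nat) : X := Num.sqrt (geig g k) *: gvec g k.

(* W_z; only z = gvec j is used below, for which the series is finite, so that
   the pointwise sum is the L^2 sum. *)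
Definition white_noise (z x : X) : R :=
  limn (fun n => \sum_(k < n | (k : nat) \in gidx g)
    (Num.sqrt (geig g k))^-1 * ip x (gvec g k) * ip z (gvec g k)).

Definition admissible (alpha : multiindex) : Prop :=
  forall j, j \in finsupp alpha -> gidx g j.

Definition Phi (alpha : multiindex) (x : X) : R :=
  Num.sqrt (mfact alpha)%:R *
  \prod_(j <- finsupp alpha) hermite (alpha j) (white_noise (gvec g j) x).

(* Closed span in L^2 of the Phi_alpha with |alpha| = n; elements of L^2 are
   represented by square-integrable Borel functions. *)
Definition chaos (n : nat) : set (X -> R) :=
  [set f | l2 P f /\ forall eps : R, 0 < eps ->
    exists s : seq (R * multiindex),
      (forall p, p \in s -> admissible p.2 /\ mdeg p.2 = n) /\
      (l2norm P (fun x => f x - \sum_(p <- s) p.1 * Phi p.2 x)%R < eps%:E)%E].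

(* u = I_n f *)
Definition is_chaos_proj (n : nat) (f u : X -> R) : Prop :=
  chaos n u /\ forall h, chaos n h ->
    Rintegral P setT (fun x => (f x - u x) * h x) = 0.

(* The Hilbert tensor power of H = CM is realised as the space of bounded
   n-linear Hilbert-Schmidt forms on H, the tensor v_1 (x) ... (x) v_n being
   the form w |-> \prod_i <v_i, w_i>_H. A form is a function on n-tuples of
   vectors of X of which only the restriction to H^n matters. *)
Definition form (n : nat) : Type := ('I_n -> X) -> R.

Definition cm_tuple n (v : 'I_n -> X) : Prop := forall i, CM (v i).

Definition form_eq n (F G : form n) : Prop :=
  forall v, cm_tuple v -> F v = G v.

Definition pure_tensor n (v : 'I_n -> X) : form n :=
  fun w => \prod_i hinner CM (v i) (w i).

Definition tensor_norm n (F : form n) : \bar R :=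
  sqrte (\esum_(i in [set i : {ffun 'I_n -> nat} | forall k, gidx g (i k)])
    ((F (fun k => cmvec (i k))) ^+ 2)%:E).

Definition multilinear_form n (F : form n) : Prop :=
  forall (k : 'I_n) (a : R) (v v1 v2 : 'I_n -> X),
    cm_tuple v1 -> cm_tuple v2 -> v k = a *: v1 k + v2 k ->
    (forall j, j != k -> v j = v1 j /\ v j = v2 j) ->
    F v = a * F v1 + F v2.

Definition is_tensor n (F : form n) : Prop :=
  [/\ multilinear_form F,
      exists C : R, forall v, cm_tuple v ->
        `|F v| <= C * \prod_i hnorm CM (v i)
    & (tensor_norm F < +oo)%E].

Definition is_sym_tensor n (F : form n) : Prop :=
  is_tensor F /\
  forall (s : {perm 'I_n}) v, cm_tuple v -> F (fun k => v (s k)) = F v.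

(* Psi_n, for n >= 1 *)
Definition is_wiener_iso n (Psi : form n -> X -> R) : Prop :=
  [/\ forall F, is_sym_tensor F -> chaos n (Psi F),
      forall a F G, is_sym_tensor F -> is_sym_tensor G ->
        (Psi (fun v => a * F v + G v) : borel X -> R)
          = (fun x => a * Psi F x + Psi G x) %[ae P],
      forall F, is_sym_tensor F ->
        l2norm P (Psi F) = ((Num.sqrt n`!%:R)%:E * tensor_norm F)%E,
      forall f, chaos n f -> exists F, is_sym_tensor F /\
        (Psi F : borel X -> R) = f %[ae P]
    & forall (alpha : multiindex) (i : n.-tuple nat),
        sorted leq i -> (forall k, gidx g (tnth i k)) ->
        (forall j, count_mem j i = alpha j) ->
        (Psi (fun w => n`!%:R^-1 * \sum_(s : {perm 'I_n})
                pure_tensor (fun k => cmvec (tnth i (s k))) w) : borel X -> R)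
          = (fun x => Num.sqrt (mfact alpha)%:R * Phi alpha x) %[ae P]].

(* L is a measurable version of the L^2(X, P; X)-limit of T \o pi_m, linear on
   a Borel subspace of full measure (an everywhere defined linear Borel map
   would be continuous). *)
Definition is_ext_infty (T L : X -> X) : Prop :=
  [/\ measurable_fun [set: borel X] (L : borel X -> borel X),
      exists V : set (borel X), [/\ measurable V, P V = 1%E,
        V 0, forall (a : R) (x y : X), V x -> V y -> V (a *: x + y)
        & forall (a : R) (x y : X), V x -> V y -> L (a *: x + y) = a *: L x + L y]
    & (\int[P]_x (`|T (proj_span ip (gidx g) (gvec g) m x) - L x| ^+ 2)%R%:E)%E
        @[m --> \oo] --> 0%E].

Definition exp_bounded (f : X -> R) : Prop :=
  measurable_fun [set: borel X] (f : borel X -> R) /\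
  exists M c : R, [/\ 0 < M, 0 < c & forall x, `|f x| <= M * expR (c * `|x|)].

End chaos.

Section second_quantization.
Context (R : realType) (X : normedModType R) (ip : inner_product X).
Variables (mu nu : gaussian ip) (T : X -> X).

Definition is_tensor_power n (Tn : form X n -> form X n) : Prop :=
  [/\ forall F, is_tensor mu F -> is_tensor nu (Tn F),
      forall a F G, is_tensor mu F -> is_tensor mu G ->
        form_eq nu (Tn (fun v => a * F v + G v))
                   (fun v => a * Tn F v + Tn G v),
      exists C : R, forall F, is_tensor mu F ->
        (tensor_norm nu (Tn F) <= C%:E * tensor_norm mu F)%E
    & forall v, cm_tuple mu v ->
        form_eq nu (Tn (pure_tensor mu v))
                   (pure_tensor nu (fun i => T (v i)))].

(* The objects entering the series operator. Each is unique: as an element of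
   L^2, hence up to almost everywhere equality, or for tensor_power as a form,
   hence up to form_eq. *)
Record series_data := SeriesData {
  chaos_proj : nat -> (X -> R) -> X -> R;
  wiener_mu : forall n, form X n -> X -> R;
  wiener_nu : forall n, form X n -> X -> R;
  tensor_power : forall n, form X n -> form X n;
  chaos_projP : forall n f, l2 (glaw mu) f ->
    is_chaos_proj mu n f (chaos_proj n f);
  wiener_muP : forall n, (0 < n)%N -> is_wiener_iso mu (@wiener_mu n);
  wiener_nuP : forall n, (0 < n)%N -> is_wiener_iso nu (@wiener_nu n);
  tensor_powerP : forall n, (0 < n)%N -> is_tensor_power (@tensor_power n) }.

Definition wiener_mu_inv (d : series_data) n (f : X -> R) : form X n :=
  xget (fun=> 0) [set F | is_sym_tensor mu F /\
    (wiener_mu d F : borel X -> R) = f %[ae glaw mu]].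

(* For n = 0, f is mu-a.e. equal to a constant c, and is sent to the constant
   function c (mu and nu may be mutually singular). *)
Definition Gamma_tilde_n (d : series_data) (n : nat) (f : X -> R) : X -> R :=
  if n is 0 then
    cst (xget 0 [set c : R | (f : borel X -> R) = cst c %[ae glaw mu]])
  else wiener_nu d (tensor_power d (@wiener_mu_inv d n f)).

(* The series defining the operator at f converges in L^2(X, nu), to u. *)
Definition is_Gamma_tilde (d : series_data) (f u : X -> R) : Prop :=
  l2 (glaw nu) u /\
  l2norm (glaw nu)
    (fun x => \sum_(n < N) Gamma_tilde_n d n (chaos_proj d n f) x - u x)
    @[N --> \oo] --> 0%E.

(* The objects entering the integral operator, for an arbitrary choice of the
   versions Tstar_infty and Tdefect_infty of the L^2 limits. Gamma is the bounded
   extension to L^2; exponentially bounded functions are dense in L^2(X, mu),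
   so it is unique up to almost everywhere equality. *)
Record integral_data := IntegralData {
  Tstar : X -> X;
  Tdefect : X -> X;
  Tstar_infty : X -> X;
  Tdefect_infty : X -> X;
  Gamma : (X -> R) -> X -> R;
  TstarP : is_adjoint (CM mu) (CM nu) T Tstar;
  TdefectP : is_sqrt_op (CM mu) (fun h => h - Tstar (T h)) Tdefect;
  Tstar_inftyP : is_ext_infty nu Tstar Tstar_infty;
  Tdefect_inftyP : is_ext_infty mu Tdefect Tdefect_infty;
  Gamma_l2 : forall f, l2 (glaw mu) f -> l2 (glaw nu) (Gamma f);
  Gamma_linear : forall a f h, l2 (glaw mu) f -> l2 (glaw mu) h ->
    (Gamma (fun x => a * f x + h x) : borel X -> R)
      = (fun x => a * Gamma f x + Gamma h x) %[ae glaw nu];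
  Gamma_bounded : exists C : R, forall f, l2 (glaw mu) f ->
    (l2norm (glaw nu) (Gamma f) <= C%:E * l2norm (glaw mu) f)%E;
  Gamma_integral : forall f, exp_bounded f ->
    (Gamma f : borel X -> R)
      = (fun x => Rintegral (glaw mu) setT
                    (fun y => f (Tstar_infty x + Tdefect_infty y)))
      %[ae glaw nu] }.

End second_quantization.

(* Main.v *)
(* Both operators are linear and bounded on each chaos, so they are compared on
   the functions He_n(W_h), where He_n is the Hermite polynomial of variance
   |h|^2 and h ranges over finite combinations of the basis of H_mu. By
   polarization these span the n-th chaos, and Psi_n sends the tensor power of h
   to He_n(W_h). Hence the series operator maps He_n(W_h) to He_n(W_{Th}), the
   Hermite polynomial now having variance |Th|^2. In the integral formula,
   <T*_infty x, .> and <D_infty y, .>, with D the defect operator, are the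
   Gaussian variables W_{Th}(x) and W_{Dh}(y); averaging over y lowers the
   variance parameter by |Dh|^2 = |h|^2 - |Th|^2 and gives the same function.
   Consequently both operators agree on every chaos, and since the chaos
   expansion of f converges in L^2, which is proved by density of the
   polynomials, the boundedness of Gamma gives the convergence of the series to
   Gamma f; no bound on the norm of the tensor powers of T uniform in the degree
   is needed. *)
From HB Require Import structures.
Require Import Defs.
From mathcomp Require Import all_boot all_order all_algebra all_fingroup finmap.
From mathcomp Require Import all_classical all_reals all_analysis.
From mathcomp Require Import measurable_realfun.
From mathcomp Require Import ring lra.
Set Implicit Arguments.
Unset Strict Implicit.
Unset Printing Implicit Defensive.
Import Order.TTheory GRing.Theory Num.Theory.
Import numFieldNormedType.Exports.
Local Open Scope classical_set_scope.
Local Open Scope ring_scope.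

(** The vector [T h] is in general an infinite combination of the basis of H_nu, so W_(Th) exists
    only as an L^2 limit, and L^2 convergence does not control a Hermite polynomial of it. Hence the
    mode [mcvg], convergence of all moments, which is stable under products. The law of the limit
    never has to be identified: increments of the approximating functionals are Gaussian with
    explicit moments, and a Fatou-type bound passes these to the limit. Since a [gaussian] gives
    only one-dimensional marginals, joint moments are read off as coefficients in s of the moments
    along the lines [z + s *: w]. A second obstacle is that a tensor power of T is specified by
    linearity, boundedness and its values on pure tensors. That it preserves symmetry, without which
    Psi_n could not be applied to its values, has to be derived. For this the density of the
    He_n(W_h) in the chaos is pulled back through the isometry Psi_n to the density of combinations
    of tensor powers of h among symmetric tensors. *)

Lemma psd_cauchy_schwarz (R : realFieldType) (a b c : R) :
  (forall t, 0 <= t ^+ 2 * a + 2 * t * b + c) -> b ^+ 2 <= a * c.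
Proof.
move=> h; have [a0|a0] := eqVneq a 0.
  have [->|b0] := eqVneq b 0; first by rewrite a0 mul0r expr0n.
  (* At this t the affine function takes the value -1. *)
  have := h (- (c + 1) / (2 * b)); rewrite a0 mulr0 add0r.
  rewrite (_ : 2 * _ * b = - (c + 1)); last by field.
  by lra.
have := h (- b / a).
rewrite (_ : _ + c = (a * c - b ^+ 2) / a); last by field.
have a_gt0 : 0 < a.
  rewrite lt_neqAle eq_sym a0 /= leNgt; apply/negP => an.
  pose k := (a * c - b ^+ 2) / a.
  have kE s : (- b / a + s) ^+ 2 * a + 2 * (- b / a + s) * b + c = s ^+ 2 * a + k.
    by rewrite /k; field.
  have k0 : 0 <= k by have := h (- b / a + 0); rewrite kE expr0n mul0r add0r.
  (* Were a negative, the shift s >= 1 from the vertex with s a = a - (k + 1) would give s^2 a + k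
     <= s a + k = a - 1 < 0. *)
  have := h (- b / a + ((k + 1) / - a + 1)); rewrite kE.
  set s := (_ / _ + 1).
  have sa : s * a = - (k + 1) + a by rewrite /s; field.
  have s1 : 1 <= s by rewrite /s lerDr divr_ge0 // ?addr_ge0 // oppr_ge0 ltW.
  rewrite expr2 -mulrA sa; nra.
by rewrite pmulr_lge0 ?invr_gt0 // subr_ge0.
Qed.

(** * Square-integrable functions *)

Section L2.
Context d (T : measurableType d) (R : realType) (P : probability T R).
Implicit Types f g h : T -> R.

(** A working form of [Lfun P 2] for real-valued functions; [L2P] and [LnormE] translate between the
    two. *)
Definition L2 f := measurable_fun setT f /\
  P.-integrable setT (fun x => (f x ^+ 2)%:E).
Definition dot f g := Rintegral P setT (fun x => f x * g x).
Definition N2 f := Num.sqrt (dot f f).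

Lemma L2_mul f g : L2 f -> L2 g -> P.-integrable setT (fun x => (f x * g x)%:E).
Proof.
move=> [mf if2] [mg ig2].
apply: (@le_integrable _ _ _ P setT _ _ (fun x => (f x ^+ 2 + g x ^+ 2)%:E)) => //.
- by apply/measurable_EFinP; exact: measurable_funM.
- move=> x _ /=; rewrite lee_fin normrM [leRHS]ger0_norm ?addr_ge0 ?sqr_ge0 //.
  rewrite -(real_normK (num_real (f x))) -(real_normK (num_real (g x))).
  have := sqr_ge0 (`|f x| - `|g x|); rewrite sqrrB.
  have : 0 <= `|f x| * `|g x| by rewrite mulr_ge0.
  lra.
- by under eq_fun do rewrite EFinD; exact: integrableD.
Qed.

Lemma L2_measurable f : L2 f -> measurable_fun setT f.
Proof. by case. Qed.

Lemma L2_cst c : L2 (fun=> c).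
Proof.
split; first exact: measurable_cst.
by apply: finite_measure_integrable_cst => //.
Qed.

Lemma L2D f g : L2 f -> L2 g -> L2 (fun x => f x + g x).
Proof.
move=> Lf Lg; split; first by apply: measurable_funD; [case: Lf|case: Lg].
rewrite (_ : (fun x => _) = (fun x => (f x ^+ 2)%:E + (2%:E * (f x * g x)%:E + (g x ^+ 2)%:E))%E).
  apply: integrableD => //; first by case: Lf.
  apply: integrableD => //; last by case: Lg.
  by apply: integrableZl => //; exact: L2_mul.
by apply/funext => x; rewrite -EFinM -!EFinD; congr EFin; ring.
Qed.

Lemma L2Z a f : L2 f -> L2 (fun x => a * f x).
Proof.
move=> [mf if2]; split; first by apply: measurable_funM => //; exact: measurable_cst.
under eq_fun do rewrite exprMn EFinM.
exact: integrableZl.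
Qed.

Lemma L2N f : L2 f -> L2 (fun x => - f x).
Proof. by move=> /(L2Z (-1)); under eq_fun do rewrite mulN1r. Qed.

Lemma L2B f g : L2 f -> L2 g -> L2 (fun x => f x - g x).
Proof. by move=> Lf Lg; apply: L2D => //; exact: L2N. Qed.

Lemma L2_sum I (s : seq I) (Q : pred I) (F : I -> T -> R) :
  (forall i, Q i -> L2 (F i)) -> L2 (fun x => \sum_(i <- s | Q i) F i x).
Proof.
move=> LF; elim: s => [|i s IH].
  by rewrite (_ : (fun x => _) = fun=> 0); [exact: L2_cst|apply/funext => x; rewrite big_nil].
rewrite (_ : (fun x => _) = fun x => if Q i then F i x + \sum_(j <- s | Q j) F j x
    else \sum_(j <- s | Q j) F j x); last by apply/funext => x; rewrite big_cons.
by case: (boolP (Q i)) => // Qi; apply: L2D => //; exact: LF.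
Qed.

Lemma dotC f g : dot f g = dot g f.
Proof. by rewrite /dot; under eq_fun do rewrite mulrC. Qed.

Lemma dotDl f g h : L2 f -> L2 g -> L2 h ->
  dot (fun x => f x + g x) h = dot f h + dot g h.
Proof.
move=> Lf Lg Lh; rewrite /dot -RintegralD //; try exact: L2_mul.
by under eq_fun do rewrite mulrDl.
Qed.

Lemma dotZl a f g : L2 f -> L2 g -> dot (fun x => a * f x) g = a * dot f g.
Proof.
move=> Lf Lg; rewrite /dot -RintegralZl //; last exact: L2_mul.
by under eq_fun do rewrite -mulrA.
Qed.

Lemma dotBl f g h : L2 f -> L2 g -> L2 h ->
  dot (fun x => f x - g x) h = dot f h - dot g h.
Proof.
move=> Lf Lg Lh; rewrite /dot -RintegralB //; try exact: L2_mul.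
by under eq_fun do rewrite mulrBl.
Qed.

Lemma dotDr f g h : L2 f -> L2 g -> L2 h ->
  dot f (fun x => g x + h x) = dot f g + dot f h.
Proof. by move=> Lf Lg Lh; rewrite dotC dotDl // !(dotC f). Qed.

Lemma dotZr a f g : L2 f -> L2 g -> dot f (fun x => a * g x) = a * dot f g.
Proof. by move=> Lf Lg; rewrite dotC dotZl // dotC. Qed.

Lemma dotBr f g h : L2 f -> L2 g -> L2 h ->
  dot f (fun x => g x - h x) = dot f g - dot f h.
Proof. by move=> Lf Lg Lh; rewrite dotC dotBl // !(dotC f). Qed.

Lemma dot_suml I (s : seq I) (F : I -> T -> R) g :
  (forall i, L2 (F i)) -> L2 g ->
  dot (fun x => \sum_(i <- s) F i x) g = \sum_(i <- s) dot (F i) g.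
Proof.
move=> LF Lg; elim: s => [|i s IH].
  rewrite big_nil /dot (_ : (fun x => _) = fun=> 0); first by rewrite Rintegral_cst // mul0r.
  by apply/funext => x; rewrite big_nil mul0r.
rewrite big_cons -IH -dotDl //; last exact: L2_sum.
by congr dot; apply/funext => x; rewrite big_cons.
Qed.

Lemma dot_ge0 f : 0 <= dot f f.
Proof. by apply: Rintegral_ge0 => x _; rewrite -expr2 sqr_ge0. Qed.

Lemma dotxxP f : L2 f -> (dot f f)%:E = (\int[P]_x (f x ^+ 2)%:E)%E.
Proof.
move=> [mf if2]; rewrite /dot /Rintegral fineK //.
exact: integrable_fin_num.
Qed.

Lemma N2_ge0 f : 0 <= N2 f. Proof. exact: sqrtr_ge0. Qed.

Lemma sqr_N2 f : N2 f ^+ 2 = dot f f.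
Proof. by rewrite sqr_sqrtr // dot_ge0. Qed.

Lemma dot_sqr_le f g : L2 f -> L2 g -> dot f g ^+ 2 <= dot f f * dot g g.
Proof.
move=> Lf Lg; apply: psd_cauchy_schwarz => t.
have := dot_ge0 (fun x => t * f x + g x).
have Lt := L2Z t Lf.
have Ltg := L2D Lt Lg.
rewrite dotDl // !dotDr // !dotZl // !dotZr // (dotC g f).
by move=> h; rewrite (_ : _ + _ + _ = t * (t * dot f f) + t * dot f g + (t * dot f g + dot g g)) //; ring.
Qed.

Lemma dot_le f g : L2 f -> L2 g -> `|dot f g| <= N2 f * N2 g.
Proof.
move=> Lf Lg; rewrite -(@ler_pXn2r _ 2) // ?nnegrE ?mulr_ge0 ?N2_ge0 //.
by rewrite exprMn !sqr_N2 real_normK ?num_real //; exact: dot_sqr_le.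
Qed.

Lemma N2D f g : L2 f -> L2 g -> N2 (fun x => f x + g x) <= N2 f + N2 g.
Proof.
move=> Lf Lg; rewrite -(@ler_pXn2r _ 2) // ?nnegrE ?addr_ge0 ?N2_ge0 //.
rewrite sqr_N2 dotDl ?dotDr //; try exact: L2D.
rewrite sqrrD !sqr_N2 (dotC g f).
have := dot_le Lf Lg; have := ler_norm (dot f g); lra.
Qed.

Lemma N2Z a f : L2 f -> N2 (fun x => a * f x) = `|a| * N2 f.
Proof.
move=> Lf; rewrite /N2 dotZl // ?dotZr //; last exact: L2Z.
by rewrite mulrA -expr2 sqrtrM ?sqr_ge0 // sqrtr_sqr.
Qed.

Lemma N2N f : N2 (fun x => - f x) = N2 f.
Proof. by rewrite /N2 /dot; under eq_fun do rewrite mulrNN. Qed.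

Lemma N2BC f g : N2 (fun x => f x - g x) = N2 (fun x => g x - f x).
Proof. by rewrite -N2N; congr N2; apply/funext => x; rewrite opprB. Qed.

Lemma N2_tri g f h : L2 f -> L2 g -> L2 h ->
  N2 (fun x => f x - h x) <= N2 (fun x => f x - g x) + N2 (fun x => g x - h x).
Proof.
move=> Lf Lg Lh; rewrite (_ : (fun x => f x - h x) = (fun x => (f x - g x) + (g x - h x))).
  by apply: N2D; exact: L2B.
by apply/funext => x; rewrite addrA subrK.
Qed.

Lemma N2_cst c : N2 (fun=> c) = `|c|.
Proof.
rewrite /N2 /dot Rintegral_cst // (_ : fine (P setT) = 1) ?probability_setT // mulr1 -expr2.
exact: sqrtr_sqr.
Qed.

Lemma L2_le f g : measurable_fun setT f -> (forall x, `|f x| <= `|g x|) -> L2 g -> L2 f.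
Proof.
move=> mf fg [mg ig2]; split=> //.
apply: le_integrable ig2 => //.
  by apply/measurable_EFinP; exact: measurable_funX.
by move=> x _ /=; rewrite lee_fin !normrX lerXn2r // nnegrE.
Qed.

Lemma N2_le f g : measurable_fun setT f -> (forall x, `|f x| <= `|g x|) -> L2 g ->
  N2 f <= N2 g.
Proof.
move=> mf fg Lg; have Lf := L2_le mf fg Lg.
rewrite ler_wsqrtr // le_Rintegral //; try exact: L2_mul.
move=> x _; rewrite -!expr2 -(real_normK (num_real (f x))) -(real_normK (num_real (g x))).
by rewrite lerXn2r // nnegrE.
Qed.

Lemma dot_ae f g h : L2 f -> L2 g -> L2 h -> f = g %[ae P] -> dot f h = dot g h.
Proof.
move=> Lf Lg Lh fg; rewrite /dot /Rintegral; congr fine.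
apply: ae_eq_integral => //.
- by apply/measurable_EFinP; apply: measurable_funM; exact: L2_measurable.
- by apply/measurable_EFinP; apply: measurable_funM; exact: L2_measurable.
- by apply: filterS fg => x fg _; rewrite fg.
Qed.

Lemma N2_ae f g : L2 f -> L2 g -> f = g %[ae P] -> N2 f = N2 g.
Proof.
move=> Lf Lg fg; rewrite /N2 (dot_ae Lf Lg Lf fg) dotC.
by rewrite (dot_ae Lf Lg Lg fg).
Qed.

Lemma N2_eq0 f : L2 f -> N2 f = 0 -> f = (fun=> 0) %[ae P].
Proof.
move=> Lf /(congr1 (fun x => x ^+ 2)); rewrite sqr_N2 expr0n /= => f0.
have := dotxxP Lf; rewrite f0 => /esym i0.
have m2 : measurable_fun setT (fun x => (f x ^+ 2)%:E).
  by apply/measurable_EFinP/measurable_funX; exact: L2_measurable.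
have : ae_eq P setT (fun x => (f x ^+ 2)%:E) (cst 0%E).
  apply/ae_eq_integral_abs => //; rewrite -[RHS]i0.
  by apply: eq_integral => x _; rewrite gee0_abs // lee_fin sqr_ge0.
apply: filterS => x /(_ I) /= h.
have /eqP : f x ^+ 2 = 0 by case: h.
by rewrite sqrf_eq0 => /eqP.
Qed.

Lemma N2_sub_eq0 f g : L2 f -> L2 g -> N2 (fun x => f x - g x) = 0 -> f = g %[ae P].
Proof.
move=> Lf Lg /(N2_eq0 (L2B Lf Lg)); apply: filterS => x /(_ I) /eqP.
by rewrite subr_eq0 => /eqP.
Qed.

Lemma ae_N2_sub f g : L2 f -> L2 g -> f = g %[ae P] -> N2 (fun x => f x - g x) = 0.
Proof.
move=> Lf Lg fg; rewrite (N2_ae (L2B Lf Lg) (L2_cst 0)) ?N2_cst ?normr0 //.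
by apply: filterS fg => x /(_ I) ->; rewrite subrr.
Qed.

Lemma N2_small_ae f g : L2 f -> L2 g ->
  (forall e, 0 < e -> N2 (fun x => f x - g x) <= e) -> f = g %[ae P].
Proof.
move=> Lf Lg h; apply: N2_sub_eq0 => //; apply/eqP; rewrite eq_le N2_ge0 andbT.
by apply/ler_addgt0Pr => e e0; rewrite add0r; exact: h.
Qed.

(** The squared errors are dominated by (2 g)^2, which is integrable, so dominated convergence
    applies to them. *)
Lemma L2_dominated (f_ : nat -> T -> R) f g :
  (forall n, measurable_fun setT (f_ n)) -> measurable_fun setT f ->
  (forall x, f_ n x @[n --> \oo] --> f x) ->
  (forall n x, `|f_ n x| <= g x) -> L2 g ->
  [/\ L2 f, forall n, L2 (f_ n) & N2 (fun x => f_ n x - f x) @[n --> \oo] --> 0].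
Proof.
move=> mf_ mf cf fg Lg.
have g0 x : 0 <= g x by apply: le_trans (fg 0%N x).
have fg' x : `|f x| <= `|g x|.
  rewrite (ger0_norm (g0 x)).
  have cn : `|f_ n x| @[n --> \oo] --> `|f x| by apply: cvg_norm; exact: cf.
  rewrite -(cvg_lim _ cn) //.
  by apply: limr_le; [apply/cvg_ex; exists `|f x| | apply: nearW => n; exact: fg].
have Lf : L2 f by exact: L2_le Lg.
have Lf_ n : L2 (f_ n) by apply: (L2_le _ _ Lg) => // x; rewrite (ger0_norm (g0 x)).
split => //.
have Lg2 : L2 (fun x => 2 * g x) by exact: L2Z.
have := @dominated_convergence _ T R P setT measurableT
  (fun n x => ((f_ n x - f x) ^+ 2)%:E) (cst 0%E) (fun x => ((2 * g x) ^+ 2)%:E).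
case.
- move=> n; apply/measurable_EFinP/measurable_funX/measurable_funB => //.
- exact: measurable_cst.
- apply: aeW => x _ /=; apply/fine_cvgP; split; first exact: nearW.
  rewrite /comp /=.
  rewrite (_ : 0 = 0 ^+ 2 :> R); last by rewrite expr0n.
  apply: (@cvg_comp _ _ _ (fun n => f_ n x - f x) (fun y => y ^+ 2)) (@exprn_continuous _ 2 0).
  by rewrite -(subrr (f x)); apply: cvgB => //; exact: cvg_cst.
- by case: Lg2.
- apply: aeW => x n _ /=; rewrite lee_fin ger0_norm ?sqr_ge0 //.
  rewrite -(real_normK (num_real (_ - _))) lerXn2r ?nnegrE ?mulr_ge0 //.
  apply: le_trans (ler_normB _ _) _.
  by rewrite mulr_natl mulr2n lerD // (le_trans (fg' x)) // ger0_norm.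
move=> _ _ /=; rewrite integral0 => h.
rewrite /N2.
rewrite (_ : 0 = Num.sqrt 0 :> R); last by rewrite sqrtr0.
apply: (@cvg_comp _ _ _ (fun n => dot (fun x => f_ n x - f x) (fun x => f_ n x - f x)) Num.sqrt);
  last exact: sqrt_continuous.
have Lb n : L2 (fun x => f_ n x - f x) by exact: L2B.
have /fine_cvgP[_] : (\int[P]_x ((f_ n x - f x) ^+ 2)%:E)%E @[n --> \oo] --> 0%:E by [].
apply: cvg_trans; apply: near_eq_cvg; apply: nearW => n /=.
by rewrite -dotxxP.
Qed.

End L2.

Section tame.
Context d (T : measurableType d) (R : realType) (P : probability T R).
Implicit Types f g h : T -> R.

Lemma L2P f : f \in Lfun P 2%:E <-> L2 P f.
Proof.
split=> [Lf|[mf if2]].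
  split; last exact: Lfun2_integrable_sqr.
  by move: Lf; rewrite inE => /andP[+ _]; rewrite inE.
rewrite inE; apply/andP; split; rewrite inE //=.
rewrite /finite_norm unlock poweR_lty //.
have /integrableP[_] := if2; apply: le_lt_trans.
rewrite le_eqVlt; apply/orP; left; apply/eqP; apply: eq_integral => x _ /=.
by rewrite normrX; congr EFin; rewrite (powR_mulrn 2).
Qed.

Lemma LnormE f : L2 P f -> Lnorm P 2%:E (EFin \o f) = (N2 P f)%:E.
Proof.
move=> Lf; rewrite unlock.
rewrite (_ : \int[P]_x _ = (dot P f f)%:E)%E.
  by rewrite /poweR /N2 powR12_sqrt // dot_ge0.
rewrite dotxxP //; apply: eq_integral => x _ /=.
by rewrite (powR_mulrn 2) // real_normK ?num_real.
Qed.

(** Unlike [L2], this class is an algebra, so polynomials in Gaussian variables stay in it and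
    integrability side conditions become automatic. *)
Definition tame f := measurable_fun setT f /\
  forall n, P.-integrable setT (fun x => (`|f x| ^+ n)%:E).

Lemma tame_measurable f : tame f -> measurable_fun setT f.
Proof. by case. Qed.

Lemma tame_bound f : measurable_fun setT f ->
  (forall n, exists2 h, P.-integrable setT (EFin \o h) & forall x, `|f x| ^+ n <= h x) ->
  tame f.
Proof.
move=> mf H; split=> // n; have [h ih fh] := H n.
apply: le_integrable ih => //.
  by apply/measurable_EFinP/measurable_funX; exact: measurableT_comp.
by move=> x _ /=; rewrite lee_fin (le_trans _ (ler_norm _)) // ger0_norm // exprn_ge0.
Qed.

Lemma tame_le f g : measurable_fun setT f -> (forall x, `|f x| <= `|g x|) -> tame g -> tame f.
Proof.
move=> mf fg [mg ig]; apply: tame_bound => // n; exists (fun x => `|g x| ^+ n); [exact: ig|move=> x].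
by rewrite lerXn2r // nnegrE.
Qed.

Lemma tame_cst c : tame (fun=> c).
Proof.
split; first exact: measurable_cst.
by move=> n; apply: finite_measure_integrable_cst => //.
Qed.

Lemma ler_addX (a b : R) n : 0 <= a -> 0 <= b -> (a + b) ^+ n <= 2 ^+ n * (a ^+ n + b ^+ n).
Proof.
move=> a0 b0; rewrite mulrDr -!exprMn.
have [ab|/ltW ba] := leP a b.
  apply: (@le_trans _ _ ((2 * b) ^+ n)); last by rewrite lerDr exprn_ge0 // mulr_ge0.
  by rewrite lerXn2r ?nnegrE ?addr_ge0 ?mulr_ge0 // mulr_natl mulr2n lerD2r.
apply: (@le_trans _ _ ((2 * a) ^+ n)); last by rewrite lerDl exprn_ge0 // mulr_ge0.
by rewrite lerXn2r ?nnegrE ?addr_ge0 ?mulr_ge0 // mulr_natl mulr2n lerD2l.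
Qed.

Lemma tameD f g : tame f -> tame g -> tame (fun x => f x + g x).
Proof.
move=> [mf iF] [mg ig]; apply: tame_bound => //; first exact: measurable_funD.
move=> n; exists (fun x => 2 ^+ n * (`|f x| ^+ n + `|g x| ^+ n)).
  rewrite /comp; under eq_fun do rewrite EFinM EFinD.
  by apply: integrableZl => //; apply: integrableD.
move=> x; apply: le_trans (ler_addX _ _ _) => //.
by rewrite lerXn2r ?nnegrE ?addr_ge0 // ler_normD.
Qed.

Lemma tameM f g : tame f -> tame g -> tame (fun x => f x * g x).
Proof.
move=> [mf iF] [mg ig]; apply: tame_bound => //; first exact: measurable_funM.
move=> n; exists (fun x => `|f x| ^+ (n * 2) + `|g x| ^+ (n * 2)).
  by rewrite /comp; under eq_fun do rewrite EFinD; apply: integrableD.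
move=> x; rewrite normrM exprMn !exprM.
have := sqr_ge0 (`|f x| ^+ n - `|g x| ^+ n); rewrite sqrrB.
have : 0 <= `|f x| ^+ n * `|g x| ^+ n by rewrite mulr_ge0 // exprn_ge0.
lra.
Qed.

Lemma tameZ a f : tame f -> tame (fun x => a * f x).
Proof. by move=> tf; apply: tameM => //; exact: tame_cst. Qed.

Lemma tameN f : tame f -> tame (fun x => - f x).
Proof. by move=> /(tameZ (-1)); under eq_fun do rewrite mulN1r. Qed.

Lemma tameB f g : tame f -> tame g -> tame (fun x => f x - g x).
Proof. by move=> tf tg; apply: tameD => //; exact: tameN. Qed.

Lemma tameX n f : tame f -> tame (fun x => f x ^+ n).
Proof.
move=> tf; elim: n => [|n IH]; first exact: tame_cst.
by under eq_fun do rewrite exprS; exact: tameM.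
Qed.

Lemma tame_sum I (s : seq I) (F : I -> T -> R) :
  (forall i, tame (F i)) -> tame (fun x => \sum_(i <- s) F i x).
Proof.
move=> LF; elim: s => [|i s IH].
  by rewrite (_ : (fun x => _) = fun=> 0); [exact: tame_cst|apply/funext => x; rewrite big_nil].
rewrite (_ : (fun x => _) = fun x => F i x + \sum_(j <- s) F j x); last first.
  by apply/funext => x; rewrite big_cons.
exact: tameD.
Qed.

Lemma tame_horner (p : {poly R}) f : tame f -> tame (fun x => p.[f x]).
Proof.
move=> tf; under eq_fun do rewrite horner_coef.
by apply: tame_sum => i; apply: tameZ; exact: tameX.
Qed.

Lemma tame_integrable f : tame f -> P.-integrable setT (fun x => (f x)%:E).
Proof.
move=> [mf iF]; apply: le_integrable (iF 1%N) => //; first exact/measurable_EFinP.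
by move=> x _ /=; rewrite expr1 normr_id.
Qed.

Lemma tame_L2 f : tame f -> L2 P f.
Proof.
move=> tf; split; first by case: tf.
by apply: tame_integrable; exact: tameX.
Qed.

Lemma Rintegral_sum I (s : seq I) (F : I -> T -> R) :
  (forall i, P.-integrable setT (EFin \o F i)) ->
  Rintegral P setT (fun x => \sum_(i <- s) F i x) = \sum_(i <- s) Rintegral P setT (F i).
Proof.
move=> iF; elim: s => [|i s IH].
  rewrite big_nil (_ : (fun x => _) = fun=> 0); first by rewrite Rintegral_cst // mul0r.
  by apply/funext => x; rewrite big_nil.
rewrite big_cons -IH -RintegralD //; last first.
  rewrite (_ : _ \o _ = fun x => \sum_(i <- s) (EFin \o F i) x)%E.
    by apply: integrable_sum.
  by apply/funext => x /=; rewrite sumEFin.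
by congr Rintegral; apply/funext => x; rewrite big_cons.
Qed.

Lemma RintegralE1 f : Rintegral P setT f = dot P f (fun=> 1).
Proof. by rewrite /dot; under [RHS]eq_Rintegral do rewrite mulr1. Qed.

Lemma N2_cst1 : N2 P (fun=> 1) = 1.
Proof. by rewrite N2_cst normr1. Qed.

Definition clip (K t : R) := Num.max (- K) (Num.min t K).

Lemma clip_bound K t : 0 <= K -> `|clip K t| <= K.
Proof.
move=> K0; rewrite ler_norml /clip le_max lexx /= ge_max ge_min lexx orbT andbT.
by rewrite (le_trans _ K0) // oppr_le0.
Qed.

Lemma clip_lip K s t : `|clip K s - clip K t| <= `|s - t|.
Proof.
have h1 := ler_norm (s - t); have h2 := ler_norm (t - s); rewrite (distrC t s) in h2.
have h3 := normr_ge0 (s - t).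
rewrite /clip; case: (leP s K) => ?; case: (leP t K) => ?;
  do 2? [case: (leP (- K)) => ?]; rewrite ler_norml; apply/andP; split; lra.
Qed.

Lemma clip_id K t : `|t| <= K -> clip K t = t.
Proof.
rewrite ler_norml => /andP[a b]; rewrite /clip; rewrite min_l // max_r //.
Qed.

Lemma clip_le K t : 0 <= K -> `|clip K t| <= `|t|.
Proof.
move=> K0; have := clip_lip K t 0; rewrite subr0 (_ : clip K 0 = 0) ?subr0 //.
by rewrite clip_id // normr0.
Qed.

Lemma measurable_clip K f : measurable_fun setT f -> measurable_fun setT (fun x => clip K (f x)).
Proof.
by move=> mf; apply: measurable_maxr; [exact: measurable_cst|apply: measurable_minr; [exact: mf|exact: measurable_cst]].
Qed.

Lemma expr_lip (a b K : R) n : `|a| <= K -> `|b| <= K ->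
  `|a ^+ n - b ^+ n| <= n%:R * K ^+ n.-1 * `|a - b|.
Proof.
move=> aK bK; rewrite subrXX normrM mulrC ler_wpM2r //.
apply: le_trans (ler_norm_sum _ _ _) _.
rewrite (_ : n%:R * K ^+ n.-1 = \sum_(i < n) K ^+ n.-1); last first.
  by rewrite sumr_const card_ord mulr_natl.
apply: ler_sum => i _; rewrite normrM !normrX.
rewrite [in leRHS](_ : n.-1 = n.-1 - i + i)%N; last by rewrite subnK // -ltnS prednK // (leq_ltn_trans _ (ltn_ord i)).
rewrite exprD ler_pM ?exprn_ge0 // lerXn2r ?nnegrE //; apply: le_trans aK => //.
Qed.

(* Truncate at level K, where the integrand is Lipschitz, then let K grow. *)
Lemma moment_lsc (Z_ : nat -> T -> R) Z n (B : R) :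
  (forall m, tame (Z_ m)) -> L2 P Z ->
  N2 P (fun x => Z_ m x - Z x) @[m --> \oo] --> 0 ->
  (forall m, Rintegral P setT (fun x => `|Z_ m x| ^+ n) <= B) ->
  P.-integrable setT (fun x => (`|Z x| ^+ n)%:E) /\
  Rintegral P setT (fun x => `|Z x| ^+ n) <= B.
Proof.
move=> tZ LZ cZ hB; have mZ := L2_measurable LZ.
have mc K : measurable_fun setT (fun x => clip K (Z x)) by exact: measurable_clip.
have tc (K : nat) f : measurable_fun setT f -> tame (fun x => `|clip K%:R (f x)|).
  move=> mf; apply: (@tame_le _ (fun=> K%:R)) (tame_cst _).
    by apply: measurableT_comp => //; exact: measurable_clip.
  by move=> x; rewrite normr_id [leRHS]ger0_norm // clip_bound.
have step (K : nat) : Rintegral P setT (fun x => `|clip K%:R (Z x)| ^+ n) <= B.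
  apply/ler_addgt0Pr => e e0.
  (* A Lipschitz constant of t^n on [-K, K]. *)
  pose k : R := n%:R * K%:R ^+ n.-1.
  have k0 : 0 <= k by rewrite mulr_ge0 // exprn_ge0.
  have : k * N2 P (fun x => Z_ m x - Z x) @[m --> \oo] --> k * 0.
    by apply: cvgM => //; exact: cvg_cst.
  rewrite mulr0 => /cvgrPdist_lt /(_ e e0) [m _ /(_ m (leqnn _))] /=.
  rewrite sub0r normrN ger0_norm ?mulr_ge0 ?N2_ge0 // => hm.
  have LD := L2B (tame_L2 (tZ m)) LZ.
  have I1 := tame_integrable (tameX n (tc K _ mZ)).
  have I2 := tame_integrable (tameX n (tc K _ (tame_measurable (tZ m)))).
  have LA : L2 P (fun x => `|Z_ m x - Z x|).
    apply: (L2_le _ _ LD); last by move=> x; rewrite normr_id.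
    by apply: measurableT_comp => //; case: LD.
  have I3 : P.-integrable setT (EFin \o (fun x => `|Z_ m x - Z x|)).
    by have := L2_mul LA (L2_cst P 1); under eq_fun do rewrite mulr1.
  have I4 : P.-integrable setT (EFin \o (fun x => `|Z_ m x| ^+ n)).
    by have [_ /(_ n)] := tZ m.
  apply: (@le_trans _ _ (Rintegral P setT (fun x => `|Z_ m x| ^+ n) + Rintegral P setT (fun x => k * `|Z_ m x - Z x|))).
    rewrite -RintegralD //; last first.
      by rewrite /comp; under eq_fun do rewrite EFinM; exact: integrableZl.
    apply: le_Rintegral => //.
      rewrite /comp; under eq_fun do rewrite EFinD EFinM.
      by apply: integrableD => //; exact: integrableZl.
    move=> x _.
    have h1 : `|clip K%:R (Z_ m x)| ^+ n <= `|Z_ m x| ^+ n.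
      by rewrite lerXn2r ?nnegrE // clip_le.
    have h2 : `|clip K%:R (Z x)| ^+ n - `|clip K%:R (Z_ m x)| ^+ n <= k * `|Z_ m x - Z x|.
      apply: le_trans (ler_norm _) _.
      apply: le_trans (expr_lip _ (_ : `| `|clip K%:R (Z x)| | <= K%:R) _) _.
      - by rewrite normr_id clip_bound.
      - by rewrite normr_id clip_bound.
      rewrite ler_wpM2l //; apply: le_trans (ler_dist_dist _ _) _.
      by rewrite distrC; exact: clip_lip.
    lra.
  rewrite lerD // RintegralZl // RintegralE1.
  apply: le_trans _ (ltW hm); rewrite ler_wpM2l //.
  apply: le_trans (ler_norm _) _; apply: le_trans (dot_le LA (L2_cst P 1)) _.
  rewrite N2_cst1 mulr1; apply: N2_le => //; first by case: LA.
  by move=> x; rewrite normr_id.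
have meas (K : nat) : measurable_fun setT (fun x => (`|clip K%:R (Z x)| ^+ n)%:E).
  by apply/measurable_EFinP/measurable_funX/measurableT_comp.
have clipE x : (`|clip K%:R (Z x)| ^+ n)%:E @[K --> \oo] --> (`|Z x| ^+ n)%:E.
  apply: cvg_near_cst; exists (Num.trunc `|Z x|).+1 => // K /= hK.
  rewrite clip_id // ltW //; apply: lt_le_trans (truncnS_gt _) _.
  by rewrite ler_nat.
have nd x : nondecreasing_seq (fun K : nat => (`|clip K%:R (Z x)| ^+ n)%:E).
  move=> K L KL; rewrite lee_fin lerXn2r ?nnegrE //.
  have [zL|/ltW zL] := leP `|Z x| L%:R; first by rewrite (clip_id zL) clip_le.
  apply: (@le_trans _ _ K%:R); first exact: clip_bound.
  rewrite /clip; have [z0|z0] := leP 0 (Z x).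
    rewrite ger0_norm // in zL; rewrite min_r // max_r ?ger0_norm ?ler_nat //.
    by rewrite (le_trans _ (ler0n _ L)) // oppr_le0.
  rewrite ltr0_norm // in zL.
  rewrite min_l ?(le_trans (ltW z0)) // max_l; last by rewrite lerNr.
  by rewrite normrN ger0_norm // ler_nat.
have mono : (\int[P]_x (`|Z x| ^+ n)%:E <= B%:E)%E.
  rewrite (_ : (\int[P]_x _)%E = limn (fun K => \int[P]_x (`|clip K%:R (Z x)| ^+ n)%:E)%E); last first.
    rewrite -monotone_convergence //.
    by apply: eq_integral => x _; apply/esym/cvg_lim.
  apply: lime_le.
    apply: ereal_nondecreasing_is_cvgn => K L KL; apply: ge0_le_integral => //.
    by move=> x _; exact: nd.
  apply: nearW => K.
  have := step K; rewrite -lee_fin /Rintegral fineK //.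
  by apply: integrable_fin_num => //; exact: tame_integrable (tameX n (tc K _ mZ)).
have iZ : P.-integrable setT (fun x => (`|Z x| ^+ n)%:E).
  apply/integrableP; split; first by apply/measurable_EFinP/measurable_funX/measurableT_comp.
  apply: le_lt_trans (ltry B); apply: le_trans mono.
  rewrite le_eqVlt; apply/orP; left; apply/eqP; apply: eq_integral => x _.
  by rewrite gee0_abs // lee_fin exprn_ge0.
split=> //; rewrite -lee_fin /Rintegral fineK //.
exact: integrable_fin_num.
Qed.

End tame.

(** * Convergence of all moments *)

Section moment_convergence.
Context d (T : measurableType d) (R : realType) (P : probability T R).

(** This amounts to convergence in every L^p; the power 0 is excluded because its norm is 1. Unlike
    L^2 convergence it is preserved by products, hence by polynomials. *)
Definition mcvg (f_ : nat -> T -> R) f := [/\ forall m, tame P (f_ m), tame P f &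
  forall k, N2 P (fun x => (f_ m x - f x) ^+ k.+1) @[m --> \oo] --> 0].

Lemma squeeze0 (u v : nat -> R) : (forall n, 0 <= u n) -> (forall n, u n <= v n) ->
  v n @[n --> \oo] --> 0 -> u n @[n --> \oo] --> 0.
Proof.
move=> u0 uv v0; apply: (@squeeze_cvgr _ _ _ _ (cst 0) v) => //; last exact: cvg_cst.
by apply: nearW => n; rewrite u0 uv.
Qed.

Lemma N2_exprM k (f g : T -> R) : tame P f -> tame P g ->
  N2 P (fun x => (f x * g x) ^+ k) ^+ 2 <= N2 P (fun x => f x ^+ (k * 2)) * N2 P (fun x => g x ^+ (k * 2)).
Proof.
move=> tf tg; rewrite sqr_N2.
rewrite (_ : dot _ _ _ = dot P (fun x => f x ^+ (k * 2)) (fun x => g x ^+ (k * 2))).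
  apply: le_trans (ler_norm _) _; apply: dot_le; exact/tame_L2/tameX.
by congr Rintegral; apply/funext => x; rewrite -expr2 exprMn exprMn !exprM.
Qed.

Lemma N2_exprD k (f g : T -> R) : tame P f -> tame P g ->
  N2 P (fun x => (f x + g x) ^+ k) <= 2 ^+ k * (N2 P (fun x => f x ^+ k) + N2 P (fun x => g x ^+ k)).
Proof.
move=> tf tg.
have Lf : L2 P (fun x => `|f x| ^+ k).
  apply: L2_le (tame_L2 (tameX k tf)); last by move=> x; rewrite normrX normr_id normrX.
  by apply/measurable_funX/measurableT_comp => //; case: tf.
have Lg : L2 P (fun x => `|g x| ^+ k).
  apply: L2_le (tame_L2 (tameX k tg)); last by move=> x; rewrite normrX normr_id normrX.
  by apply/measurable_funX/measurableT_comp => //; case: tg.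
apply: (@le_trans _ _ (N2 P (fun x => 2 ^+ k * (`|f x| ^+ k + `|g x| ^+ k)))).
  apply: N2_le; last by apply: L2Z; exact: L2D.
    by apply: (@tame_measurable _ _ _ P); apply: tameX; exact: tameD.
  move=> x; rewrite normrX [leRHS]ger0_norm ?mulr_ge0 ?addr_ge0 ?exprn_ge0 //.
  by apply: le_trans (ler_addX _ _ _) => //; rewrite lerXn2r ?nnegrE ?addr_ge0 // ler_normD.
rewrite N2Z; last exact: L2D.
rewrite ger0_norm ?exprn_ge0 // ler_wpM2l ?exprn_ge0 //.
apply: le_trans (N2D Lf Lg) _; rewrite lerD //.
  apply: N2_le (tame_L2 (tameX k tf)); first by case: Lf.
  by move=> x; rewrite !normrX normr_id.
apply: N2_le (tame_L2 (tameX k tg)); first by case: Lg.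
by move=> x; rewrite !normrX normr_id.
Qed.

Lemma sqr_cvg0 (u : nat -> R) : (forall n, 0 <= u n) -> u n ^+ 2 @[n --> \oo] --> 0 ->
  u n @[n --> \oo] --> 0.
Proof.
move=> u0 cu.
have -> : u = (fun n => Num.sqrt (u n ^+ 2)).
  by apply/funext => n; rewrite sqrtr_sqr ger0_norm.
rewrite -[X in _ --> X]sqrtr0.
apply: (@cvg_comp _ _ _ (fun n => u n ^+ 2) Num.sqrt) cu _; exact: sqrt_continuous.
Qed.

Lemma mcvg_cst (c_ : nat -> R) c : c_ n @[n --> \oo] --> c ->
  mcvg (fun n _ => c_ n) (fun=> c).
Proof.
move=> cc; split; [by move=> m; exact: tame_cst|exact: tame_cst|move=> k].
under eq_fun do rewrite N2_cst normrX.
rewrite (_ : 0 = `|c - c| ^+ k.+1 :> R); last by rewrite subrr normr0 expr0n.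
apply: (@cvg_comp _ _ _ (fun m => `|c_ m - c|) (fun y => y ^+ k.+1)); last exact: exprn_continuous.
by apply: cvg_norm; apply: cvgB => //; exact: cvg_cst.
Qed.

Lemma mcvg_tame f_ f : mcvg f_ f -> tame P f. Proof. by case. Qed.

Lemma mcvg0P f_ f : mcvg f_ f ->
  forall k, N2 P (fun x => (f_ m x - f x) ^+ k.+1) @[m --> \oo] --> 0.
Proof. by case. Qed.

Lemma mcvgD f_ g_ f g : mcvg f_ f -> mcvg g_ g ->
  mcvg (fun m x => f_ m x + g_ m x) (fun x => f x + g x).
Proof.
move=> [tf_ tf cf] [tg_ tg cg]; split; [by move=> m; exact: tameD|exact: tameD|move=> k].
apply: (@squeeze0 _ (fun m => 2 ^+ k.+1 * (N2 P (fun x => (f_ m x - f x) ^+ k.+1) + N2 P (fun x => (g_ m x - g x) ^+ k.+1)))).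
- by move=> n; exact: N2_ge0.
- move=> m; apply: le_trans (N2_exprD _ _ _); [|exact: tameB|exact: tameB].
  by under eq_fun do rewrite opprD addrACA.
- rewrite -[X in _ --> X](_ : 2 ^+ k.+1 * (0 + 0) = 0); last by rewrite addr0 mulr0.
  by apply: cvgM; [exact: cvg_cst|apply: cvgD].
Qed.

(** Cauchy-Schwarz for powers: one factor tends to 0 in every L^p while the other stays bounded in
    every L^p. *)
Lemma mcvg_mul0 f_ f (g_ : nat -> T -> R) : mcvg f_ f -> (forall m, tame P (g_ m)) ->
  (forall k, exists B, forall m, N2 P (fun x => g_ m x ^+ k) <= B) ->
  mcvg (fun m x => (f_ m x - f x) * g_ m x) (fun=> 0).
Proof.
move=> [tf_ tf cf] tg_ hB; split; [by move=> m; apply: tameM => //; exact: tameB|exact: tame_cst|move=> k].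
have [B hB'] := hB (k.+1 * 2)%N.
apply: sqr_cvg0; first by move=> n; exact: N2_ge0.
(* The exponent is (k + 1) * 2, written as a successor to match the convergence of [f_]. *)
apply: (@squeeze0 _ (fun m => N2 P (fun x => (f_ m x - f x) ^+ (k.*2.+1).+1) * B)).
- by move=> n; rewrite sqr_ge0.
- move=> m; under eq_fun do rewrite subr0.
  apply: le_trans (N2_exprM _ _ _) _ => //; first exact: tameB.
  by rewrite muln2 doubleS ler_wpM2l ?N2_ge0 // -doubleS -muln2.
- rewrite -[X in _ --> X](mul0r B); apply: cvgM; [exact: cf|exact: cvg_cst].
Qed.

Lemma mcvg_bounded f_ f : mcvg f_ f ->
  forall k, exists B, forall m, N2 P (fun x => f_ m x ^+ k) <= B.
Proof.
move=> [tf_ tf cf] [|k].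
  by exists 1 => m; under eq_fun do rewrite expr0; rewrite N2_cst1.
have /cvg_seq_bounded [M [_ hM]] : cvgn (fun m => N2 P (fun x => (f_ m x - f x) ^+ k.+1)).
  by apply/cvg_ex; exists 0; exact: cf.
exists (2 ^+ k.+1 * ((M + 1) + N2 P (fun x => f x ^+ k.+1))) => m.
have -> : (fun x => f_ m x ^+ k.+1) = (fun x => ((f_ m x - f x) + f x) ^+ k.+1).
  by apply/funext => x; rewrite subrK.
apply: le_trans (N2_exprD _ _ _) _ => //; first exact: tameB.
rewrite ler_wpM2l ?exprn_ge0 // lerD2r.
apply: le_trans (ler_norm _) _.
by apply: (hM (M + 1)); rewrite ?ltrDl.
Qed.

Lemma mcvgM f_ g_ f g : mcvg f_ f -> mcvg g_ g ->
  mcvg (fun m x => f_ m x * g_ m x) (fun x => f x * g x).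
Proof.
move=> cf cg; have [tf_ tf _] := cf; have [tg_ tg _] := cg.
have cfg : mcvg (fun m x => f x * g x) (fun x => f x * g x).
  split; [by move=> m; exact: tameM|exact: tameM|move=> k].
  under eq_fun do under eq_fun do rewrite subrr expr0n.
  by under eq_fun do rewrite N2_cst normr0; exact: cvg_cst.
have c1 := mcvg_mul0 cf tg_ (mcvg_bounded cg).
have hB k : exists B, forall m : nat, N2 P (fun x => f x ^+ k) <= B by eexists.
have c2 := mcvg_mul0 (g_ := fun _ => f) cg (fun _ => tf) hB.
(* f_m g_m = (f_m - f) g_m + (g_m - g) f + f g. *)
have := mcvgD (mcvgD c1 c2) cfg.
rewrite (_ : (fun m x => _ + _ + _) = (fun m x => f_ m x * g_ m x)).
  by under [X in mcvg _ X -> _]eq_fun do rewrite !add0r.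
by apply/funext => m; apply/funext => x; ring.
Qed.

Lemma mcvg_N2 f_ f : mcvg f_ f -> N2 P (fun x => f_ m x - f x) @[m --> \oo] --> 0.
Proof. by move=> /mcvg0P /(_ 0%N); under eq_fun do under eq_fun do rewrite expr1. Qed.

Lemma mcvg_Rintegral f_ f : mcvg f_ f ->
  Rintegral P setT (f_ m) @[m --> \oo] --> Rintegral P setT f.
Proof.
move=> cf; have [tf_ tf _] := cf; apply/cvgrPdist_le => e e0.
have /cvgrPdist_le /(_ e e0) := mcvg_N2 cf; apply: filterS => m.
rewrite sub0r normrN ger0_norm ?N2_ge0 // => h.
rewrite distrC -RintegralB //; try exact: tame_integrable.
rewrite RintegralE1; apply: le_trans (dot_le _ _) _.
- exact/tame_L2/tameB.
- exact: L2_cst.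
by rewrite N2_cst1 mulr1.
Qed.

(** Serves for limits of Gaussian functionals whose law has not been computed: Cauchy bounds on the
    even moments of f_l - f_m pass to f - f_m by [moment_lsc], letting l tend to infinity at fixed
    m. *)
Lemma mcvg_of_cauchy f_ f : (forall m, tame P (f_ m)) -> L2 P f ->
  N2 P (fun x => f_ m x - f x) @[m --> \oo] --> 0 ->
  (forall k e, 0 < e -> exists M, forall m l, (M <= m)%N -> (M <= l)%N ->
    Rintegral P setT (fun x => `|f_ l x - f_ m x| ^+ (k.+1 * 2)) <= e) ->
  mcvg f_ f.
Proof.
move=> tf_ Lf cf hC.
have key k e : 0 < e -> exists M, forall m, (M <= m)%N ->
    P.-integrable setT (fun x => (`|f x - f_ m x| ^+ (k.+1 * 2))%:E) /\
    Rintegral P setT (fun x => `|f x - f_ m x| ^+ (k.+1 * 2)) <= e.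
  move=> e0; have [M hM] := hC k e e0; exists M => m Mm.
  apply: (@moment_lsc _ _ _ _ (fun l x => f_ (l + M)%N x - f_ m x)).
  - by move=> l; exact: tameB.
  - by apply: L2B => //; exact: tame_L2.
  - rewrite (_ : (fun l => _) = (fun l => N2 P (fun x => f_ (l + M)%N x - f x))).
      by rewrite (cvg_shiftn M (fun l => N2 P (fun x => f_ l x - f x))).
    by apply/funext => l; congr N2; apply/funext => x; ring.
  - by move=> l; apply: hM => //; rewrite leq_addl.
have tf : tame P f.
  apply: tame_bound; first by case: Lf.
  move=> n; have [M /(_ M (leqnn _)) [iM _]] := key n 1 ltr01.
  (* From |f|^n <= 1 + |f|^(2(n + 1)) and f = (f - f_M) + f_M. *)
  exists (fun x => 1 + 2 ^+ (n.+1 * 2) * (`|f x - f_ M x| ^+ (n.+1 * 2) + `|f_ M x| ^+ (n.+1 * 2))).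
    rewrite /comp; under eq_fun do rewrite EFinD EFinM EFinD.
    apply: integrableD => //; first by apply: finite_measure_integrable_cst => //.
    apply: integrableZl => //; apply: integrableD => //.
    by have [_ /(_ (n.+1 * 2)%N)] := tf_ M.
  move=> x; apply: (@le_trans _ _ (1 + `|f x| ^+ (n.+1 * 2))).
    have [f1|/ltW f1] := leP `|f x| 1.
      by rewrite (le_trans (exprn_ile1 _ _ f1)) // lerDl exprn_ge0.
    apply: le_trans (_ : `|f x| ^+ (n.+1 * 2) <= _); last by rewrite lerDr.
    by rewrite ler_weXn2l // muln2 -addnn addSn ltnW // ltnS leq_addr.
  rewrite lerD2l; apply: le_trans (ler_addX _ _ _) => //.
  rewrite lerXn2r ?nnegrE ?addr_ge0 //.
  by rewrite -[X in `|X| <= _](subrK (f_ M x)) ler_normD.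
split=> // k; apply: sqr_cvg0; first by move=> n; exact: N2_ge0.
apply/cvgrPdist_le => e e0; have [M hM] := key k e e0.
exists M => // m /= /hM[_]; rewrite sub0r normrN ger0_norm ?sqr_ge0 // sqr_N2.
move=> h; rewrite (_ : dot _ _ _ = Rintegral P setT (fun x => `|f x - f_ m x| ^+ (k.+1 * 2))) //.
congr Rintegral; apply/funext => x.
by rewrite distrC -normrX exprM ger0_norm ?sqr_ge0 // expr2.
Qed.

End moment_convergence.

(** Convergence at s = 1 bounds the coefficients; the first coefficient not yet known to vanish is
    then O(s) as s tends to 0. *)
Lemma pseries_coeff_eq0 (R : realType) (c : nat -> R) :
  (forall s, 0 <= s <= 1 -> (fun n => \sum_(k < n) c k * s ^+ k) @ \oo --> 0) ->
  forall n, c n = 0.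
Proof.
move=> hc.
have [M hM] : exists M, forall k, `|c k| <= M.
  have h1 := hc 1 _.
  have {}h1 : (fun n => \sum_(k < n) c k) @ \oo --> 0.
    have := hc 1; rewrite ler01 lexx => /(_ isT).
    by under eq_fun do under eq_bigr do rewrite expr1n mulr1.
  have h2 : (fun n => \sum_(k < n.+1) c k) @ \oo --> 0.
    by rewrite (cvg_shiftS (fun n => \sum_(k < n) c k)).
  have h3 : c n @[n --> \oo] --> (0 : R).
    rewrite -(subrr (0 : R)) (_ : (fun n => c n) = (fun n => \sum_(k < n.+1) c k - \sum_(k < n) c k)).
      exact: cvgB.
    by apply/funext => n; rewrite big_ord_recr /= [RHS]addrC addKr.
  have /cvg_seq_bounded [M [_ hM]] : cvgn c by apply/cvg_ex; exists 0.
  by exists (M + 1) => k; apply: (hM (M + 1)); rewrite ?ltrDl.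
have M0 : 0 <= M by apply: le_trans (hM 0%N).
move=> n; elim/ltn_ind: n => n IH.
(* The lower coefficients vanish by induction, so dividing by s^n leaves c_n plus a tail of size at
   most M (s + s^2 + ...) <= 2 M s. *)
have key s : 0 < s -> s <= 1 / 2 -> `|c n| <= 2 * M * s.
  move=> s0 s12.
  have s1 : s <= 1 by lra.
  have hs : (fun N => \sum_(k < N) c k * s ^+ k) @ \oo --> 0 by apply: hc; rewrite (ltW s0) s1.
  have hs' : (fun N => \sum_(k < N + n.+1) c k * s ^+ k) @ \oo --> 0.
    by rewrite (cvg_shiftn n.+1 (fun n => \sum_(k < n) c k * s ^+ k)).
  have E N : \sum_(k < N + n.+1) c k * s ^+ k = s ^+ n * (c n + \sum_(k < N) c (k + n.+1)%N * s ^+ k.+1).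
    rewrite addnC big_split_ord /= big_ord_recr /= big1 ?add0r; last first.
      by move=> i _; rewrite IH ?mul0r.
    rewrite mulrDr mulrC mulr_sumr; congr (_ + _); apply: eq_bigr => i _.
    by rewrite mulrCA -exprD [(n + i.+1)%N]addnS -addSn [(i + n.+1)%N]addnC.
  have geo N : \sum_(k < N) s ^+ k.+1 <= 2 * s.
    suff : \sum_(k < N) s ^+ k.+1 <= 2 * s * (1 - s ^+ N).
      move=> h; apply: le_trans h _; rewrite ler_piMr ?mulr_ge0 ?(ltW s0) //.
      by rewrite gerBl exprn_ge0 // ltW.
    elim: N => [|N IHN]; first by rewrite big_ord0 expr0 subrr mulr0.
    rewrite big_ord_recr /= !exprS; have sN : 0 <= s ^+ N by rewrite exprn_ge0 // ltW.
    have : 0 <= s * s ^+ N * (1 - 2 * s) by rewrite !mulr_ge0 ?(ltW s0) // subr_ge0; lra.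
    by lra.
  have B N : `|\sum_(k < N) c (k + n.+1)%N * s ^+ k.+1| <= 2 * M * s.
    apply: le_trans (ler_norm_sum _ _ _) _.
    apply: (@le_trans _ _ (\sum_(k < N) M * s ^+ k.+1)).
      apply: ler_sum => i _; rewrite normrM (ger0_norm (exprn_ge0 _ (ltW s0))).
      by rewrite ler_wpM2r ?exprn_ge0 // ltW.
    by rewrite -mulr_sumr (mulrC 2) -mulrA ler_wpM2l.
  apply/ler_addgt0Pl => e e0.
  have sn0 : 0 < s ^+ n by rewrite exprn_gt0.
  have /cvgrPdist_le /(_ (e * s ^+ n)) : (fun N => \sum_(k < N + n.+1) c k * s ^+ k) @ \oo --> 0 by [].
  rewrite mulr_gt0 // => /(_ isT) [N _ /(_ N (leqnn _))].
  rewrite sub0r normrN E normrM gtr0_norm // mulrC ler_pM2r // => h.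
  have := B N; have := ler_normB (c n + \sum_(k < N) c (k + n.+1)%N * s ^+ k.+1) (\sum_(k < N) c (k + n.+1)%N * s ^+ k.+1).
  rewrite addrK; lra.
apply/eqP; rewrite -normr_le0; apply/ler_addgt0Pl => e e0; rewrite addr0.
(* The added 1 keeps the denominator positive when M = 0. *)
pose s := Num.min (1 / 2) (e / (2 * M + 1)).
have s0 : 0 < s by rewrite lt_min; apply/andP; split; [lra|rewrite divr_gt0 //; lra].
apply: le_trans (key s s0 _) _; first by rewrite ge_min lexx.
apply: (@le_trans _ _ (2 * M * (e / (2 * M + 1)))).
  by rewrite ler_wpM2l ?mulr_ge0 // ge_min lexx orbT.
rewrite mulrA ler_pdivrMr; last lra.
nra.
Qed.

Lemma cvg_exp_series (R : realType) (y : R) :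
  \sum_(k < n) y ^+ k / k`!%:R @[n --> \oo] --> expR y.
Proof.
have := @is_cvg_series_exp_coeff R y.
rewrite /expR => h; apply: cvg_trans h; apply: near_eq_cvg; apply: nearW => n.
by rewrite /series /= big_mkord.
Qed.

Lemma exp_series_le (R : realType) (y : R) n : 0 <= y ->
  \sum_(k < n) y ^+ k / k`!%:R <= expR y.
Proof.
move=> y0; rewrite -(cvg_lim _ (@cvg_exp_series _ y)) //.
apply: (nondecreasing_cvgn_le (u_ := fun n => \sum_(k < n) y ^+ k / k`!%:R)); last first.
  by apply/cvg_ex; exists (expR y); exact: cvg_exp_series.
apply/nondecreasing_seqP => m; rewrite big_ord_recr /= lerDl.
by rewrite mulr_ge0 ?exprn_ge0.
Qed.

Lemma cvg_L2_Rintegral d (T : measurableType d) (R : realType) (P : probability T R)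
  (f_ : nat -> T -> R) f : (forall m, L2 P (f_ m)) -> L2 P f ->
  N2 P (fun x => f_ m x - f x) @[m --> \oo] --> 0 ->
  Rintegral P setT (f_ m) @[m --> \oo] --> Rintegral P setT f.
Proof.
move=> Lf_ Lf cf; apply/cvgrPdist_le => e e0.
have /cvgrPdist_le /(_ e e0) := cf; apply: filterS => m.
rewrite sub0r normrN ger0_norm ?N2_ge0 // => h.
have i1 g : L2 P g -> P.-integrable setT (EFin \o g).
  by move=> Lg; have := L2_mul Lg (L2_cst P 1); under eq_fun do rewrite mulr1.
rewrite distrC -RintegralB //; try exact: i1.
rewrite RintegralE1; apply: le_trans (dot_le _ _) _.
- exact: L2B.
- exact: L2_cst.
by rewrite N2_cst1 mulr1.
Qed.

(** * Gaussian moments and Hermite polynomials *)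

Section gaussian_moments.
Context d (T : measurableType d) (R : realType) (P : probability T R).
Variables (Y : T -> R) (v : R).
Hypotheses (mY : measurable_fun setT Y).
Hypothesis mgf : forall s, (\int[P]_x (expR (s * Y x))%:E = (expR (s ^+ 2 * v / 2))%:E)%E.

Lemma tame_exp (s : R) : tame P (fun x => expR (s * Y x)).
Proof.
have m1 s' : measurable_fun setT (fun x => expR (s' * Y x)).
  by apply: measurableT_comp => //; apply: measurable_funM.
apply: tame_bound => // n; exists (fun x => expR ((n%:R * s) * Y x)).
  apply/integrableP; split; first exact/measurable_EFinP.
  under eq_integral do rewrite gee0_abs ?lee_fin ?expR_ge0 //.
  by rewrite mgf ltry.
by move=> x; rewrite ger0_norm ?expR_ge0 // -mulrA expRM_natl.
Qed.

Lemma tame_expabs (s : R) : tame P (fun x => expR (`|s| * `|Y x|)).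
Proof.
apply: (@tame_le _ _ _ P _ (fun x => expR (s * Y x) + expR ((- s) * Y x))).
- apply: measurableT_comp => //; apply: measurable_funM => //; exact: measurableT_comp.
- move=> x; rewrite [leLHS]ger0_norm ?expR_ge0 // [leRHS]ger0_norm ?addr_ge0 ?expR_ge0 // -normrM.
  by have [h|h] := leP 0 (s * Y x); rewrite ?(ger0_norm h) ?(ltr0_norm h) ?mulNr (lerDl, lerDr) expR_ge0.
- by apply: tameD; exact: tame_exp.
Qed.

Lemma tame_gauss : tame P Y.
Proof.
apply: (@tame_le _ _ _ P _ (fun x => expR (`|1 : R| * `|Y x|))) => //; last exact: tame_expabs.
move=> x; rewrite [leRHS]ger0_norm ?expR_ge0 // normr1 mul1r.
by apply: le_trans (expR_ge1Dx _); rewrite lerDr.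
Qed.

(** The Taylor coefficients in s of exp(s^2 v / 2). *)
Definition mgf_coeff (n : nat) : R := if odd n then 0 else (v / 2) ^+ n./2 / (n./2)`!%:R.

(** Both sides are the coefficients of a power series with sum E exp(s Y): the left by integrating
    the exponential series term by term, with exp(|s| |Y|) as dominating function, the right by
    [mgf]. *)
Lemma moment_coeff n : Rintegral P setT (fun x => Y x ^+ n) / n`!%:R = mgf_coeff n.
Proof.
apply/eqP; rewrite -subr_eq0; apply/eqP; move: n.
apply: pseries_coeff_eq0 => s /andP[s0 s1].
rewrite (_ : (fun n => _) = (fun n =>
    \sum_(k < n) Rintegral P setT (fun x => Y x ^+ k) / k`!%:R * s ^+ k
    - \sum_(k < n) mgf_coeff k * s ^+ k)); last first.
  by apply/funext => n; rewrite -sumrB; apply: eq_bigr => k _; rewrite mulrBl.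
rewrite -[X in _ --> X](subrr (expR (s ^+ 2 * v / 2))); apply: cvgB.
  pose f n x := \sum_(k < n) (s * Y x) ^+ k / k`!%:R.
  have tf n : tame P (f n).
    by apply: tame_sum => k; under eq_fun do rewrite mulrC; apply: tameZ;
      apply: tameX; apply: tameZ; exact: tame_gauss.
  have bd n x : `|f n x| <= expR (`|s| * `|Y x|).
    apply: le_trans (exp_series_le n (_ : 0 <= `|s| * `|Y x|)); last by rewrite mulr_ge0.
    apply: le_trans (ler_norm_sum _ _ _) _; apply: ler_sum => k _.
    by rewrite normrM normrX normrM [X in _ * X]ger0_norm ?invr_ge0.
  have [Lf Lfn cf] := @L2_dominated _ _ _ P f (fun x => expR (s * Y x)) (fun x => expR (`|s| * `|Y x|))
    (fun n => tame_measurable (tf n)) (tame_measurable (tame_exp s))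
    (fun x => @cvg_exp_series _ _) bd (tame_L2 (tame_expabs s)).
  have -> : expR (s ^+ 2 * v / 2) = Rintegral P setT (fun x => expR (s * Y x)).
    by rewrite /Rintegral mgf.
  apply: cvg_trans (cvg_L2_Rintegral Lfn Lf cf).
  apply: near_eq_cvg; apply: nearW => n /=; rewrite Rintegral_sum => [|k].
    apply: eq_bigr => k _; rewrite mulrAC -mulrA mulrC -RintegralZl //; last first.
      exact/tame_integrable/tameX/tame_gauss.
    by apply: eq_Rintegral => x _; rewrite exprMn; ring.
  apply: tame_integrable; under eq_fun do rewrite mulrC; apply: tameZ.
  by apply: tameX; apply: tameZ; exact: tame_gauss.
(* [uphalf n] counts the even k < n, the only ones that contribute. *)
have E n : \sum_(k < n) mgf_coeff k * s ^+ k = \sum_(k < uphalf n) (s ^+ 2 * v / 2) ^+ k / k`!%:R.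
  elim: n => [|n IH]; first by rewrite !big_ord0.
  rewrite big_ord_recr IH /= uphalf_half /mgf_coeff; case: (boolP (odd n)) => on.
    by rewrite mul0r addr0.
  rewrite add0n big_ord_recr /=; congr (_ + _).
  rewrite -[in s ^+ n](odd_double_half n) (negbTE on) add0n -mul2n exprM.
  rewrite (_ : s ^+ 2 * v / 2 = v / 2 * s ^+ 2); last by ring.
  by rewrite [in RHS]exprMn mulrAC.
under eq_fun do rewrite E.
apply: (@cvg_comp _ _ _ uphalf (fun n => \sum_(k < n) (s ^+ 2 * v / 2) ^+ k / k`!%:R)); last exact: cvg_exp_series.
move=> A [N _ hN]; exists N.*2 => // n /= Nn; apply: hN => /=.
by rewrite uphalf_half; apply: leq_trans (leq_addl _ _); rewrite -(doubleK N) half_leq.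
Qed.

Lemma moment1 : Rintegral P setT Y = 0.
Proof.
have := moment_coeff 1; rewrite /mgf_coeff /= divr1.
by under eq_Rintegral do rewrite expr1.
Qed.

Lemma moment_rec n : Rintegral P setT (fun x => Y x ^+ n.+2) = n.+1%:R * v * Rintegral P setT (fun x => Y x ^+ n).
Proof.
have h1 := moment_coeff n.+2; have h2 := moment_coeff n.
have F k : (k`!%:R : R) != 0 by rewrite pnatr_eq0 -lt0n fact_gt0.
have -> : Rintegral P setT (fun x => Y x ^+ n.+2) = mgf_coeff n.+2 * n.+2`!%:R by rewrite -h1 divfK.
have -> : Rintegral P setT (fun x => Y x ^+ n) = mgf_coeff n * n`!%:R by rewrite -h2 divfK.
rewrite /mgf_coeff /= negbK; have [on|on] := boolP (odd n); first by rewrite !mul0r mulr0.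
have [k nk] : exists k, n = k.*2 by exists n./2; rewrite -[LHS]odd_double_half (negbTE on).
rewrite {on h1 h2}nk doubleK !factS !natrM exprS.
have -> : (k.*2.+2%:R : R) = 2 * k.+1%:R by rewrite -natrM mul2n.
have := F k; have : (k.+1%:R : R) != 0 by rewrite pnatr_eq0.
by move=> ? ?; field; apply/andP.
Qed.

(** Gaussian integration by parts. By linearity only monomials matter, and there it is the recursion
    between moments. *)
Lemma stein1 (p : {poly R}) :
  Rintegral P setT (fun x => Y x * p.[Y x]) = v * Rintegral P setT (fun x => p^`().[Y x]).
Proof.
have tY := tame_gauss.
have ih (q : {poly R}) : P.-integrable setT (fun x => (Y x * q.[Y x])%:E).
  by apply: tame_integrable; apply: tameM => //; exact: tame_horner.
have id (q : {poly R}) : P.-integrable setT (fun x => (q.[Y x])%:E).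
  by apply: tame_integrable; exact: tame_horner.
rewrite -(coefK p) poly_def; elim/big_ind: _ => [|p1 p2 h1 h2|i _].
- rewrite deriv0; under eq_Rintegral do rewrite horner0 mulr0.
  by under [in RHS]eq_Rintegral do rewrite horner0; rewrite Rintegral_cst // mul0r mulr0.
- rewrite derivD; under eq_Rintegral do rewrite hornerD mulrDr.
  under [in RHS]eq_Rintegral do rewrite hornerD.
  by rewrite !RintegralD //; (try exact: id); (try exact: ih); rewrite h1 h2 mulrDr.
rewrite derivZ; under eq_Rintegral do rewrite hornerZ mulrCA.
under [in RHS]eq_Rintegral do rewrite hornerZ.
rewrite !RintegralZl //; (try exact: id); (try exact: ih); rewrite mulrCA; congr (_ * _).
case: (val i) => [|n].
  rewrite derivXn mulr0n; under eq_Rintegral do rewrite hornerXn expr0 mulr1.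
  by under [in RHS]eq_Rintegral do rewrite horner0; rewrite Rintegral_cst // mul0r mulr0 moment1.
rewrite derivXn /=; under eq_Rintegral do rewrite hornerXn -exprS.
under [in RHS]eq_Rintegral do rewrite hornerMn hornerXn -mulr_natl.
rewrite moment_rec RintegralZl //; first by ring.
exact/tame_integrable/tameX.
Qed.

End gaussian_moments.

Section hermite_polynomials.
Variable R : realType.

(** Defined by recurrence rather than by rescaling the case v = 1, so that v = 0, where it is
    ['X^n], and limits in v need no separate treatment. *)
Fixpoint He (v : R) n : {poly R} :=
  if n isn't n'.+1 then 1 else
  if n' isn't n''.+1 then 'X else 'X * He v n' - (n'%:R * v) *: He v n''.

Lemma HeSS v n : He v n.+2 = 'X * He v n.+1 - (n.+1%:R * v) *: He v n.
Proof. by []. Qed.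

Lemma deriv_He v n : (He v n.+1)^`() = n.+1%:R *: He v n.
Proof.
elim/ltn_ind: n => -[|[|n]] IH; first by rewrite derivX scale1r.
  rewrite HeSS (_ : He v 0 = 1) // (_ : He v 1 = 'X) // derivB derivM derivZ derivX.
  by rewrite (derivC 1) scaler0 subr0 mul1r mulr1 -mulr2n scaler_nat.
rewrite HeSS derivB derivM derivZ derivX mul1r !IH // HeSS.
rewrite -!mul_polyC !polyCM !polyC_natr; ring.
Qed.

Lemma HeS v n : He v n.+1 = 'X * He v n - v *: (He v n)^`().
Proof.
case: n => [|n].
  by rewrite /= (_ : 1^`() = 0) ?scaler0 ?subr0 ?mulr1 //; exact: (derivC 1).
by rewrite HeSS deriv_He scalerA (mulrC v).
Qed.

(** The n-th derivative of exp(- t^2 / 2) is (-1)^n He_n(t) exp(- t^2 / 2); sign and exponential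
    cancel against those in [hermite]. *)
Lemma hermiteE n (x : R) : hermite n x = (He 1 n).[x] / n`!%:R.
Proof.
rewrite /hermite.
have E k : derive1n k (fun t : R => expR (- (t ^+ 2) / 2)) =
    (fun t => (-1) ^+ k * (He 1 k).[t] * expR (- (t ^+ 2) / 2)).
  elim: k => [|k IH]; first by apply/funext => t; rewrite expr0 hornerC !mul1r.
  rewrite derive1nS IH; apply/funext => t.
  pose q : {poly R} := - 2^-1 *: 'X^2.
  have qE u : - (u ^+ 2) / 2 = q.[u] by rewrite /q hornerZ hornerXn mulNr mulrC mulNr.
  rewrite (_ : (fun _ => _) = (horner ((-1) ^+ k *: He 1 k) * (expR \o horner q))); last first.
    by apply/funext => u; rewrite qE /= -hornerZ.
  rewrite derive1E (@derive_val _ _ _ _ _ _ _ (is_deriveM (is_derive_poly _ t)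
    (is_derive1_comp (is_derive_expR _) (is_derive_poly q t)))).
  transitivity (((-1) ^+ k *: He 1 k).[t] * (expR q.[t] * q^`().[t])
    + expR q.[t] * ((-1) ^+ k *: He 1 k)^`().[t]); first by [].
  have -> : q^`().[t] = - t by rewrite /q derivZ derivXn hornerZ hornerMn hornerXn expr1; lra.
  rewrite qE; set E0 := expR q.[t]; clearbody E0.
  rewrite HeS derivZ !hornerZ hornerD hornerN hornerZ hornerM hornerX exprS.
  ring.
have E2 : expR (x ^+ 2 / 2) * expR (- x ^+ 2 / 2) = 1 by rewrite -expRD mulNr subrr expR0.
rewrite E (_ : (He 1 n).[x] / n`!%:R = (-1) ^+ n * (-1) ^+ n * (He 1 n).[x] / n`!%:R
  * (expR (x ^+ 2 / 2) * expR (- x ^+ 2 / 2))); first by ring.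
by rewrite E2 mulr1 -exprMn mulN1r opprK expr1n mul1r.
Qed.

End hermite_polynomials.

Section normal_law.
Variable R : realType.

(** The Radon-Nikodym derivative of the normal law agrees almost everywhere with the density, as
    both have the same integral over every measurable set. *)
Lemma integral_normal_prob (s : R) (f : R -> \bar R) : 
  (forall x, 0 <= f x)%E -> measurable_fun setT f ->
  (\int[normal_prob 0 s]_x f x = \int[lebesgue_measure]_x (f x * (normal_pdf 0 s x)%:E))%E.
Proof.
move=> f0 mf.
rewrite -(Radon_Nikodym_SigmaFinite.change_of_variables (normal_prob_dominates 0 s)) //.
apply: ae_eq_integral => //.
- apply: emeasurable_funM => //; apply: (measurable_int lebesgue_measure).
  by apply: Radon_Nikodym_SigmaFinite.f_integrable; exact: normal_prob_dominates.
- apply: emeasurable_funM => //; apply/measurable_EFinP; exact: measurable_normal_pdf.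
- apply: ae_eqe_mul2l => /=.
  apply: integral_ae_eq => //=.
  + by apply: Radon_Nikodym_SigmaFinite.f_integrable; exact: normal_prob_dominates.
  + by apply/measurable_EFinP; exact: measurable_normal_pdf.
  + move=> E _ mE; rewrite -Radon_Nikodym_SigmaFinite.f_integral //.
    exact: normal_prob_dominates.
Qed.

(** Completing the square: exp(t x) times the centered density is a constant times the density with
    mean t s^2. *)
Lemma normal_mgf (s t : R) : s != 0 ->
  (\int[normal_prob 0 s]_x (expR (t * x))%:E = (expR (t ^+ 2 * s ^+ 2 / 2))%:E)%E.
Proof.
move=> s0; rewrite integral_normal_prob => [|x|]; first last.
- by apply/measurable_EFinP/measurableT_comp => //; exact: measurable_funM.
- by rewrite lee_fin expR_ge0.
transitivity (\int[lebesgue_measure]_x ((expR (t ^+ 2 * s ^+ 2 / 2))%:E * (normal_pdf (t * s ^+ 2) s x)%:E))%E.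
  apply: eq_integral => x _; rewrite -!EFinM !normal_pdfE //; congr EFin.
  rewrite mulrCA [in RHS]mulrCA; congr (_ * _).
  by rewrite /normal_fun -!expRD; congr expR; field.
rewrite ge0_integralZl //; last first.
- by move=> x _; rewrite lee_fin normal_pdf_ge0.
- by apply/measurable_EFinP; exact: measurable_normal_pdf.
by rewrite integral_normal_pdf mule1.
Qed.

End normal_law.

(** A nonzero difference would have the roots 0, 1, ..., as many as its size, which is one too
    many. *)
Lemma horner_inj (R : realType) (p r : {poly R}) : (forall s, p.[s] = r.[s]) -> p = r.
Proof.
move=> h; apply/eqP; rewrite -subr_eq0; apply: contraT => pr0.
have := @max_poly_roots _ (p - r) [seq i%:R | i <- iota 0 (size (p - r))] pr0.
rewrite size_map size_iota ltnn => ->//.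
  by apply/allP => s _; rewrite /root !hornerE h subrr.
by rewrite map_inj_uniq ?iota_uniq // => i j /eqP; rewrite eqr_nat => /eqP.
Qed.

(** * Inner products and linear functionals of a Gaussian measure *)

Section inner_product_theory.
Context (R : realType) (X : normedModType R) (ip : inner_product X).
Implicit Types x y z : X.

Lemma innerDr x y z : ip x (y + z) = ip x y + ip x z.
Proof. by rewrite innerC innerDl !(innerC ip x). Qed.
Lemma innerZr a x y : ip x (a *: y) = a * ip x y.
Proof. by rewrite innerC innerZl innerC. Qed.
Lemma inner0l x : ip 0 x = 0.
Proof. by rewrite -(scale0r x) innerZl mul0r. Qed.
Lemma inner0r x : ip x 0 = 0.
Proof. by rewrite innerC inner0l. Qed.
Lemma innerNl x y : ip (- x) y = - ip x y.
Proof. by rewrite -scaleN1r innerZl mulN1r. Qed.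
Lemma innerNr x y : ip x (- y) = - ip x y.
Proof. by rewrite innerC innerNl innerC. Qed.
Lemma innerBl x y z : ip (x - y) z = ip x z - ip y z.
Proof. by rewrite innerDl innerNl. Qed.
Lemma innerBr x y z : ip x (y - z) = ip x y - ip x z.
Proof. by rewrite innerDr innerNr. Qed.
Lemma inner_suml I (s : seq I) (Q : pred I) (F : I -> X) y :
  ip (\sum_(i <- s | Q i) F i) y = \sum_(i <- s | Q i) ip (F i) y.
Proof.
elim/big_rec2: _ => [|i a b _ <-]; first exact: inner0l.
by rewrite innerDl.
Qed.
Lemma inner_sumr I (s : seq I) (Q : pred I) (F : I -> X) y :
  ip y (\sum_(i <- s | Q i) F i) = \sum_(i <- s | Q i) ip y (F i).
Proof. by rewrite innerC inner_suml; apply: eq_bigr => i _; rewrite innerC. Qed.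

Lemma inner_ge0 x : 0 <= ip x x.
Proof. by rewrite inner_norm sqr_ge0. Qed.

Lemma inner_eq0 x : ip x x = 0 -> x = 0.
Proof. by move=> /eqP; rewrite inner_norm sqrf_eq0 normr_eq0 => /eqP. Qed.

Lemma inner_le x y : `|ip x y| <= `|x| * `|y|.
Proof.
rewrite -(@ler_pXn2r _ 2) // ?nnegrE ?mulr_ge0 //.
rewrite exprMn -!(inner_norm ip) real_normK ?num_real //.
apply: psd_cauchy_schwarz => t; have := inner_ge0 (t *: x + y).
rewrite innerDl !innerDr !innerZl !innerZr (innerC _ y x).
by move=> h; rewrite (_ : _ + _ + _ = t * (t * ip x x) + t * ip x y + (t * ip x y + ip y y)) //; ring.
Qed.

Lemma norm_inner x : `|x| = Num.sqrt (ip x x).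
Proof. by rewrite inner_norm sqrtr_sqr normr_id. Qed.

Lemma inner_cont y : continuous (fun x => ip x y).
Proof.
move=> x; apply/cvgrPdist_lt => e e0; near=> z.
rewrite -innerBl; apply: le_lt_trans (inner_le _ _) _.
apply: (@le_lt_trans _ _ (`|x - z| * (`|y| + 1))); first by rewrite ler_wpM2l // lerDl.
rewrite -ltr_pdivlMr ?ltr_wpDl //.
near: z; apply: cvgr_dist_lt => //; by rewrite divr_gt0 // ltr_wpDl.
Unshelve. all: by end_near. Qed.

Lemma inner_cvg (u : nat -> X) x y : u n @[n --> \oo] --> x ->
  ip (u n) y @[n --> \oo] --> ip x y.
Proof. by move=> ux; apply: (@cvg_comp _ _ _ u (fun x => ip x y)) ux _; exact: inner_cont. Qed.

Lemma continuous_borel_measurable (f : X -> R) : continuous f ->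
  measurable_fun setT (f : borel X -> R).
Proof.
move=> /continuousP cf; apply: (measurability _ (RGenOpens.measurableE R)).
move=> _ [_ [a [b ->]] <-]; rewrite setTI.
by apply: sub_sigma_algebra; apply: cf; exact: interval_open.
Qed.

Lemma measurable_inner y : measurable_fun setT (fun x : borel X => ip x y).
Proof. by apply: continuous_borel_measurable; exact: inner_cont. Qed.

End inner_product_theory.

Section gaussian_linear.
Context (R : realType) (X : normedModType R) (ip : inner_product X) (g : gaussian ip).
Local Notation P := (glaw g).
Local Notation E f := (Rintegral P setT (f : borel X -> R)).
Implicit Types z w u : X.

Definition cov z w := ip (gcov g z) w.

Lemma gcov_linear a x y : gcov g (a *: x + y) = a *: gcov g x + gcov g y.
Proof. by have [[_ + _] _ _] := gcov_nonneg g; apply. Qed.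

Lemma covC z w : cov z w = cov w z.
Proof. by rewrite /cov; have [_ /(_ z w I I) /= -> _] := gcov_nonneg g; rewrite innerC. Qed.

Lemma cov_linear a x y w : cov (a *: x + y) w = a * cov x w + cov y w.
Proof. by rewrite /cov gcov_linear innerDl innerZl. Qed.

Lemma covDl x y w : cov (x + y) w = cov x w + cov y w.
Proof. by rewrite -[x]scale1r cov_linear mul1r scale1r. Qed.

Lemma cov0l w : cov 0 w = 0.
Proof. by have := covDl 0 0 w; rewrite addr0 => /eqP; rewrite -subr_eq0 opprD addrA subrr add0r oppr_eq0 => /eqP. Qed.

Lemma covZl a x w : cov (a *: x) w = a * cov x w.
Proof. by rewrite -[a *: x]addr0 cov_linear cov0l addr0. Qed.

Lemma covDr x y w : cov w (x + y) = cov w x + cov w y.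
Proof. by rewrite covC covDl !(covC w). Qed.
Lemma covZr a x w : cov w (a *: x) = a * cov w x.
Proof. by rewrite covC covZl covC. Qed.

Lemma cov_ge0 z : 0 <= cov z z.
Proof. by have [_ _ /(_ z I)] := gcov_nonneg g. Qed.

(** The integral is transported to the real line, where the marginal is given; variance 0 is treated
    apart because the marginal is then a Dirac mass. *)
Lemma gauss_mgf z (s : R) :
  (\int[P]_x (expR (s * ip x z))%:E = (expR (s ^+ 2 * cov z z / 2))%:E)%E.
Proof.
pose RT := measurableTypeR R.
have mz : measurable_fun setT ((fun x => ip x z) : borel X -> RT) by exact: measurable_inner.
pose Ymix := isMeasurableFun.Build _ _ (borel X) RT (fun x => ip x z) mz.
pose Y : {mfun borel X >-> RT} := HB.pack (fun x : borel X => ip x z) Ymix.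
pose pushed : {measure set RT -> \bar R} := pushforward P Y.
pose F (t : RT) : \bar R := (expR (s * t))%:E.
have mF : measurable_fun setT F.
  by apply/measurable_EFinP/measurableT_comp => //; exact: measurable_funM.
have e0 : {in setT, forall y : RT, (0 <= F y)%E}.
  by move=> y _; rewrite lee_fin expR_ge0.
have law A : measurable A -> pushed mz A = centered_normal (cov z z) A.
  by move=> mA; rewrite -(glaw_marginal g z mA).
transitivity (\int[pushed mz]_(y in setT) F y)%E.
  by rewrite (@ge0_integral_pushforward _ _ (borel X) RT R (fun x => ip x z) mz P setT F).
have [q0|q0] := eqVneq (cov z z) 0.
  rewrite (@eq_measure_integral _ _ R setT (\d_(0 : RT)) (pushed mz) F) => [|A mA _].
    by rewrite integral_dirac // diracT mul1e /F mulr0 q0 mulr0 mul0r.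
  by rewrite law // /centered_normal q0 eqxx.
rewrite (@eq_measure_integral _ _ R setT (normal_prob 0 (Num.sqrt (cov z z))) (pushed mz) F) => [|A mA _]; last first.
  by rewrite law // /centered_normal (negbTE q0).
rewrite normal_mgf ?sqr_sqrtr ?cov_ge0 // sqrtr_eq0 -ltNge lt_neqAle eq_sym q0.
exact: cov_ge0.
Qed.

Lemma tame_inner z : tame P (fun x => ip x z).
Proof. exact: (tame_gauss (@measurable_inner _ _ ip z) (gauss_mgf z)). Qed.

Lemma tame_expabs_inner z (s : R) : tame P (fun x => expR (`|s| * `|ip x z|)).
Proof. exact: (tame_expabs (@measurable_inner _ _ ip z) (gauss_mgf z)). Qed.

Lemma mean_inner z : E (fun x => ip x z) = 0.
Proof. exact: (moment1 (@measurable_inner _ _ ip z) (gauss_mgf z)). Qed.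

Lemma moment_rec_inner z n :
  E (fun x => ip x z ^+ n.+2) = n.+1%:R * cov z z * E (fun x => ip x z ^+ n).
Proof. exact: (moment_rec (@measurable_inner _ _ ip z) (gauss_mgf z)). Qed.

Lemma stein1_inner z (p : {poly R}) :
  E (fun x => ip x z * p.[ip x z]) = cov z z * E (fun x => p^`().[ip x z]).
Proof. exact: (stein1 (@measurable_inner _ _ ip z) (gauss_mgf z)). Qed.

Lemma integrable_tame (f : X -> R) : tame P f -> P.-integrable setT (fun x : borel X => (f x)%:E).
Proof. exact: tame_integrable. Qed.

(** The map s |-> E (h <x, z + s w>^N) as a polynomial. Its coefficients are the mixed moments in z
    and w, so an identity valid for every single functional yields identities for pairs. *)
Definition moment_poly (h : X -> R) z w N : {poly R} :=
  \poly_(b < N.+1) ('C(N, b)%:R * E (fun x => h x * (ip x z ^+ (N - b) * ip x w ^+ b))).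

Lemma moment_polyE h z w N s : tame P h ->
  (moment_poly h z w N).[s] = E (fun x => h x * ip x (z + s *: w) ^+ N).
Proof.
move=> th; rewrite horner_poly.
rewrite (_ : (fun x => h x * _) = fun x => \sum_(b < N.+1)
   ('C(N, b)%:R * s ^+ b) * (h x * (ip x z ^+ (N - b) * ip x w ^+ b))); last first.
  apply/funext => x; rewrite innerDr innerZr exprDn mulr_sumr; apply: eq_bigr => b _.
  by rewrite exprMn -mulr_natl; ring.
have t b : tame P (fun x => h x * (ip x z ^+ (N - b) * ip x w ^+ b)).
  by apply: tameM => //; apply: tameM; apply: tameX; exact: tame_inner.
rewrite Rintegral_sum => [|b]; last by apply/integrable_tame/tameZ; exact: t.
apply: eq_bigr => b _; rewrite RintegralZl //; last exact/integrable_tame/t.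
by ring.
Qed.

Lemma coef_mpoly h z w N b : (b <= N)%N ->
  (moment_poly h z w N)`_b = 'C(N, b)%:R * E (fun x => h x * (ip x z ^+ (N - b) * ip x w ^+ b)).
Proof. by move=> bN; rewrite coef_poly ltnS bN. Qed.

(** The moment recursion holds for the functional of every z + s w; comparing coefficients of s
    links the moments linear in w in degrees n + 1 and n - 1, and strong induction solves this
    relation. *)
Lemma stein_pow w z n :
  E (fun x => ip x w * ip x z ^+ n.+1) = n.+1%:R * cov w z * E (fun x => ip x z ^+ n).
Proof.
have t1 : tame P (fun=> 1) by exact: tame_cst.
have id1 N : moment_poly (fun=> 1) z w N.+2 =
    N.+1%:R *: (((cov z z)%:P + (2 * cov w z) *: 'X + (cov w w) *: 'X^2) * moment_poly (fun=> 1) z w N).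
  apply: horner_inj => s; rewrite moment_polyE // hornerZ hornerM !hornerD hornerC !hornerZ hornerXn hornerX moment_polyE //.
  under eq_Rintegral do rewrite mul1r.
  rewrite moment_rec_inner; under [in RHS]eq_Rintegral do rewrite mul1r.
  rewrite covDl !covDr covZl !covZr (covC z w) covZl; ring.
have id2 N : N.+2%:R * E (fun x => ip x w * ip x z ^+ N.+1) =
    N.+1%:R * (cov z z * (N%:R * E (fun x => ip x w * ip x z ^+ N.-1)) + 2 * cov w z * E (fun x => ip x z ^+ N)).
  have /(congr1 (fun p : {poly R} => p`_1)) := id1 N.
  rewrite coef_mpoly // coefZ bin1 subSS subn0.
  under eq_Rintegral do rewrite mul1r expr1 mulrC.
  move=> ->; congr (_ * _).
  rewrite mulrDl mulrDl !coefD coefCM -!scalerAl !coefZ coefXM coefXnM /= mulr0 addr0.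
  rewrite (_ : (moment_poly _ _ _ _)`_0 = E (fun x => ip x z ^+ N)); last first.
    rewrite coef_mpoly // bin0 mul1r subn0.
    by apply: eq_Rintegral => x _; rewrite mul1r expr0 mulr1.
  rewrite (_ : (moment_poly _ _ _ _)`_1 = N%:R * E (fun x => ip x w * ip x z ^+ N.-1)).
    by rewrite -mulrA.
  case: N => [|N]; first by rewrite mul0r /moment_poly coef_poly ltnn.
  rewrite coef_mpoly // bin1 subSS subn0; congr (_ * _).
  by apply: eq_Rintegral => x _; rewrite mul1r expr1 mulrC.
elim/ltn_ind: n => n IH.
have := id2 n.
(* Induction and [moment_rec_inner] evaluate the lower mixed moment; the total factor n + 2 then
   cancels on both sides. *)
rewrite (_ : cov z z * _ = n%:R * cov w z * E (fun x => ip x z ^+ n)); last first.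
  case: n IH {id1 id2} => [|[|n]] IH; first by rewrite !mul0r mulr0.
    under eq_Rintegral do rewrite expr0 mulr1.
    under [in RHS]eq_Rintegral do rewrite expr1.
    by rewrite !mean_inner !mulr0.
  by rewrite IH // moment_rec_inner; ring.
have n0 : (n.+2%:R : R) != 0 by rewrite pnatr_eq0.
move=> h; apply: (mulfI n0); rewrite h.
rewrite (_ : n.+2%:R = n%:R + 2 :> R); last by rewrite -natrD addn2.
ring.
Qed.

(** The coefficient of s^b in [stein_pow] applied to u and z + s w. *)
Lemma stein_mixed u z w a b :
  E (fun x => ip x u * (ip x z ^+ a * ip x w ^+ b)) =
  a%:R * cov u z * E (fun x => ip x z ^+ a.-1 * ip x w ^+ b) +
  b%:R * cov u w * E (fun x => ip x z ^+ a * ip x w ^+ b.-1).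
Proof.
case Eab: (a + b)%N => [|N].
  have [-> ->] : a = 0%N /\ b = 0%N by move/eqP: Eab; rewrite addn_eq0 => /andP[/eqP -> /eqP ->].
  rewrite !mul0r addr0; under eq_Rintegral do rewrite !expr0 !mulr1.
  exact: mean_inner.
have bN : (b <= N.+1)%N by rewrite -Eab leq_addl.
have aE : a = (N.+1 - b)%N by rewrite -Eab addnK.
have t1 : tame P (fun=> 1) by exact: tame_cst.
have id1 : moment_poly (fun x => ip x u) z w N.+1 =
    N.+1%:R *: (((cov u z)%:P + (cov u w) *: 'X) * moment_poly (fun=> 1) z w N).
  apply: horner_inj => s; rewrite moment_polyE; last exact: tame_inner.
  rewrite hornerZ hornerM !hornerD hornerC !hornerZ hornerX moment_polyE //.
  rewrite stein_pow; under [in RHS]eq_Rintegral do rewrite mul1r.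
  rewrite covDr covZr; ring.
have /(congr1 (fun p : {poly R} => p`_b)) := id1.
rewrite coef_mpoly // coefZ mulrDl coefD coefCM -scalerAl coefZ coefXM -aE.
have c0 : ('C(N.+1, b)%:R : R) != 0 by rewrite pnatr_eq0 -lt0n bin_gt0.
move=> h; apply: (mulfI c0); rewrite {}h mulrDr [RHS]mulrDr; congr (_ + _).
- have [bN'|bN'] := leqP b N; last first.
    have -> : a = 0%N by apply/eqP; rewrite aE subn_eq0.
    by rewrite /moment_poly coef_poly ltnS leqNgt bN' /= !mul0r !mulr0.
  rewrite coef_mpoly // (_ : E (fun x => ip x z ^+ a.-1 * _) = E (fun x => 1 * (ip x z ^+ (N - b) * ip x w ^+ b))); last first.
    by apply: eq_Rintegral => x _; rewrite mul1r aE subSn.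
  have : (N.+1%:R * 'C(N, b)%:R : R) = 'C(N.+1, b)%:R * a%:R.
    by rewrite -!natrM (mul_bin_down N.+1) aE mulnC.
  move=> h; rewrite mulrCA [RHS]mulrA -[RHS](mulrA) mulrA; rewrite !mulrA.
  rewrite [in RHS]mulrAC -h; ring.
- case: b bN aE c0 Eab => [|b] bN aE c0 Eab /=; first by rewrite !mulr0 !mul0r mulr0.
  rewrite coef_mpoly // (_ : E (fun x => ip x z ^+ a * _) = E (fun x => 1 * (ip x z ^+ (N - b) * ip x w ^+ b))); last first.
    by apply: eq_Rintegral => x _; rewrite mul1r aE subSS.
  have : (N.+1%:R * 'C(N, b)%:R : R) = 'C(N.+1, b.+1)%:R * b.+1%:R.
    by rewrite -!natrM (mul_bin_diag N.+1) mulnC.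
  move=> h; rewrite (_ : _ * (b.+1%:R * _ * _) = ('C(N.+1, b.+1)%:R * b.+1%:R) * cov u w * E (fun x => 1 * (ip x z ^+ (N - b) * ip x w ^+ b))); last by ring.
  by rewrite -h; ring.
Qed.

Definition He_at n z (x : X) : R := (He (cov z z) n).[ip x z].

Lemma tame_He_at n z : tame P (He_at n z).
Proof. by apply: tame_horner; exact: tame_inner. Qed.

Lemma stein_poly (p : {poly R}) z w b :
  E (fun x => ip x z * (p.[ip x z] * ip x w ^+ b)) =
  cov z z * E (fun x => p^`().[ip x z] * ip x w ^+ b) +
  b%:R * cov z w * E (fun x => p.[ip x z] * ip x w ^+ b.-1).
Proof.
have tp (q : {poly R}) k : tame P (fun x => q.[ip x z] * ip x w ^+ k).
  by apply: tameM; [apply: tame_horner; exact: tame_inner|apply: tameX; exact: tame_inner].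
have tp' (q : {poly R}) k : tame P (fun x => ip x z * (q.[ip x z] * ip x w ^+ k)).
  by apply: tameM => //; exact: tame_inner.
have i0 k : E (fun x => (0 : {poly R}).[ip x z] * ip x w ^+ k) = 0.
  by under eq_Rintegral do rewrite horner0 mul0r; rewrite Rintegral_cst // mul0r.
rewrite -(coefK p) poly_def; elim/big_ind: _ => [|p1 p2 h1 h2|i _].
- rewrite deriv0 !i0; under eq_Rintegral do rewrite horner0 mul0r mulr0.
  by rewrite Rintegral_cst // mul0r !mulr0 addr0.
- rewrite derivD.
  have D k (q r : {poly R}) : E (fun x => (q + r).[ip x z] * ip x w ^+ k) =
      E (fun x => q.[ip x z] * ip x w ^+ k) + E (fun x => r.[ip x z] * ip x w ^+ k).
    rewrite -RintegralD //; try exact/integrable_tame/tp.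
    by apply: eq_Rintegral => x _; rewrite hornerD mulrDl.
  rewrite !D (_ : E _ = E (fun x => ip x z * (p1.[ip x z] * ip x w ^+ b)) + E (fun x => ip x z * (p2.[ip x z] * ip x w ^+ b))).
    by rewrite h1 h2; ring.
  rewrite -RintegralD //; try exact/integrable_tame/tp'.
  by apply: eq_Rintegral => x _; rewrite hornerD mulrDl mulrDr.
rewrite derivZ derivXn.
have Z k (c : R) (q : {poly R}) : E (fun x => (c *: q).[ip x z] * ip x w ^+ k) =
    c * E (fun x => q.[ip x z] * ip x w ^+ k).
  rewrite -RintegralZl //; last exact/integrable_tame/tp.
  by apply: eq_Rintegral => x _; rewrite hornerZ mulrA.
rewrite !Z -scaler_nat Z.
rewrite (_ : E _ = p`_i * E (fun x => ip x z * (ip x z ^+ i * ip x w ^+ b))).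
  rewrite stein_mixed.
  under [in RHS]eq_Rintegral do rewrite hornerXn.
  have -> : E (fun x => ip x z ^+ i * ip x w ^+ b.-1) = E (fun x => ('X^i).[ip x z] * ip x w ^+ b.-1).
    by apply: eq_Rintegral => x _; rewrite hornerXn.
  ring.
rewrite -RintegralZl //; last first.
  by apply/integrable_tame; apply: tameM; [|apply: tameM]; do ?apply: tameX; exact: tame_inner.
by apply: eq_Rintegral => x _; rewrite hornerZ hornerXn; ring.
Qed.

(** In He_(n+1) = X He_n - v He_n' the derivative term cancels against integration by parts of the
    first one. What remains differentiates the power of w, lowering both degrees by one. *)
Lemma He_orth_pow n z w b : (b < n)%N -> E (fun x => He_at n z x * ip x w ^+ b) = 0.
Proof.
elim: n b => // n IH b bn; rewrite /He_at HeS.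
rewrite (_ : E _ = E (fun x => ip x z * ((He (cov z z) n).[ip x z] * ip x w ^+ b))
   - cov z z * E (fun x => (He (cov z z) n)^`().[ip x z] * ip x w ^+ b)); last first.
  have tp (q : {poly R}) : tame P (fun x => q.[ip x z] * ip x w ^+ b).
    by apply: tameM; [apply: tame_horner; exact: tame_inner|apply: tameX; exact: tame_inner].
  rewrite -RintegralZl //; last exact/integrable_tame/tp.
  rewrite -RintegralB //; first 1 last.
  - by apply/integrable_tame/tameM => //; exact: tame_inner.
  - exact/integrable_tame/tameZ.
  by apply: eq_Rintegral => x _; rewrite hornerD hornerN hornerM hornerX hornerZ; ring.
rewrite stein_poly addrC addKr.
case: b bn => [|b] bn; first by rewrite !mul0r.
by rewrite (IH b) // mulr0.
Qed.

Lemma size_He v n : (size (He v n : {poly R}) <= n.+1)%N.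
Proof.
elim/ltn_ind: n => -[|[|n]] IH; first by rewrite size_poly1.
  by rewrite size_polyX.
rewrite HeSS; apply: leq_trans (size_polyD _ _) _; rewrite geq_max; apply/andP; split.
  by apply: leq_trans (size_polyMleq _ _) _; rewrite size_polyX /= ltnS; exact: IH.
rewrite size_polyN; apply: leq_trans (size_scale_leq _ _) _.
by apply: leq_trans (IH n _) _ => //; rewrite ltnW.
Qed.

Lemma He_orth_lt n m z w : (m < n)%N -> dot P (He_at n z) (He_at m w) = 0.
Proof.
move=> mn; rewrite /dot.
rewrite (_ : E _ = E (fun x => \sum_(i < size (He (cov w w) m)) (He (cov w w) m)`_i * (He_at n z x * ip x w ^+ i))); last first.
  apply: eq_Rintegral => x _; rewrite {2}/He_at horner_coef mulr_sumr.
  by apply: eq_bigr => i _; rewrite mulrCA.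
have t i : tame P (fun x => He_at n z x * ip x w ^+ i).
  by apply: tameM; [exact: tame_He_at|apply: tameX; exact: tame_inner].
rewrite Rintegral_sum => [|i]; last exact/integrable_tame/tameZ.
apply: big1 => i _; rewrite RintegralZl //; last exact: integrable_tame.
rewrite He_orth_pow ?mulr0 //; apply: leq_trans (ltn_ord i) _.
exact: leq_trans (size_He _ _) mn.
Qed.

Lemma He_orth n m z w : n != m -> dot P (He_at n z) (He_at m w) = 0.
Proof.
rewrite neq_ltn => /orP[nm|mn]; last exact: He_orth_lt.
by rewrite dotC; exact: He_orth_lt.
Qed.

End gaussian_linear.

(** * Wick products and polarization *)

Section index_sums.
Variables (R : realType) (r : nat).
Implicit Types (c : nat -> R) (F G : seq nat -> R).

Definition ffun_seq n (t : {ffun 'I_n -> 'I_r}) : seq nat := [seq val (t k) | k <- enum 'I_n].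

(** The pairing of F, a function of index lists, with the n-th tensor power of the vector (c_0, ...,
    c_(r-1)). *)
Definition isum c n F := \sum_(t : {ffun 'I_n -> 'I_r}) (\prod_k c (t k)) * F (ffun_seq t).

Lemma isum0 c F : isum c 0 F = F [::].
Proof.
pose t0 : {ffun 'I_0 -> 'I_r} := ffun0 (card_ord 0).
rewrite /isum (big_pred1 t0).
  by rewrite big_ord0 mul1r /ffun_seq enum_ord0.
by move=> t /=; apply/esym/eqP/ffunP => -[].
Qed.

Definition ffun_cons n (p : 'I_r * {ffun 'I_n -> 'I_r}) : {ffun 'I_n.+1 -> 'I_r} :=
  [ffun k => if unlift ord0 k is Some k' then p.2 k' else p.1].

Lemma isumS c n F : isum c n.+1 F = \sum_(j < r) c j * isum c n (fun s => F (val j :: s)).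
Proof.
rewrite /isum (reindex (@ffun_cons n)) /=; last first.
  exists (fun t : {ffun 'I_n.+1 -> 'I_r} => (t ord0, [ffun k => t (lift ord0 k)])).
    move=> [j t] _ /=; congr (_, _); first by rewrite ffunE unlift_none.
    by apply/ffunP => k; rewrite !ffunE liftK.
  move=> t _; apply/ffunP => k; rewrite ffunE /=.
  by case: unliftP => [k' ->|->] //; rewrite ffunE.
rewrite (eq_bigr (fun p : 'I_r * {ffun 'I_n -> 'I_r} => c p.1 * ((\prod_k c (p.2 k)) * F (val p.1 :: ffun_seq p.2)))); last first.
  move=> [j t] _ /=; rewrite mulrA big_ord_recl ffunE unlift_none /=.
  congr (_ * _ * F _).
    by apply: eq_bigr => k _; rewrite ffunE liftK.
  rewrite /ffun_seq enum_ordSl /= ffunE unlift_none -map_comp; congr (_ :: _).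
  by apply: eq_map => k /=; rewrite ffunE liftK.
rewrite -(pair_bigA _ (fun (j : 'I_r) (t : {ffun 'I_n -> 'I_r}) => c j * ((\prod_k c (t k)) * F (val j :: ffun_seq t)))) /=.
by apply: eq_bigr => j _; rewrite mulr_sumr.
Qed.

Lemma eq_isum c n F G : (forall s, size s = n -> all (fun j => j < r)%N s -> F s = G s) ->
  isum c n F = isum c n G.
Proof.
move=> FG; apply: eq_bigr => t _; rewrite FG // /ffun_seq.
  by rewrite size_map size_enum_ord.
by apply/allP => _ /mapP [k _ ->]; exact: ltn_ord.
Qed.

Lemma isumD c n F G : isum c n (fun s => F s + G s) = isum c n F + isum c n G.
Proof. by rewrite -big_split; apply: eq_bigr => t _; rewrite mulrDr. Qed.

Lemma isumZ c n a F : isum c n (fun s => a * F s) = a * isum c n F.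
Proof. by rewrite mulr_sumr; apply: eq_bigr => t _; rewrite mulrCA. Qed.

(** For symmetric F, each of the n positions may hold the removed letter j, whose weight c_j then
    occurs twice; the remaining letters range over all lists of length n - 1. This is the
    contraction term of the Hermite recurrence. *)
Lemma isum_rem c n F : (forall s t, perm_eq s t -> F s = F t) ->
  \sum_(j < r) c j * isum c n (fun s => (count_mem (val j) s)%:R * F (rem (val j) s)) =
  n%:R * (\sum_(j < r) c j ^+ 2) * isum c n.-1 F.
Proof.
elim: n F => [|n IH] F hF.
  by rewrite !mul0r big1 // => j _; rewrite isum0 mul0r mulr0.
rewrite (eq_bigr (fun j : 'I_r => c j ^+ 2 * isum c n F +
    \sum_(a < r) c a * (c j * isum c n (fun s => (count_mem (val j) s)%:R * F (val a :: rem (val j) s))))); last first.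
  move=> j _; rewrite isumS.
  rewrite (_ : c j ^+ 2 * _ = c j * \sum_(a < r) c a * isum c n (fun s => (val a == val j)%:R * F s)); last first.
    rewrite expr2 -mulrA; congr (_ * _); rewrite (bigD1 j) //= big1 ?addr0.
      by rewrite isumZ eqxx mul1r.
    by move=> a aj; rewrite isumZ (_ : (val a == val j) = false) ?mul0r ?mulr0 //; apply/negbTE.
  rewrite [X in _ = _ + X](_ : _ = c j * \sum_(a < r) c a * isum c n (fun s => (count_mem (val j) s)%:R * F (val a :: rem (val j) s))); last first.
    by rewrite mulr_sumr; apply: eq_bigr => a _; rewrite mulrCA.
  rewrite -mulrDr -big_split; congr (_ * _); apply: eq_bigr => a _.
  rewrite [RHS]/= -mulrDr -isumD; congr (_ * _); apply: eq_isum => s _ _ /=.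
  have [->|aj] := eqVneq (val a) (val j); last by rewrite add0n mul0r add0r.
  rewrite mul1r natrD mulrDl mul1r; congr (_ + _).
  have [js|/count_memPn ->] := boolP (val j \in s); last by rewrite !mul0r.
  by congr (_ * _); apply: hF; exact: perm_to_rem.
rewrite big_split /= -mulr_suml [X in _ + X]exchange_big /=.
rewrite [X in _ + X](eq_bigr (fun a : 'I_r => c a * (n%:R * (\sum_(j < r) c j ^+ 2) * isum c n.-1 (fun s => F (val a :: s))))); last first.
  move=> a _; rewrite -mulr_sumr (IH (fun s => F (val a :: s))) // => s t st; apply: hF; rewrite perm_cons //.
have -> : \sum_(a < r) c a * (n%:R * (\sum_(j < r) c j ^+ 2) * isum c n.-1 (fun s => F (val a :: s))) =
  n%:R * (\sum_(j < r) c j ^+ 2) * isum c n F.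
  case: n {IH} => [|n]; first by rewrite !mul0r big1 // => a _; rewrite !mul0r mulr0.
  by set v := n.+1%:R * _; rewrite isumS mulr_sumr; apply: eq_bigr => a _; rewrite mulrCA.
by rewrite -[n.+1]add1n natrD mulrDl mul1r mulrDl.
Qed.

Variable y : nat -> R.

(** The Wick product of the orthonormal coordinates y_j listed in s: a Hermite polynomial of degree
    the multiplicity of j in each coordinate. *)
Definition wick (s : seq nat) : R := \prod_(j < r) (He 1 (count_mem (val j) s)).[y j].

Lemma wick_perm s t : perm_eq s t -> wick s = wick t.
Proof. by move=> /seq.permP st; apply: eq_bigr => j _; rewrite st. Qed.

Lemma He1_rec n x : x * (He (1 : R) n).[x] = (He 1 n.+1).[x] + n%:R * (He 1 n.-1).[x].
Proof.
case: n => [|n]; first by rewrite /= hornerC hornerX mul0r addr0 mulr1.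
rewrite HeSS hornerD hornerN hornerZ hornerM hornerX mulr1; ring.
Qed.

Lemma wick_cons (j : 'I_r) s :
  wick (val j :: s) = y j * wick s - (count_mem (val j) s)%:R * wick (rem (val j) s).
Proof.
apply/eqP; rewrite eq_sym subr_eq; apply/eqP; rewrite /wick !(bigD1 (P := xpredT) j) //=.
rewrite mulrA He1_rec eqxx mulrDl; congr (_ * _ + _).
  by apply: eq_bigr => i ij; rewrite (_ : (val j == val i) = false) ?add0n //; apply/negbTE; rewrite eq_sym.
rewrite -mulrA count_mem_rem eqxx subn1; congr (_ * (_ * _)).
apply: eq_bigr => i ij; rewrite count_mem_rem (_ : (val j == val i) = false) ?subn0 //.
by apply/negbTE; rewrite eq_sym.
Qed.

(** The multinomial theorem for Hermite polynomials. Splitting off the first index j gives y_j times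
    the shorter Wick product minus a contraction; summed with weights c_j this is the recurrence
    [HeSS], the contraction being evaluated by [isum_rem]. *)
Lemma isum_wick c n :
  isum c n wick = (He (\sum_(j < r) c j ^+ 2) n).[(\sum_(j < r) c j * y j)].
Proof.
elim/ltn_ind: n => -[|[|n]] IH.
- by rewrite isum0 /= hornerC /wick big1 // => j _; rewrite /= hornerC.
- rewrite isumS /= hornerX; apply: eq_bigr => j _; rewrite isum0 wick_cons /= mul0r subr0.
  by rewrite /wick big1 ?mulr1 // => i _; rewrite /= hornerC.
rewrite isumS (eq_bigr (fun j : 'I_r => (c j * y j) * isum c n.+1 wick
   + (- 1) * (c j * isum c n.+1 (fun s => (count_mem (val j) s)%:R * wick (rem (val j) s))))); last first.
  move=> j _; rewrite (_ : isum c n.+1 (fun s => wick (val j :: s)) = y j * isum c n.+1 wick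
    + (- 1) * isum c n.+1 (fun s => (count_mem (val j) s)%:R * wick (rem (val j) s))); first by ring.
  by rewrite -!isumZ -isumD; apply: eq_isum => s _ _; rewrite wick_cons mulN1r.
rewrite big_split [LHS]/= -mulr_suml -mulr_sumr isum_rem; last exact: wick_perm.
rewrite !IH // HeSS hornerD hornerN hornerZ hornerM hornerX; ring.
Qed.

End index_sums.

Section polarization.
Variables (R : realType) (r n : nat).

(** Expand the product over l of 1 - [l not in B], with A the set of factors from which 1 is
    chosen. *)
Lemma alternating_superset (B : {set 'I_n}) :
  \sum_(A : {set 'I_n} | B \subset A) (-1) ^+ (n - #|A|) = (B == [set: 'I_n]%SET)%:R :> R.
Proof.
have -> : (B == [set: 'I_n]%SET)%:R = \prod_(l < n) (1 + - (l \notin B)%:R) :> R.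
  have [->|BT] := eqVneq; first by rewrite big1 // => l _; rewrite inE /= subr0.
  have [l lB] : exists l, l \notin B.
    apply/existsP; rewrite -negb_forall; apply: contra BT => /forallP h.
    by apply/eqP/setP => l; rewrite h inE.
  by rewrite (bigD1 l) //= lB subrr mul0r.
rewrite bigA_distr big_mkcond; apply: eq_bigr => A _.
case: ifPn => [BA|BA]; last first.
  have [l lB lA] := subsetPn BA.
  by rewrite (bigD1 l) //= (negbTE lA) lB /= oppr0 mul0r.
rewrite (bigID (mem A)) /= big1 ?mul1r; last by move=> l ->.
rewrite (eq_bigr (fun=> -1)); last first.
  by move=> l lA; rewrite (negbTE lA) (_ : l \notin B) //; apply: contra lA; exact: (fintype.subsetP BA).
rewrite prodr_const; congr (_ ^+ _).
have h := cardC (mem A); rewrite card_ord in h.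
rewrite (_ : (n - #|A|)%N = #|[predC (mem A)]|); last first.
  by rewrite -(addKn #|A| #|[predC (mem A)]|) h.
by apply: eq_card => l; rewrite !inE.
Qed.

(** The coordinates of the sum over l in A of the basis vectors e_(i l). *)
Definition subset_weight (i : 'I_n -> 'I_r) (A : {set 'I_n}) (j : nat) : R :=
  \sum_(l in A) (val (i l) == j)%:R.

(** For fixed A the sum expands over maps g of 'I_n into A. The alternating sum over A retains the
    surjective g, which are the n! permutations, and each contributes the same value by symmetry of
    a. *)
Lemma polarization (a : seq nat -> R) (i : 'I_n -> 'I_r) :
  (forall s t, perm_eq s t -> a s = a t) ->
  \sum_(A : {set 'I_n}) (-1) ^+ (n - #|A|) * isum r (subset_weight i A) n a =
  n`!%:R * a [seq val (i k) | k <- enum 'I_n].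
Proof.
move=> ha.
have E (A : {set 'I_n}) : isum r (subset_weight i A) n a =
    \sum_(g : {ffun 'I_n -> 'I_n} | (g @: [set: 'I_n]%SET) \subset A) a [seq val (i (g k)) | k <- enum 'I_n].
  rewrite /isum /subset_weight.
  under eq_bigr do rewrite bigA_distr_big mulr_suml.
  rewrite exchange_big /= (eq_bigl (fun g : {ffun 'I_n -> 'I_n} => g @: [set: 'I_n]%SET \subset A)); last first.
    move=> g; apply/ffun_onP/fintype.subsetP => [h _ /imsetP[k _ ->]|h k]; first exact: h.
    by apply: h; exact: imset_f.
  apply: eq_bigr => g _; rewrite (bigD1 [ffun k => i (g k)]) //= [X in _ + X]big1 ?addr0.
    rewrite big1 ?mul1r => [|k _]; last by rewrite ffunE eqxx.
    by congr a; apply: eq_map => k /=; rewrite ffunE.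
  move=> t ti; rewrite [X in X * _](_ : _ = 0) ?mul0r //.
  have [k hk] : exists k, i (g k) != t k.
    apply/existsP; rewrite -negb_forall; apply: contra ti => /forallP h.
    by apply/eqP/ffunP => k; rewrite ffunE; apply/esym/eqP; exact: h.
  by rewrite (bigD1 k) //= (_ : (_ == _) = false) ?mul0r //; exact/negbTE.
under eq_bigr do rewrite E mulr_sumr.
rewrite (exchange_big_dep xpredT) //=.
rewrite (eq_bigr (fun g : {ffun 'I_n -> 'I_n} => ((g @: [set: 'I_n]%SET) == [set: 'I_n]%SET)%:R * a [seq val (i (g k)) | k <- enum 'I_n])); last first.
  by move=> g _; rewrite -mulr_suml alternating_superset.
(* On a finite set, surjective and injective self-maps coincide. *)
rewrite (bigID (fun g : {ffun 'I_n -> 'I_n} => injectiveb g)) /= [X in _ + X]big1 ?addr0; last first.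
  move=> g gi; rewrite (_ : (_ == _) = false) ?mul0r //; apply/negbTE; apply: contra gi => /eqP gT.
  have /imset_injP gi : #|g @: [set: 'I_n]%SET| == #|[set: 'I_n]%SET| by rewrite gT.
  by apply/injectiveP => k l; apply: gi; rewrite inE.
rewrite (eq_bigr (fun=> a [seq val (i k) | k <- enum 'I_n])); last first.
  move=> g /injectiveP gi.
  rewrite (_ : (_ == _) = true) ?mul1r; last first.
    by rewrite eqEcard finset.subsetT (card_imset _ gi) leqnn.
  apply: ha; rewrite (map_comp (fun k => val (i k)) g); apply: perm_map.
  apply: uniq_perm; [by rewrite (map_inj_uniq gi) enum_uniq|exact: enum_uniq|].
  move=> k; rewrite mem_enum inE; apply/mapP.
  by exists (invF gi k); rewrite ?mem_enum ?f_invF.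
rewrite sumr_const -[LHS]mulr_natl; congr (_%:R * _).
by have := card_inj_ffuns 'I_n 'I_n; rewrite cardsE card_ord ffactnn.
Qed.

End polarization.

(** * Density of polynomials *)

Section linear_subspaces.
Context (T : Type) (R : realType).
Implicit Types V : set (T -> R).

Definition lsubspace V := V (fun=> 0) /\
  forall (a : R) f g, V f -> V g -> V (fun x => a * f x + g x).

Lemma subspaceZ V a f : lsubspace V -> V f -> V (fun x => a * f x).
Proof.
move=> [V0 VD] Vf; have := VD a f _ Vf V0.
by under [X in V X -> _]eq_fun do rewrite addr0.
Qed.

Lemma subspaceD V f g : lsubspace V -> V f -> V g -> V (fun x => f x + g x).
Proof.
move=> [V0 VD] Vf Vg; have := VD 1 f _ Vf Vg.
by under [X in V X -> _]eq_fun do rewrite mul1r.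
Qed.

Lemma subspaceB V f g : lsubspace V -> V f -> V g -> V (fun x => f x - g x).
Proof.
move=> sV Vf Vg; apply: subspaceD => //.
by have := subspaceZ (-1) sV Vg; under [X in V X -> _]eq_fun do rewrite mulN1r.
Qed.

Lemma subspace_sum V I (s : seq I) (Q : pred I) (F : I -> T -> R) : lsubspace V ->
  (forall i, Q i -> V (F i)) -> V (fun x => \sum_(i <- s | Q i) F i x).
Proof.
move=> sV VF; elim: s => [|i s IH].
  by rewrite (_ : (fun x => _) = fun=> 0); [case: sV|apply/funext => x; rewrite big_nil].
rewrite (_ : (fun x => _) = fun x => if Q i then F i x + \sum_(j <- s | Q j) F j x
    else \sum_(j <- s | Q j) F j x); last by apply/funext => x; rewrite big_cons.
by case: (boolP (Q i)) => // Qi; apply: subspaceD => //; exact: VF.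
Qed.

End linear_subspaces.

Section L2_closure.
Context d (T : measurableType d) (R : realType) (P : probability T R).
Implicit Types V W : set (T -> R).

Definition lclos V : set (T -> R) := [set f | L2 P f /\
  forall e : R, 0 < e -> exists2 v, V v & N2 P (fun x => f x - v x) < e].

Lemma lclos_L2 V f : lclos V f -> L2 P f. Proof. by case. Qed.

Lemma sub_lclos V : (forall f, V f -> L2 P f) -> V `<=` lclos V.
Proof.
move=> VL f Vf; split; first exact: VL.
by move=> e e0; exists f => //; under eq_fun do rewrite subrr; rewrite N2_cst normr0.
Qed.

Lemma lclos_lsubspace V : (forall f, V f -> L2 P f) -> lsubspace V -> lsubspace (lclos V).
Proof.
move=> VL sV; split; first by apply: sub_lclos => //; case: sV.
move=> a f h [Lf cf] [Lh ch]; split; first by apply: L2D => //; exact: L2Z.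
move=> e e0.
have a0 : 0 < `|a| + 1 by rewrite ltr_wpDl.
have [v Vv hv] := cf (e / 2 / (`|a| + 1)) (divr_gt0 (divr_gt0 e0 (ltr0n _ 2)) a0).
have [w Vw hw] := ch (e / 2) (divr_gt0 e0 (ltr0n _ 2)).
exists (fun x => a * v x + w x); first by case: sV => _; apply.
have Lv := VL _ Vv; have Lw := VL _ Vw.
rewrite (_ : (fun x => _) = (fun x => a * (f x - v x) + (h x - w x))); last first.
  by apply/funext => x; ring.
apply: le_lt_trans (N2D _ _) _; [by apply: L2Z; exact: L2B|exact: L2B|].
rewrite N2Z; last exact: L2B.
rewrite (splitr e); apply: ler_ltD => //.
apply: (@le_trans _ _ ((`|a| + 1) * N2 P (fun x => f x - v x))).
  by rewrite ler_wpM2r ?N2_ge0 // lerDl.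
by rewrite mulrC -ler_pdivlMr // ltW.
Qed.

Lemma lclosS V W : V `<=` W -> lclos V `<=` lclos W.
Proof.
move=> VW f [Lf cf]; split=> // e /cf [v Vv h]; exists v => //; exact: VW.
Qed.

Lemma lclosK V : (forall f, V f -> L2 P f) -> lclos (lclos V) `<=` lclos V.
Proof.
move=> VL f [Lf cf]; split=> // e e0.
have [w [Lw cw] hw] := cf (e / 2) (divr_gt0 e0 (ltr0n _ 2)).
have [v Vv hv] := cw (e / 2) (divr_gt0 e0 (ltr0n _ 2)).
exists v => //; apply: le_lt_trans (N2_tri Lf Lw (VL _ Vv)) _.
by rewrite (splitr e) ltrD.
Qed.

Lemma lclos_lim V (f_ : nat -> T -> R) f : (forall f, V f -> L2 P f) ->
  (forall n, lclos V (f_ n)) -> L2 P f -> N2 P (fun x => f_ n x - f x) @[n --> \oo] --> 0 ->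
  lclos V f.
Proof.
move=> VL cf_ Lf cf; apply: lclosK => //; split=> // e e0.
have /cvgrPdist_lt /(_ e e0) [n _ /(_ n (leqnn _))] := cf.
by rewrite sub0r normrN ger0_norm ?N2_ge0 // N2BC; exists (f_ n).
Qed.

End L2_closure.

Section multipliers.
Context d (T : measurableType d) (R : realType) (P : probability T R).
Variable V : set (T -> R).
Hypotheses (VL : forall f, V f -> L2 P f) (sV : lsubspace V).
Local Notation W := (lclos P V).
Implicit Types phi psi : T -> R.

(* Multipliers of W are studied because the sets whose indicator is one form a
   sigma-algebra. *)
Definition Mult phi := [/\ measurable_fun setT phi, exists C, forall x, `|phi x| <= C
  & forall f, W f -> W (fun x => phi x * f x)].

Let sW : lsubspace W. Proof. exact: (lclos_lsubspace VL sV). Qed.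

(** Multiplication by a bounded function is continuous on L^2, so stability may be tested on V. *)
Lemma mult_dense phi C : measurable_fun setT phi -> (forall x, `|phi x| <= C) ->
  (forall f, V f -> V (fun x => phi x * f x)) -> Mult phi.
Proof.
move=> mphi bC hV; split=> //; first by exists C.
pose K := `|C|; have K0 : 0 <= K by exact: normr_ge0.
have bK x : `|phi x| <= K by apply: le_trans (bC x) (ler_norm _).
have Lb f : L2 P f -> L2 P (fun x => phi x * f x) /\
    N2 P (fun x => phi x * f x) <= K * N2 P f.
  move=> Lf.
  have m : measurable_fun setT (fun x => phi x * f x) by apply: measurable_funM => //; case: Lf.
  have b x : `|phi x * f x| <= `|K * f x| by rewrite !normrM ler_wpM2r // (ger0_norm K0).
  split; first by apply: (L2_le m b); exact: L2Z.
  by apply: le_trans (N2_le m b (L2Z _ Lf)) _; rewrite N2Z // ger0_norm.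
move=> f [Lf cf]; split; first by have [] := Lb f Lf.
move=> e e0; have C1 : 0 < K + 1 by rewrite ltr_wpDl.
have [v Vv hv] := cf (e / (K + 1)) (divr_gt0 e0 C1).
exists (fun x => phi x * v x); first exact: hV.
rewrite (_ : (fun x => _) = (fun x => phi x * (f x - v x))); last by apply/funext => x; ring.
have [_ h] := Lb _ (L2B Lf (VL Vv)); apply: le_lt_trans h _.
rewrite ltr_pdivlMr // mulrC in hv; apply: le_lt_trans hv.
by rewrite ler_wpM2r ?N2_ge0 // lerDl.
Qed.

Lemma mult_cst c : Mult (fun=> c).
Proof.
split; [exact: measurable_cst|by exists `|c| => x|].
by move=> f Wf; exact: subspaceZ.
Qed.

Lemma multM phi psi : Mult phi -> Mult psi -> Mult (fun x => phi x * psi x).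
Proof.
move=> [m1 [C1 b1] h1] [m2 [C2 b2] h2]; split; first exact: measurable_funM.
  by exists (C1 * C2) => x; rewrite normrM ler_pM.
by move=> f Wf; under eq_fun do rewrite -mulrA; apply: h1; exact: h2.
Qed.

Lemma multD phi psi : Mult phi -> Mult psi -> Mult (fun x => phi x + psi x).
Proof.
move=> [m1 [C1 b1] h1] [m2 [C2 b2] h2]; split; first exact: measurable_funD.
  by exists (C1 + C2) => x; apply: le_trans (ler_normD _ _) _; rewrite lerD.
by move=> f Wf; under eq_fun do rewrite mulrDl; apply: subspaceD => //; [exact: h1|exact: h2].
Qed.

Lemma multZ c phi : Mult phi -> Mult (fun x => c * phi x).
Proof. by move=> h; apply: multM => //; exact: mult_cst. Qed.

Lemma multB phi psi : Mult phi -> Mult psi -> Mult (fun x => phi x - psi x).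
Proof.
move=> h1 h2; apply: multD => //.
by have := multZ (-1) h2; under [X in Mult X -> _]eq_fun do rewrite mulN1r.
Qed.

(** Uniformly bounded pointwise limits are handled by dominated convergence, C |f| being the
    dominating function. *)
Lemma mult_lim (phi_ : nat -> T -> R) phi C : (forall n, Mult (phi_ n)) ->
  (forall n x, `|phi_ n x| <= C) -> (forall x, phi_ n x @[n --> \oo] --> phi x) -> Mult phi.
Proof.
move=> hm bC cphi.
have mphi : measurable_fun setT phi.
  apply: (measurable_fun_cvg (h := phi_)) => [n|x _]; last exact: cphi.
  by case: (hm n).
split=> //.
  exists C => x; have cn : `|phi_ n x| @[n --> \oo] --> `|phi x| by apply: cvg_norm; exact: cphi.
  rewrite -(cvg_lim _ cn) //; apply: limr_le; [by apply/cvg_ex; eexists; exact: cn|].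
  by apply: nearW => n; exact: bC.
move=> f Wf; have Lf := lclos_L2 Wf.
have [ | | | | |Lp Lpn cp] := @L2_dominated _ _ _ P (fun n x => phi_ n x * f x) (fun x => phi x * f x) (fun x => C * `|f x|).
- by move=> n; apply: measurable_funM; [case: (hm n)|case: Lf].
- by apply: measurable_funM => //; case: Lf.
- by move=> x; apply: cvgM; [exact: cphi|exact: cvg_cst].
- by move=> n x; rewrite normrM ler_wpM2r.
- apply: L2Z; apply: (L2_le _ _ Lf); last by move=> x; rewrite normr_id.
  by apply: measurableT_comp => //; case: Lf.
by apply: (lclos_lim VL _ Lp cp) => n; have [_ _] := hm n; apply.
Qed.

(** A polynomial fixing -1, 0 and 1, with 1 - sgn_poly s = (1 - s)^2 (2 + s) / 2. On [-1, 1] its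
    iterates converge to the sign, which so becomes a limit of polynomials in a multiplier. *)
Definition sgn_poly (s : R) := (3 * s - s ^+ 3) / 2.

Lemma sgn_poly_range s : 0 <= s <= 1 -> s <= sgn_poly s <= 1.
Proof.
move=> /andP[s0 s1]; rewrite /sgn_poly; apply/andP; split.
  have : 0 <= s * (1 - s) * (1 + s) by rewrite !mulr_ge0 // ?subr_ge0 // addr_ge0.
  by rewrite !exprS expr0; lra.
have : 0 <= (1 - s) * (1 - s) * (2 + s) by rewrite !mulr_ge0 ?subr_ge0 // addr_ge0.
by rewrite !exprS expr0; lra.
Qed.

Lemma sgn_polyN s : sgn_poly (- s) = - sgn_poly s.
Proof. by rewrite /sgn_poly !exprS expr0; field. Qed.

Lemma iter_sgn_polyN n s : iter n sgn_poly (- s) = - iter n sgn_poly s.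
Proof. by elim: n => //= n ->; rewrite sgn_polyN. Qed.

(** One iteration multiplies the distance of u to 1 by (1 - u)(2 + u) / 2 = 1 - u / 2 - u^2 / 2, at
    most 1 - s / 2 as long as u >= s. *)
Lemma iter_sgn_poly n s : 0 <= s <= 1 ->
  s <= iter n sgn_poly s <= 1 /\ 1 - iter n sgn_poly s <= (1 - s / 2) ^+ n.
Proof.
move=> /andP[s0 s1]; elim: n => [|n [/andP[IH1 IH2] IH3]] /=.
  by rewrite lexx s1 expr0 gerBl.
set u := iter n _ _ in IH1 IH2 IH3 *.
have u0 : 0 <= u by apply: le_trans IH1.
have /andP[h1 h2] := @sgn_poly_range u (introT andP (conj u0 IH2)).
split; first by rewrite h2 (le_trans IH1 h1).
have -> : 1 - sgn_poly u = (1 - u) * ((1 - u) * (2 + u) / 2) by rewrite /sgn_poly; field.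
rewrite exprSr; apply: ler_pM => //; first by rewrite subr_ge0.
  by rewrite divr_ge0 // mulr_ge0 ?subr_ge0 // addr_ge0.
have : 0 <= u * u by rewrite mulr_ge0.
lra.
Qed.

Lemma cvg_iter_sgn_poly s : `|s| <= 1 -> iter n sgn_poly s @[n --> \oo] --> Num.sg s.
Proof.
wlog s0 : s / 0 <= s.
  move=> h s1; have [s0|s0] := leP 0 s; first exact: h.
  have := h (- s); rewrite normrN oppr_ge0 ltW // => /(_ isT s1) c.
  rewrite -[s]opprK sgrN; under eq_fun do rewrite iter_sgn_polyN.
  exact: cvgN.
rewrite ger0_norm // => s1; have [->|sn0] := eqVneq s 0.
  rewrite sgr0 (_ : (fun n => _) = fun=> 0); first exact: cvg_cst.
  by apply/funext; elim=> //= n ->; rewrite /sgn_poly !exprS !mul0r mulr0 subrr mul0r.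
have sp : 0 < s by rewrite lt_neqAle eq_sym sn0.
rewrite gtr0_sg //.
apply: (@squeeze_cvgr _ _ _ _ (fun n => 1 - (1 - s / 2) ^+ n) (cst 1)); last exact: cvg_cst.
  apply: nearW => n; have [/andP[_ h1] h2] := @iter_sgn_poly n s (introT andP (conj s0 s1)).
  by rewrite h1 andbT; lra.
rewrite -[X in _ --> X]subr0; apply: cvgB; first exact: cvg_cst.
apply: cvg_expr; rewrite ger0_norm; lra.
Qed.

Lemma mult_sgn phi : Mult phi -> (forall x, `|phi x| <= 1) -> Mult (fun x => Num.sg (phi x)).
Proof.
move=> hp b1; apply: (@mult_lim (fun n x => iter n sgn_poly (phi x)) _ 1).
- elim=> //= n IH; rewrite /sgn_poly.
  under eq_fun do rewrite mulrC; apply: multZ; apply: multB; first exact: multZ.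
  under eq_fun do rewrite !exprS expr0 mulr1.
  by apply: multM => //; exact: multM.
- move=> n x; have := b1 x; rewrite ler_norml => /andP[l u].
  have [p0|p0] := leP 0 (phi x).
    have [/andP[h1 h2] _] := @iter_sgn_poly n (phi x) (introT andP (conj p0 u)).
    by rewrite ger0_norm // (le_trans p0).
  have hN : 0 <= - phi x <= 1 by apply/andP; split; lra.
  have [/andP[h1 h2] _] := @iter_sgn_poly n _ hN.
  rewrite -normrN -iter_sgn_polyN ger0_norm //; apply: le_trans h1; lra.
- by move=> x; exact: cvg_iter_sgn_poly.
Qed.

Definition mult_set : set (set T) := [set A | Mult \1_A].

Lemma mult_setC A : mult_set A -> mult_set (~` A).
Proof.
move=> hA; rewrite /mult_set /= (_ : \1_(~` A) = fun x => 1 - \1_A x).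
  exact: (multB (mult_cst 1) hA).
by apply/funext => x; rewrite !indicE in_setC; case: (x \in A); rewrite ?subrr ?subr0.
Qed.

Lemma mult_setI A B : mult_set A -> mult_set B -> mult_set (A `&` B).
Proof. by move=> hA hB; rewrite /mult_set /= indicI; exact: multM. Qed.

Lemma indic_bound (A : set T) x : `|\1_A x| <= 1 :> R.
Proof. by rewrite indicE; case: (x \in A); rewrite ?normr1 ?normr0. Qed.

Lemma mult_set_bigcap (F : (set T)^nat) : (forall n, mult_set (F n)) -> mult_set (\bigcap_n F n).
Proof.
move=> hF; apply: (@mult_lim (fun n => \1_(\bigcap_(k < n) F k)) _ 1).
- elim=> [|n IH]; last by rewrite bigcap_mkord big_ord_recr -bigcap_mkord; exact: mult_setI.
  rewrite (_ : \bigcap_(k < 0) F k = setT); first by rewrite indicT; exact: mult_cst.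
  by apply/seteqP; split=> // x _ k.
- by move=> n x; exact: indic_bound.
- move=> x; apply: cvg_near_cst; have [h|h] := pselect ((\bigcap_n F n) x).
    by apply: nearW => n; rewrite !indicE !mem_set // => k _; exact: h.
  have /existsNP [k hk] : ~ (forall k, F k x) by apply: contra_not h => h k _.
  exists k.+1 => // n /= kn; rewrite !indicE !memNset //.
  by move=> hh; apply: hk; exact: hh.
Qed.

Lemma mult_set_bigcup (F : (set T)^nat) : (forall n, mult_set (F n)) -> mult_set (\bigcup_n F n).
Proof.
move=> hF; rewrite -[X in mult_set X]setCK setC_bigcup; apply: mult_setC.
by apply: mult_set_bigcap => n; exact: mult_setC.
Qed.

Lemma mult_set0 : mult_set set0.
Proof. by rewrite /mult_set /= indic0; exact: mult_cst. Qed.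

Lemma mult_set_sigma : sigma_algebra setT mult_set.
Proof.
split; [exact: mult_set0| |exact: mult_set_bigcup].
by move=> A hA; rewrite setTD; exact: mult_setC.
Qed.

(** The indicator of s > 0 is (sg(s)^2 + sg(s)) / 2. *)
Lemma mult_set_lt phi : Mult (fun x => Num.sg (phi x)) -> mult_set [set x | 0 < phi x].
Proof.
move=> h; rewrite /mult_set /= (_ : \1_ _ = fun x => 2^-1 * (Num.sg (phi x) * Num.sg (phi x) + Num.sg (phi x))).
  by apply: multZ; apply: multD => //; exact: multM.
apply/funext => x; rewrite indicE; have [p0|p0|p0] := ltgtP 0 (phi x).
- by rewrite mem_set // gtr0_sg //= ; lra.
- rewrite memNset /=; last by apply/negP; rewrite -leNgt ltW.
  by rewrite ltr0_sg //; lra.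
- rewrite memNset /=; last by rewrite -p0 ltxx.
  by rewrite -p0 sgr0; lra.
Qed.

Import HBNNSimple.

(** An indicator belongs to the closure as a multiplier applied to the constant 1; simple functions,
    monotone approximation and the positive and negative parts give the rest. *)
Lemma mult_total : W (fun=> 1) -> (forall A, measurable A -> mult_set A) ->
  forall f, L2 P f -> W f.
Proof.
move=> W1 hm.
have W_indic A : measurable A -> W \1_A.
  move=> mA; have [_ _ /(_ _ W1)] := hm A mA.
  by under [X in W X -> _]eq_fun do rewrite mulr1.
have pos f : L2 P f -> (forall x, 0 <= f x) -> W f.
  move=> Lf f0; have mf : measurable_fun setT (EFin \o f).
    by apply/measurable_EFinP; case: Lf.
  pose f_ n := nnsfun_approx measurableT mf n.
  have f0' x : setT x -> (0 <= (EFin \o f) x)%E by rewrite lee_fin.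
  have cf x : f_ n x @[n --> \oo] --> f x.
    have := @cvg_nnsfun_approx _ _ _ _ measurableT _ mf f0' x I.
    by move=> /fine_cvgP[].
  have nd x : nondecreasing_seq (fun n => f_ n x).
    by move=> m n mn; have /lefP := nd_nnsfun_approx measurableT mf mn; apply.
  have fle n x : `|f_ n x| <= f x.
    rewrite ger0_norm; last exact: fun_ge0.
    rewrite -(cvg_lim _ (cf x)) //; apply: nondecreasing_cvgn_le => //.
    by apply/cvg_ex; exists (f x).
  have [ | | | | |Lp Lpn cp] := @L2_dominated _ _ _ P (fun n => f_ n) f f => //.
    by case: Lf.
  apply: (lclos_lim VL _ Lf cp) => n.
  rewrite (_ : HBNNSimple.NonNegSimpleFun.sort (f_ n) = fun x => \sum_(i < #|` fset_set (range (f_ n))|)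
     ((fset_set (range (f_ n)))`_i * \1_((f_ n) @^-1` [set (fset_set (range (f_ n)))`_i]) x)); last first.
    by apply/funext => x; rewrite fimfunEord.
  apply: subspace_sum => // i _; apply: subspaceZ => //; apply: W_indic.
  exact: measurable_sfunP.
move=> f Lf.
have mf := L2_measurable Lf.
have Lp : L2 P (fun x => Num.max (f x) 0).
  apply: L2_le Lf; first by apply: measurable_maxr => //; exact: measurable_cst.
  by move=> x; case: (leP (f x)) => h; rewrite ?normr0.
have Ln : L2 P (fun x => Num.max (- f x) 0).
  apply: L2_le Lf; first by apply: measurable_maxr; [exact: measurableT_comp|exact: measurable_cst].
  by move=> x; case: (leP (- f x)) => h; rewrite ?normr0 ?normrN.
rewrite (_ : f = fun x => Num.max (f x) 0 - Num.max (- f x) 0); last first.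
  by apply/funext => x; case: (leP (f x)) => h1; case: (leP (- f x)) => h2; lra.
apply: subspaceB => //; apply: pos => // x; by rewrite le_max lexx orbT.
Qed.

End multipliers.

Section linear_span.
Context (T : Type) (R : realType) (I : Type) (b : I -> T -> R).

Definition lspan : set (T -> R) :=
  [set f | exists s : seq (R * I), f = fun x => \sum_(p <- s) p.1 * b p.2 x].

Lemma lspan_lsubspace : lsubspace lspan.
Proof.
split; first by exists [::]; apply/funext => x; rewrite big_nil.
move=> a f g [s ->] [t ->]; exists ([seq (a * p.1, p.2) | p <- s] ++ t).
apply/funext => x; rewrite big_cat big_map mulr_sumr /=; congr (_ + _).
by apply: eq_bigr => p _; rewrite mulrA.
Qed.

Lemma lspan_gen i : lspan (b i).
Proof. by exists [:: (1, i)]; apply/funext => x; rewrite big_seq1 mul1r. Qed.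

Lemma lspan_sub (V : set (T -> R)) : lsubspace V -> (forall i, V (b i)) -> lspan `<=` V.
Proof.
move=> sV Vb f [s ->]; apply: subspace_sum => // p _.
by apply: subspaceZ => //; exact: Vb.
Qed.

End linear_span.

(** * Half-spaces generate the Borel sets *)

Section separable_borel.
Context (R : realType) (X : normedModType R) (ip : inner_product X).

Lemma separable_seq : separable_space X ->
  exists D : nat -> X, forall x e, 0 < e -> exists n, `|x - D n| < e.
Proof.
move=> [A [/countable_injP [f fi] dA]].
exists (fun n => xget 0 [set x | A x /\ f x = n]) => x e e0.
have [y [xy Ay]] : ball x e `&` A !=set0.
  apply: dA; last exact: ball_open.
  by exists x; exact: ballxx.
exists (f y); have /= [] := @xgetPex _ 0 [set x | A x /\ f x = f y] (ex_intro _ y (conj Ay erefl)).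
set z := xget _ _ => Az fz; have -> : z = y by apply: fi; rewrite ?inE.
by move: xy; rewrite -ball_normE.
Qed.

(** Makes a closed ball a countable intersection of half-spaces: the norm of y is attained by
    testing against y itself, which the dense sequence approximates. *)
Lemma norm_le_halfspaces (D : nat -> X) (y : X) rho :
  (forall x e, 0 < e -> exists n, `|x - D n| < e) -> 0 <= rho ->
  (`|y| <= rho <-> forall n, ip y (D n) <= rho * `|D n|).
Proof.
move=> hD rho0; split=> [yr n|h].
  by apply: le_trans (ler_norm _) _; apply: le_trans (inner_le ip _ _) _; rewrite ler_wpM2r.
have [->|y0] := eqVneq y 0; first by rewrite normr0.
have ny : 0 < `|y| by rewrite normr_gt0.
suff : `|y| ^+ 2 <= rho * `|y| by rewrite expr2 ler_pM2r.
apply/ler_addgt0Pr => e e0.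
have k0 : 0 < rho + `|y| by rewrite ltr_wpDl.
have [n hn] := hD y (e / (rho + `|y|)) (divr_gt0 e0 k0).
rewrite ltr_pdivlMr // in hn.
rewrite -(inner_norm ip) -[X in ip _ X](subrK (D n)) innerDr.
have h1 : ip y (y - D n) <= `|y| * `|y - D n| by apply: le_trans (ler_norm _) (inner_le ip _ _).
have h2 := h n.
have h3 : rho * `|D n| <= rho * (`|y| + `|y - D n|).
  rewrite ler_wpM2l // -[X in `|X| <= _](subKr y) (le_trans (ler_normB _ _)) // .
lra.
Qed.

Lemma borel_halfspaces (G : set (set X)) : separable_space X -> sigma_algebra setT G ->
  (forall z r, G [set x | r < ip x z]) -> (<<s @open X >>) `<=` G.
Proof.
move=> /separable_seq [D hD] sG hG; apply: smallest_sub => // U oU.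
have [G0 GC GU] := sG.
have GN A : G A -> G (~` A) by move=> /GC; rewrite setTD.
have GI (F : (set X)^nat) : (forall n, G (F n)) -> G (\bigcap_n F n).
  move=> GF; rewrite -[X in G X]setCK setC_bigcap; apply: (GN); apply: (GU) => n; exact: GN.
pose B n k := [set x | `|x - D n| <= k.+1%:R^-1].
have GB n k : G (B n k).
  have k0 : 0 <= (k.+1%:R^-1 : R) by rewrite invr_ge0.
  rewrite (_ : B n k = \bigcap_i ~` [set x | ip (D n) (D i) + k.+1%:R^-1 * `|D i| < ip x (D i)]).
    by apply: GI => i; apply: GN; exact: hG.
  apply/seteqP; split=> x /=.
    move=> /(norm_le_halfspaces _ hD k0) h i _; apply/negP; rewrite -leNgt.
    by rewrite -lerBlDl -innerBl.
  move=> h; apply/(norm_le_halfspaces _ hD k0) => i.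
  by have /negP := h i I; rewrite -leNgt -lerBlDl -innerBl.
(* The closed balls with centre D n and radius 1 / (k + 1) that lie in U; the others are replaced by
   the empty set. *)
pose F n := \bigcup_k (if `[< B n k `<=` U >] then B n k else set0).
have -> : U = \bigcup_n F n.
  apply/seteqP; split=> x; last first.
    by move=> [n _ [k _]]; case: asboolP => // h; exact: h.
  move=> Ux; have /nbhs_ballP [e /= e0 hU] : nbhs x U by exact: open_nbhs_nbhs.
  (* With radius below e / 2, a ball containing x stays within distance e of x. *)
  have [k hk] : exists k : nat, k.+1%:R^-1 < e / 2.
    by have := ltr_add_invr (_ : 0 < e / 2); rewrite divr_gt0 // => /(_ isT) [k]; rewrite add0r; exists k.
  have kp : 0 < (k.+1%:R^-1 : R) by rewrite invr_gt0.
  have [n hn] := hD x _ kp.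
  exists n => //; exists k => //; case: asboolP => [_|]; first by rewrite /B /= ltW.
  case=> z /= hz; apply: hU; rewrite -ball_normE /=.
  rewrite (_ : x - z = (x - D n) - (z - D n)); last by rewrite opprB addrA subrK.
  apply: le_lt_trans (ler_normB _ _) _; rewrite (splitr e).
  by apply: ltrD; [exact: lt_trans hn hk|exact: le_lt_trans hz hk].
apply: (GU _ _) => n; apply: (GU _ _) => k; case: asboolP => // _.
Qed.

End separable_borel.

Section trigonometric.
Context (R : realType) (X : normedModType R) (ip : inner_product X) (g : gaussian ip).
Local Notation P := (glaw g).

(** A real substitute for complex exponentials: the product-to-sum formulas make the span an algebra
    of bounded functions. *)
Definition trig (p : bool * X) (x : borel X) : R :=
  if p.1 then cos (ip x p.2) else sin (ip x p.2).

Lemma trig_bound p x : `|trig p x| <= 1.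
Proof. by rewrite /trig; case: p.1; [exact: cos_max|exact: sin_max]. Qed.

Lemma trig_measurable p : measurable_fun setT (trig p).
Proof.
have mi := @measurable_inner _ _ ip p.2; rewrite /trig; case: p.1.
  by apply: (measurableT_comp _ mi); apply: continuous_measurable_fun; exact: continuous_cos.
by apply: (measurableT_comp _ mi); apply: continuous_measurable_fun; exact: continuous_sin.
Qed.

Lemma trig_L2 p : L2 P (trig p).
Proof.
apply: (L2_le (trig_measurable p) _ (L2_cst P 1)) => x.
by rewrite normr1; exact: trig_bound.
Qed.

Let A := lspan trig.

Lemma trig_span_mul p f : A f -> A (fun x => trig p x * f x).
Proof.
have sA := lspan_lsubspace trig.
move=> [s ->]; rewrite (_ : (fun x => _) = fun x => \sum_(q <- s) q.1 * (trig p x * trig q.2 x)); last first.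
  by apply/funext => x; rewrite mulr_sumr; apply: eq_bigr => q _; rewrite mulrCA.
apply: subspace_sum => // q _; apply: subspaceZ => //; move: p q.2 => [bp z] [bq w].
have tD := @lspan_gen _ _ _ trig (true, z + w); have tB := @lspan_gen _ _ _ trig (true, z - w).
have sD := @lspan_gen _ _ _ trig (false, z + w); have sB := @lspan_gen _ _ _ trig (false, z - w).
case: bp; case: bq.
- rewrite (_ : (fun x => _) = (fun x => 2^-1 * (trig (true, z + w) x + trig (true, z - w) x))).
    by apply: subspaceZ => //; exact: subspaceD.
  by apply/funext => x; rewrite /trig /= innerDr innerBr cosD cosB; field.
- rewrite (_ : (fun x => _) = (fun x => 2^-1 * (trig (false, z + w) x - trig (false, z - w) x))).
    by apply: subspaceZ => //; exact: subspaceB.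
  by apply/funext => x; rewrite /trig /= innerDr innerBr sinD sinB; field.
- rewrite (_ : (fun x => _) = (fun x => 2^-1 * (trig (false, z + w) x + trig (false, z - w) x))).
    by apply: subspaceZ => //; exact: subspaceD.
  by apply/funext => x; rewrite /trig /= innerDr innerBr sinD sinB; field.
- rewrite (_ : (fun x => _) = (fun x => 2^-1 * (trig (true, z - w) x - trig (true, z + w) x))).
    by apply: subspaceZ => //; exact: subspaceB.
  by apply/funext => x; rewrite /trig /= innerBr innerDr cosB cosD; field.
Qed.

Lemma trig_span_L2 f : A f -> L2 P f.
Proof.
by move=> [s ->]; apply: L2_sum => p _; apply: L2Z; exact: trig_L2.
Qed.

(** Trigonometric functions multiply their own span, so the sets whose indicator is a multiplier
    form a sigma-algebra; it contains the half-spaces, hence all Borel sets. *)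
Lemma trig_dense : separable_space X -> forall f, L2 P f -> lclos P A f.
Proof.
move=> sepX; have sA := lspan_lsubspace trig; have LA := trig_span_L2.
have Mtrig p : Mult P A (trig p).
  by apply: (mult_dense LA (C := 1) (trig_measurable p)); [exact: trig_bound|exact: trig_span_mul].
apply: (mult_total LA sA).
  apply: (sub_lclos LA); rewrite (_ : (fun=> 1) = trig (true, 0)); first exact: lspan_gen.
  by apply/funext => x; rewrite /trig /= inner0r cos0.
have half z r : mult_set P A [set x | r < ip x z].
  rewrite (_ : [set x | _] = [set x | 0 < ip x z - r]); last first.
    by apply/seteqP; split=> x /=; rewrite subr_gt0.
  apply: mult_set_lt => //.
  (* For large n the argument lies in (-1, 1), inside (-pi, pi), where the sine has the sign of its
     argument. *)
  apply: (@mult_lim _ _ _ _ _ LA (fun n x => Num.sg (sin ((ip x z - r) / n.+1%:R))) _ 1).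
  - move=> n; apply: mult_sgn => //; last by move=> x; exact: sin_max.
    rewrite (_ : (fun x => _) = fun x => cos (r / n.+1%:R) * trig (false, n.+1%:R^-1 *: z) x
       - sin (r / n.+1%:R) * trig (true, n.+1%:R^-1 *: z) x).
      by apply: multB => //; apply: multZ.
    by apply/funext => x; rewrite mulrBl sinB /trig /= innerZr (mulrC (ip x z)); ring.
  - by move=> n x; rewrite normr_sg; case: (_ != _).
  - move=> x; set u := ip x z - r; apply: cvg_near_cst.
    exists (Num.trunc `|u|) => // n /= un.
    have un1 : `|u| / n.+1%:R < 1.
      by rewrite ltr_pdivrMr // mul1r (lt_le_trans (truncnS_gt _)) // ler_nat.
    have piB : 1 < pi :> R by apply: lt_le_trans (pi_ge2 R); lra.
    have [u0|u0|u0] := ltgtP 0 u.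
    + rewrite (gtr0_sg u0) gtr0_sg // sin_gt0_pi // divr_gt0 //=.
      by rewrite gtr0_norm // in un1; exact: lt_trans piB.
    + rewrite (ltr0_sg u0) ltr0_sg // -[u]opprK mulNr sinN oppr_lt0 sin_gt0_pi // divr_gt0 ?oppr_gt0 //=.
      by rewrite ltr0_norm // in un1; exact: lt_trans piB.
    + by rewrite -u0 mul0r sin0.
move=> B mB; apply: (borel_halfspaces sepX (mult_set_sigma LA sA) half); exact: mB.
Qed.

Definition ip_pow (p : X * nat) (x : borel X) : R := ip x p.1 ^+ p.2.

Lemma ip_pow_L2 f : lspan ip_pow f -> L2 P f.
Proof.
by move=> [s ->]; apply: L2_sum => p _; apply: L2Z; apply/tame_L2/tameX; exact: tame_inner.
Qed.

(** Taylor sums of sine and cosine are dominated by exp(|<x, z>|), square-integrable because the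
    functional is Gaussian. *)
Lemma trig_taylor p : lclos P (lspan ip_pow) (trig p).
Proof.
have sV := lspan_lsubspace ip_pow.
have key (a : nat -> R) (F : X -> R) : (forall k, `|a k| <= 1) ->
  (forall x, \sum_(k < n) a k * (ip x p.2 ^+ k / k`!%:R) @[n --> \oo] --> F x) ->
  measurable_fun setT (F : borel X -> R) -> lclos P (lspan ip_pow) F.
  move=> a1 cF mF.
  pose f_ n (x : borel X) := \sum_(k < n) a k * (ip x p.2 ^+ k / k`!%:R).
  have Vf n : lspan ip_pow (f_ n).
    apply: subspace_sum => // k _; apply: subspaceZ => //.
    under eq_fun do rewrite mulrC; apply: subspaceZ => //.
    exact: (lspan_gen _ (p.2, val k)).
  have bd n x : `|f_ n x| <= expR (`|1 : R| * `|ip x p.2|).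
    rewrite normr1 mul1r; apply: le_trans (exp_series_le n (normr_ge0 (ip x p.2))).
    apply: le_trans (ler_norm_sum _ _ _) _; apply: ler_sum => k _.
    rewrite normrM (_ : `|_ / _| = `|ip x p.2| ^+ k / k`!%:R).
      by rewrite ler_piMl // mulr_ge0 ?exprn_ge0.
    by rewrite normrM normrX [X in _ * X]ger0_norm.
  have [ | | | | |Lp Lpn cp] := @L2_dominated _ _ _ P f_ F (fun x => expR (`|1 : R| * `|ip x p.2|)) => //.
  - by move=> n; case: (ip_pow_L2 (Vf n)).
  - exact/tame_L2/tame_expabs_inner.
  apply: (lclos_lim ip_pow_L2 _ Lp cp) => n; exact: (sub_lclos ip_pow_L2).
have mt := trig_measurable p; rewrite /trig in mt *; case: p.1 mt => mt.
- apply: (key (fun k => (~~ odd k)%:R * (-1) ^+ k./2)) => //.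
    by move=> k; rewrite normrM normrX normrN1 expr1n mulr1; case: (~~ _); rewrite ?normr1 ?normr0.
  move=> x; have := @is_cvg_series_cos_coeff R (ip x p.2).
  rewrite cos.unlock; apply: cvg_trans; apply: near_eq_cvg; apply: nearW => n.
  rewrite /series /= big_mkord; apply: eq_bigr => k _.
  by rewrite /cos_coeff /= !mulrA.
- apply: (key (fun k => (odd k)%:R * (-1) ^+ k.-1./2)) => //.
    by move=> k; rewrite normrM normrX normrN1 expr1n mulr1; case: (odd _); rewrite ?normr1 ?normr0.
  move=> x; have := @is_cvg_series_sin_coeff R (ip x p.2).
  rewrite sin.unlock; apply: cvg_trans; apply: near_eq_cvg; apply: nearW => n.
  rewrite /series /= big_mkord; apply: eq_bigr => k _.
  by rewrite /sin_coeff /= !mulrA.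
Qed.

Lemma ip_pow_dense : separable_space X -> forall f, L2 P f -> lclos P (lspan ip_pow) f.
Proof.
move=> sepX f /(trig_dense sepX) Wf.
apply: (lclosK ip_pow_L2); apply: lclosS Wf.
apply: lspan_sub; last exact: trig_taylor.
exact: (lclos_lsubspace ip_pow_L2 (lspan_lsubspace ip_pow)).
Qed.

End trigonometric.

(** * The Cameron-Martin space *)

Section cameron_martin_space.
Context (R : realType) (X : completeNormedModType R) (ip : inner_product X) (g : gaussian ip).
Local Notation S := (gsqrt g).
Local Notation Q := (gcov g).
Local Notation H := (CM g).
Implicit Types x y z h : X.

Lemma gsqrt_linear a x y : S (a *: x + y) = a *: S x + S y.
Proof. by have [[[_ + _] _ _] _] := gsqrtP g; apply. Qed.

Lemma gsqrtD x y : S (x + y) = S x + S y.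
Proof. by rewrite -[x]scale1r gsqrt_linear !scale1r. Qed.
Lemma gsqrt0 : S 0 = 0.
Proof. by have := gsqrtD 0 0; rewrite addr0 => /eqP; rewrite -subr_eq0 opprD addrA subrr add0r oppr_eq0 => /eqP. Qed.
Lemma gsqrtZ a x : S (a *: x) = a *: S x.
Proof. by rewrite -[a *: x]addr0 gsqrt_linear gsqrt0 addr0. Qed.
Lemma gsqrtB x y : S (x - y) = S x - S y.
Proof. by rewrite gsqrtD -scaleN1r gsqrtZ scaleN1r. Qed.
Lemma gsqrt_sum I (s : seq I) (P : pred I) (F : I -> X) :
  S (\sum_(i <- s | P i) F i) = \sum_(i <- s | P i) S (F i).
Proof. by elim/big_rec2: _ => [|i a b _ <-]; [exact: gsqrt0|rewrite gsqrtD]. Qed.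

Lemma gsqrt_sa x y : ip (S x) y = ip x (S y).
Proof. by have [[_ + _] _] := gsqrtP g; apply. Qed.

Lemma gsqrtK x : S (S x) = Q x.
Proof. by have [_ +] := gsqrtP g; apply. Qed.

Lemma gcov_sa x y : ip (Q x) y = ip x (Q y).
Proof. by have [_ + _] := gcov_nonneg g; apply. Qed.

Lemma gsqrt_ge0 x : 0 <= ip (S x) x.
Proof. by have [[_ _ +] _] := gsqrtP g; apply. Qed.

Lemma gsqrt_eq0 x : Q x = 0 -> S x = 0.
Proof. by move=> Qx; apply: (@inner_eq0 _ _ ip); rewrite gsqrt_sa gsqrtK Qx inner0r. Qed.

Lemma ker_perpE : ker_perp ip S = ker_perp ip Q.
Proof.
apply/seteqP; split=> z hz y hy; first by apply: hz; exact: gsqrt_eq0.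
by apply: hz; rewrite -gsqrtK hy gsqrt0.
Qed.

Lemma gvec_ortho i j : gidx g i -> gidx g j -> ip (gvec g i) (gvec g j) = (i == j)%:R.
Proof. by have [_ + _] := gvec_basis g; apply. Qed.

(** The vector u = S f - sqrt(lambda) f satisfies S u + sqrt(lambda) u = Q f - lambda f = 0, and S
    >= 0 forces u = 0. *)
Lemma gsqrt_gvec k : gidx g k -> S (gvec g k) = cmvec g k.
Proof.
move=> ik; rewrite /cmvec; set s := Num.sqrt (geig g k).
have s0 : 0 < s by rewrite sqrtr_gt0 geig_gt0.
pose u := S (gvec g k) - s *: gvec g k.
have Su : S u + s *: u = 0.
  rewrite /u gsqrtB gsqrtZ gsqrtK gvec_eigen // scalerBr scalerA -expr2 sqr_sqrtr; last first.
    by rewrite ltW // geig_gt0.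
  by rewrite addrA subrK subrr.
have : ip (S u + s *: u) u = 0 by rewrite Su inner0l.
rewrite innerDl innerZl => e.
have u0 : s * ip u u = 0.
  by have := gsqrt_ge0 u; have := mulr_ge0 (ltW s0) (inner_ge0 ip u); lra.
have /(@inner_eq0 _ _ ip)/eqP : ip u u = 0 by apply: (mulfI (lt0r_neq0 s0)); rewrite u0 mulr0.
by rewrite subr_eq0 => /eqP.
Qed.

(** Extension by 0 outside the index set, so that sums over k < m carry no membership condition. *)
Definition fv k : X := if k \in gidx g then gvec g k else 0.

Lemma proj_spanE m x : proj_span ip (gidx g) (gvec g) m x = \sum_(k < m) ip x (fv k) *: fv k.
Proof.
rewrite /proj_span big_mkcond; apply: eq_bigr => k _.
by rewrite /fv; case: ifP => // _; rewrite inner0r scale0r.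
Qed.

Lemma fv_ortho i j : ip (fv i) (fv j) = ((i == j) && (i \in gidx g))%:R.
Proof.
rewrite /fv; case: (boolP (i \in gidx g)) => hi; last by rewrite inner0l andbF.
case: (boolP (j \in gidx g)) => hj; first by rewrite andbT gvec_ortho //; exact: set_mem.
by rewrite inner0r andbT; case: eqP => // ij; rewrite -ij hi in hj.
Qed.

Local Notation pi m x := (proj_span ip (gidx g) (gvec g) m x).

Lemma inner_fv_sum m (c : nat -> R) j :
  ip (\sum_(k < m) c k *: fv k) (fv j) = if (j < m)%N && (j \in gidx g) then c j else 0.
Proof.
rewrite inner_suml; under eq_bigr do rewrite innerZl fv_ortho.
case: ltnP => [jm|mj] /=; last first.
  rewrite big1 // => k _; rewrite (_ : _ && _ = false) ?mulr0 //.
  by apply/negbTE; rewrite negb_and neq_ltn (leq_trans (ltn_ord k) mj).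
rewrite (bigD1 (Ordinal jm)) //= eqxx big1 ?addr0; last first.
  by move=> k kj; rewrite (_ : (val k == j) = false) ?mulr0 //; apply/negbTE.
by case: ifP => _; rewrite ?mulr1 ?mulr0.
Qed.

Lemma fv0 j x : (j \in gidx g) = false -> ip x (fv j) = 0.
Proof. by rewrite /fv => ->; rewrite inner0r. Qed.

Lemma inner_pi m x j : ip (pi m x) (fv j) = if (j < m)%N then ip x (fv j) else 0.
Proof.
rewrite proj_spanE (inner_fv_sum m (fun k => ip x (fv k))); case: ltnP => //= _.
by case: ifPn => // /negbTE/fv0 ->.
Qed.

Lemma inner_pi_pi m x : ip (pi m x) (pi m x) = \sum_(k < m) ip x (fv k) ^+ 2.
Proof.
rewrite {2}proj_spanE inner_sumr; apply: eq_bigr => k _.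
by rewrite innerZr inner_pi ltn_ord expr2.
Qed.

Lemma inner_pi_sum m x y : ip (pi m x) y = \sum_(k < m) ip x (fv k) * ip y (fv k).
Proof. by rewrite proj_spanE inner_suml; apply: eq_bigr => k _; rewrite innerZl (innerC _ _ y). Qed.

Lemma bessel m x : \sum_(k < m) ip x (fv k) ^+ 2 <= ip x x.
Proof.
have := inner_ge0 ip (x - pi m x).
rewrite innerBl !innerBr inner_pi_pi (innerC ip x) inner_pi_sum.
by under eq_bigr do rewrite -expr2; lra.
Qed.

Lemma is_cvg_bessel x : cvgn (fun m => \sum_(k < m) ip x (fv k) ^+ 2).
Proof.
apply: nondecreasing_is_cvgn.
  by apply/nondecreasing_seqP => m; rewrite big_ord_recr lerDl sqr_ge0.
by exists (ip x x) => _ [m _ <-]; exact: bessel.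
Qed.

Lemma inner_pi_diff m l x : (m <= l)%N ->
  `|pi l x - pi m x| ^+ 2 = \sum_(k < l) ip x (fv k) ^+ 2 - \sum_(k < m) ip x (fv k) ^+ 2.
Proof.
move=> ml; rewrite -(inner_norm ip) innerBl !innerBr !inner_pi_pi (innerC _ (pi l x)).
rewrite (_ : ip (pi m x) (pi l x) = \sum_(k < m) ip x (fv k) ^+ 2); first by lra.
rewrite inner_pi_sum; apply: eq_bigr => k _.
by rewrite inner_pi (leq_trans (ltn_ord k) ml) expr2.
Qed.

(** Squared norms of increments are increments of the convergent Bessel sums, and X is complete. *)
Lemma is_cvg_pi x : cvgn (fun m => pi m x).
Proof.
apply: cauchy_cvg; apply: cauchy_exP => e e0.
have e2 : 0 < e ^+ 2 by rewrite exprn_gt0.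
pose s := fun m => \sum_(k < m) ip x (fv k) ^+ 2.
have /cvg_ex [l sl] := @is_cvg_bessel x.
have /cvgrPdist_lt /(_ _ e2) [M _ hM] := sl.
exists (pi M x), M => // n /= Mn; rewrite -ball_normE /= distrC.
rewrite -(@ltr_pXn2r _ 2) // ?nnegrE ?(ltW e0) // inner_pi_diff //.
have sle : s n <= l.
  rewrite -(cvg_lim _ sl) //; apply: (nondecreasing_cvgn_le (u_ := s)); last exact: is_cvg_bessel.
  by apply/nondecreasing_seqP => m; rewrite /s big_ord_recr lerDl sqr_ge0.
have := hM M (leqnn _); rewrite /= -/(s M) -/(s n) => h.
have := ler_norm (l - s M); lra.
Qed.

(** The orthogonal projection of x onto (ker Q)^perp. *)
Definition projk x : X := limn (fun m => pi m x).

Lemma cvg_pi x : pi m x @[m --> \oo] --> projk x.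
Proof. exact: is_cvg_pi. Qed.

Lemma inner_projk x j : ip (projk x) (fv j) = ip x (fv j).
Proof.
have h := @inner_cvg _ _ ip _ _ (fv j) (@cvg_pi x).
have h' : ip (pi m x) (fv j) @[m --> \oo] --> ip x (fv j).
  by apply: cvg_near_cst; exists j.+1 => // m /= jm; rewrite inner_pi jm.
by rewrite -(cvg_lim _ h) // (cvg_lim _ h').
Qed.

Lemma ker_perp_cvg z : ker_perp ip Q z -> pi m z @[m --> \oo] --> z.
Proof. by have [_ _] := gvec_basis g; apply. Qed.

Lemma ker_perp_fv k : ker_perp ip Q (fv k).
Proof.
rewrite /fv; case: ifPn => [/set_mem kI|_]; last by move=> y _; rewrite inner0l.
by have [+ _ _] := gvec_basis g; apply.
Qed.

Lemma ker_perp_lin a x y : ker_perp ip Q x -> ker_perp ip Q y -> ker_perp ip Q (a *: x + y).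
Proof. by move=> hx hy u hu; rewrite innerDl innerZl hx // hy // mulr0 addr0. Qed.

Lemma ker_perp_sum m (c : nat -> R) : ker_perp ip Q (\sum_(k < m) c k *: fv k).
Proof. by move=> u hu; rewrite inner_suml big1 // => k _; rewrite innerZl ker_perp_fv ?mulr0. Qed.

Lemma ker_perp_projk x : ker_perp ip Q (projk x).
Proof.
move=> y hy; have h := @inner_cvg _ _ ip _ _ y (@cvg_pi x).
rewrite -(cvg_lim _ h) //.
rewrite (_ : (fun m => _) = fun=> 0); first exact: lim_cst.
by apply/funext => m; rewrite proj_spanE; exact: (@ker_perp_sum m (fun k => ip x (fv k))).
Qed.

Lemma ker_perp_cov x : ker_perp ip Q (Q x).
Proof. by move=> y hy; rewrite gcov_sa hy inner0r. Qed.

(** For u = projk x - x, |S u|^2 = <Q u, u>. Since Q u lies in (ker Q)^perp it expands in the f_k,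
    all of which are orthogonal to u. *)
Lemma gsqrt_projk x : S (projk x) = S x.
Proof.
apply/eqP; rewrite -subr_eq0 -gsqrtB; apply/eqP; apply: (@inner_eq0 _ _ ip).
set u := projk x - x.
rewrite gsqrt_sa gsqrtK innerC.
have h := @inner_cvg _ _ ip _ _ u (ker_perp_cvg (ker_perp_cov u)).
rewrite -(cvg_lim _ h) //.
rewrite (_ : (fun m => _) = fun=> 0); first exact: lim_cst.
apply/funext => m; rewrite inner_pi_sum big1 // => k _.
by rewrite /u innerBl inner_projk subrr mulr0.
Qed.

Local Notation J := (perp_inv ip S).

Lemma gsqrt_inj z : ker_perp ip Q z -> S z = 0 -> z = 0.
Proof. by move=> hz Sz; apply: (@inner_eq0 _ _ ip); apply: hz; rewrite -gsqrtK Sz gsqrt0. Qed.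

(** Projecting any preimage of h onto (ker Q)^perp gives a witness, so the default value of [xget]
    is not reached on H. *)
Lemma perp_invP h : H h -> ker_perp ip Q (J h) /\ S (J h) = h.
Proof.
move=> [x _ <-]; rewrite -ker_perpE /perp_inv.
apply: (@xgetPex _ 0 [set z | ker_perp ip S z /\ S z = S x]).
exists (projk x); split; last exact: gsqrt_projk.
by rewrite ker_perpE; exact: ker_perp_projk.
Qed.

Lemma perp_inv_uniq z h : H h -> ker_perp ip Q z -> S z = h -> J h = z.
Proof.
move=> /perp_invP[h1 h2] hz Sz; apply/eqP; rewrite -subr_eq0; apply/eqP.
apply: gsqrt_inj; last by rewrite gsqrtB h2 Sz subrr.
by rewrite addrC -scaleN1r; exact: ker_perp_lin.
Qed.

Lemma perp_invK z : ker_perp ip Q z -> J (S z) = z.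
Proof. by move=> hz; apply: perp_inv_uniq => //; exists z. Qed.

Lemma CM_gsqrt x : H (S x). Proof. by exists x. Qed.

Lemma CM_lin a h k : H h -> H k -> H (a *: h + k).
Proof. by move=> [x _ <-] [y _ <-]; rewrite -gsqrt_linear; exact: CM_gsqrt. Qed.

Lemma CM0 : H 0. Proof. by rewrite -gsqrt0; exact: CM_gsqrt. Qed.
Lemma CMD h k : H h -> H k -> H (h + k).
Proof. by move=> hh hk; rewrite -[h]scale1r; exact: CM_lin. Qed.
Lemma CMZ a h : H h -> H (a *: h).
Proof. by move=> hh; rewrite -[_ *: _]addr0; apply: CM_lin => //; exact: CM0. Qed.
Lemma CMB h k : H h -> H k -> H (h - k).
Proof. by move=> hh hk; rewrite addrC -scaleN1r; exact: CM_lin. Qed.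
Lemma CM_sum I (s : seq I) (P : pred I) (F : I -> X) :
  (forall i, P i -> H (F i)) -> H (\sum_(i <- s | P i) F i).
Proof. by move=> hF; elim/big_ind: _ => //; [exact: CM0|exact: CMD]. Qed.

Lemma perp_inv_lin a h k : H h -> H k -> J (a *: h + k) = a *: J h + J k.
Proof.
move=> hh hk; have [h1 h2] := perp_invP hh; have [k1 k2] := perp_invP hk.
apply: perp_inv_uniq; [exact: CM_lin|exact: ker_perp_lin|].
by rewrite gsqrt_linear h2 k2.
Qed.

Local Notation hin := (hinner H).

Lemma hinnerE h k : hin h k = ip (J h) (J k). Proof. by []. Qed.

Lemma hinnerC h k : hin h k = hin k h. Proof. by rewrite !hinnerE innerC. Qed.

Lemma hinner_lin a h h' k : H h -> H h' -> hin (a *: h + h') k = a * hin h k + hin h' k.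
Proof. by move=> ? ?; rewrite !hinnerE perp_inv_lin // innerDl innerZl. Qed.

Lemma perp_inv0 : J 0 = 0.
Proof. by apply: perp_inv_uniq; [exact: CM0|move=> y _; rewrite inner0l|exact: gsqrt0]. Qed.

Lemma hinner0l k : hin 0 k = 0. Proof. by rewrite hinnerE perp_inv0 inner0l. Qed.

Lemma hinnerZl a h k : H h -> hin (a *: h) k = a * hin h k.
Proof. by move=> hh; rewrite -[_ *: _]addr0 hinner_lin ?hinner0l ?addr0 //; exact: CM0. Qed.
Lemma hinnerDl h h' k : H h -> H h' -> hin (h + h') k = hin h k + hin h' k.
Proof. by move=> ? ?; rewrite -[h]scale1r hinner_lin // mul1r scale1r. Qed.
Lemma hinnerBl h h' k : H h -> H h' -> hin (h - h') k = hin h k - hin h' k.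
Proof. by move=> ? ?; rewrite addrC -scaleN1r hinner_lin // mulN1r addrC. Qed.
Lemma hinner_suml m (F : nat -> X) k : (forall i, H (F i)) ->
  hin (\sum_(i < m) F i) k = \sum_(i < m) hin (F i) k.
Proof.
move=> hF; elim: m => [|m IH]; first by rewrite !big_ord0 hinner0l.
by rewrite !big_ord_recr hinnerDl ?IH //; apply: CM_sum.
Qed.
Lemma hinner_ge0 h : 0 <= hin h h. Proof. exact: inner_ge0. Qed.

(* [gw k] represents the coordinate functional W_(f_k) = <., gw k>, [cmb k] is the
   k-th vector of the orthonormal basis of H; both vanish outside the index set. *)
Definition gw k : X := (Num.sqrt (geig g k))^-1 *: fv k.
Definition cmb k : X := Num.sqrt (geig g k) *: fv k.

Lemma geig_sqrt_neq0 k : k \in gidx g -> Num.sqrt (geig g k) != 0.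
Proof. by move=> /set_mem kI; rewrite gt_eqF // sqrtr_gt0 geig_gt0. Qed.

Lemma gsqrt_fv k : S (fv k) = cmb k.
Proof.
rewrite /cmb /fv; case: ifPn => [/set_mem kI|_]; last by rewrite gsqrt0 scaler0.
exact: gsqrt_gvec.
Qed.

Lemma cmb_cmvec k : k \in gidx g -> cmb k = cmvec g k.
Proof. by rewrite /cmb /fv /cmvec => ->. Qed.

Lemma cmb_notin k : (k \in gidx g) = false -> cmb k = 0.
Proof. by rewrite /cmb /fv => ->; rewrite scaler0. Qed.

Lemma CM_cmb k : H (cmb k). Proof. by rewrite -gsqrt_fv; exact: CM_gsqrt. Qed.

Lemma perp_inv_cmb k : J (cmb k) = fv k.
Proof. by rewrite -gsqrt_fv perp_invK //; exact: ker_perp_fv. Qed.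

Lemma fvE k : fv k = (Num.sqrt (geig g k))^-1 *: cmb k.
Proof.
rewrite /cmb scalerA /fv; case: ifPn => kI; last by rewrite scaler0.
by rewrite mulVf ?scale1r //; exact: geig_sqrt_neq0.
Qed.

Lemma CM_fv k : H (fv k). Proof. by rewrite fvE; apply: CMZ; exact: CM_cmb. Qed.

Lemma perp_inv_fv k : J (fv k) = gw k.
Proof.
rewrite fvE -[_ *: cmb k]addr0 perp_inv_lin ?perp_inv0 ?addr0 ?perp_inv_cmb //; [exact: CM_cmb|exact: CM0].
Qed.

Definition coord h k : R := hin h (cmb k).

Lemma coordE h k : coord h k = ip (J h) (fv k).
Proof. by rewrite /coord hinnerE perp_inv_cmb. Qed.

Lemma coord_notin h k : (k \in gidx g) = false -> coord h k = 0.
Proof. by move=> kI; rewrite coordE fv0. Qed.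

Lemma inner_gw h k : H h -> ip h (gw k) = coord h k.
Proof.
move=> hh; have [_ h2] := perp_invP hh; rewrite -[in LHS]h2 gsqrt_sa /gw gsqrtZ gsqrt_fv coordE.
by rewrite -fvE.
Qed.

Lemma coord_sum_le m h : \sum_(k < m) coord h k ^+ 2 <= hin h h.
Proof. by under eq_bigr do rewrite coordE; exact: bessel. Qed.

Lemma cvg_coord_sum h : H h -> \sum_(k < m) coord h k ^+ 2 @[m --> \oo] --> hin h h.
Proof.
move=> hh; have [h1 h2] := perp_invP hh.
have := @inner_cvg _ _ ip _ _ (J h) (ker_perp_cvg h1).
apply: cvg_trans; apply: near_eq_cvg; apply: nearW => m.
by rewrite inner_pi_sum; apply: eq_bigr => k _; rewrite coordE expr2.
Qed.

(** Paired with [hc]: the element [hc r c] of H has W_h = <., zc r c>, an honest continuous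
    functional since the combination is finite. *)
Definition zc r (c : nat -> R) : X := \sum_(k < r) c k *: gw k.
Definition hc r (c : nat -> R) : X := \sum_(k < r) c k *: cmb k.

Lemma CM_hc r c : H (hc r c).
Proof. by apply: CM_sum => k _; apply: CMZ; exact: CM_cmb. Qed.

Lemma hinner_hc r c h : hin (hc r c) h = \sum_(k < r) c k * coord h k.
Proof.
rewrite /hc (hinner_suml _ (F := fun k => c k *: cmb k)) => [|i]; last by apply: CMZ; exact: CM_cmb.
by apply: eq_bigr => k _; rewrite hinnerZl 1?hinnerC //; exact: CM_cmb.
Qed.

Lemma inner_zc r c x : ip x (zc r c) = \sum_(k < r) c k * ip x (gw k).
Proof. by rewrite /zc inner_sumr; apply: eq_bigr => k _; rewrite innerZr. Qed.

Lemma inner_zc_CM r c h : H h -> ip h (zc r c) = hin h (hc r c).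
Proof.
move=> hh; rewrite inner_zc hinnerC hinner_hc; apply: eq_bigr => k _.
by rewrite inner_gw.
Qed.

Lemma coord_hc r c j : coord (hc r c) j = if (j < r)%N && (j \in gidx g) then c j else 0.
Proof.
rewrite coordE -inner_fv_sum; congr (inner ip _ _); apply: perp_inv_uniq.
- exact: CM_hc.
- exact: ker_perp_sum.
- by rewrite gsqrt_sum; apply: eq_bigr => k _; rewrite gsqrtZ gsqrt_fv.
Qed.

Lemma cov_gw i j : cov g (gw i) (gw j) = ((i == j) && (i \in gidx g))%:R.
Proof.
rewrite /cov -gsqrtK gsqrt_sa /gw !gsqrtZ !gsqrt_fv -!fvE; exact: fv_ortho.
Qed.

(** Outside the index set [gw] is 0, so without this condition the sum of the c_k^2 would not be the
    variance of <., zc r c>. *)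
Definition csupp (c : nat -> R) := forall k, (k \in gidx g) = false -> c k = 0.

Lemma csupp_coord h : csupp (coord h).
Proof. by move=> k; exact: coord_notin. Qed.

Lemma cov_sumr r (c : nat -> R) z : cov g z (zc r c) = \sum_(k < r) c k * cov g z (gw k).
Proof. by rewrite /cov inner_zc. Qed.

Lemma cov_zc r s c : csupp c -> (r <= s)%N ->
  cov g (zc s c) (zc r c) = \sum_(k < r) c k ^+ 2.
Proof.
move=> hc' rs; rewrite cov_sumr; apply: eq_bigr => k _; rewrite covC cov_sumr expr2; congr (_ * _).
have ks := leq_trans (ltn_ord k) rs.
rewrite (bigD1 (Ordinal ks)) //= cov_gw eqxx big1 ?addr0.
  by case: (boolP (val k \in gidx g)) => kI; rewrite ?mulr1 // hc' ?mul0r //; exact/negbTE.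
move=> i ik; rewrite cov_gw (_ : (val k == i) = false) ?mulr0 //.
by apply/negbTE; rewrite eq_sym.
Qed.

Lemma cov_zcB r s c : csupp c -> (r <= s)%N ->
  cov g (zc s c - zc r c) (zc s c - zc r c) = \sum_(k < s) c k ^+ 2 - \sum_(k < r) c k ^+ 2.
Proof.
move=> hc' rs; rewrite -scaleN1r covDl !covDr !covZl !covZr (covC g (zc r c)) !cov_zc //.
ring.
Qed.

Lemma CM_pi m x : H (pi m x).
Proof. by rewrite proj_spanE; apply: CM_sum => k _; apply: CMZ; exact: CM_fv. Qed.

(** Identifies the functionals in the definition of the measurable extensions: they are the finite
    approximations of W_h. *)
Lemma hinner_pi m x h : hin (pi m x) h = ip x (zc m (coord h)).
Proof.
rewrite proj_spanE (hinner_suml _ (F := fun k => ip x (fv k) *: fv k)) => [|i]; last by apply: CMZ; exact: CM_fv.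
rewrite inner_zc; apply: eq_bigr => k _; rewrite hinnerZl; last exact: CM_fv.
rewrite hinnerE perp_inv_fv coordE /gw innerZl innerZr (innerC _ (fv k)); ring.
Qed.

Lemma pi_zc m x : pi m x = zc m (fun k => Num.sqrt (geig g k) * ip x (fv k)).
Proof.
rewrite proj_spanE; apply: eq_bigr => k _; rewrite /gw scalerA.
case: (boolP (val k \in gidx g)) => kI; last by rewrite /fv (negbTE kI) !scaler0.
by rewrite mulrAC mulfV ?mul1r //; exact: geig_sqrt_neq0.
Qed.

Lemma gcov_fv k : Q (fv k) = geig g k *: fv k.
Proof.
rewrite /fv; case: ifPn => [/set_mem kI|_]; first exact: gvec_eigen.
by rewrite scaler0 -gsqrtK !gsqrt0.
Qed.

Lemma cov_pi m x : cov g (pi m x - x) (pi m x - x) = ip (Q x) x - ip (pi m (Q x)) x.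
Proof.
set u := pi m x - x.
have -> : cov g u u = - ip (Q x) u.
  rewrite /cov gcov_sa {1}/u innerBl inner_pi_sum big1 ?add0r => [|k _].
    by rewrite -gcov_sa.
  by rewrite gcov_sa gcov_fv innerZr /u innerBl inner_pi ltn_ord subrr !mulr0.
rewrite /u innerBr opprB; congr (_ - _).
by rewrite innerC !inner_pi_sum; apply: eq_bigr => k _; rewrite mulrC.
Qed.

(** The projections of x need not tend to x when x has a component in ker Q, but Q x lies in (ker
    Q)^perp, and by [cov_pi] only the projections of Q x matter. *)
Lemma cvg_cov_pi x : cov g (pi m x - x) (pi m x - x) @[m --> \oo] --> 0.
Proof.
rewrite -[X in _ --> X](subrr (ip (Q x) x)).
rewrite (_ : (fun m => _) = (fun m => ip (Q x) x - ip (pi m (Q x)) x)); last by apply/funext => m; exact: cov_pi.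
apply: cvgB; first exact: cvg_cst.
by apply: inner_cvg; apply: ker_perp_cvg; exact: ker_perp_cov.
Qed.

End cameron_martin_space.

(** * Orthogonality of closed spans *)

Section L2_orthogonality.
Context d (T : measurableType d) (R : realType) (P : probability T R).

Lemma lclos_orth (V W : set (T -> R)) : (forall f, V f -> L2 P f) -> (forall f, W f -> L2 P f) ->
  (forall f h, V f -> W h -> dot P f h = 0) ->
  forall f h, lclos P V f -> lclos P W h -> dot P f h = 0.
Proof.
move=> VL WL VW.
have step f h : lclos P V f -> W h -> dot P f h = 0.
  move=> [Lf cf] Wh; have Lh := WL _ Wh; apply/eqP; rewrite -normr_le0; apply/ler_addgt0Pl => e e0.
  rewrite addr0; have h0 : 0 < N2 P h + 1 by rewrite ltr_wpDl ?N2_ge0.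
  have [v Vv hv] := cf (e / (N2 P h + 1)) (divr_gt0 e0 h0); have Lv := VL _ Vv.
  rewrite (_ : dot P f h = dot P (fun x => f x - v x) h); last by rewrite dotBl // (VW v h Vv Wh) subr0.
  apply: le_trans (dot_le _ Lh) _; first exact: L2B.
  rewrite ltr_pdivlMr // in hv; apply: le_trans (ltW hv).
  by rewrite ler_wpM2l ?N2_ge0 // lerDl.
move=> f h cf [Lh ch]; have Lf := lclos_L2 cf; apply/eqP; rewrite -normr_le0; apply/ler_addgt0Pl => e e0.
rewrite addr0; have f0 : 0 < N2 P f + 1 by rewrite ltr_wpDl ?N2_ge0.
have [w Ww hw] := ch (e / (N2 P f + 1)) (divr_gt0 e0 f0); have Lw := WL _ Ww.
rewrite (_ : dot P f h = dot P f (fun x => h x - w x)); last by rewrite dotBr // (step f w cf Ww) subr0.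
apply: le_trans (dot_le Lf _) _; first exact: L2B.
rewrite ltr_pdivlMr // in hw; rewrite mulrC; apply: le_trans (ltW hw).
by rewrite ler_wpM2l ?N2_ge0 // lerDl.
Qed.

(** The squared norm of f - p is the sum of those of f - s and s - p. *)
Lemma pythagoras f s p : L2 P f -> L2 P s -> L2 P p ->
  dot P (fun x => f x - s x) (fun x => s x - p x) = 0 ->
  N2 P (fun x => f x - s x) <= N2 P (fun x => f x - p x).
Proof.
move=> Lf Ls Lp h; rewrite ler_wsqrtr //.
pose a x := f x - s x; pose b x := s x - p x.
have La : L2 P a by exact: L2B.
have Lb : L2 P b by exact: L2B.
change (dot P a b = 0) in h; change (dot P a a <= dot P (fun x => f x - p x) (fun x => f x - p x)).
rewrite (_ : (fun x => f x - p x) = (fun x => a x + b x)); last first.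
  by apply/funext => x; rewrite /a /b addrA subrK.
rewrite (dotDl La Lb (L2D La Lb)) (dotDr La La Lb) (dotDr Lb La Lb).
rewrite h addr0 [dot P b a]dotC h add0r lerDl; exact: dot_ge0.
Qed.

End L2_orthogonality.

(** * Chaos spaces *)

Section multi_indices.

Definition mi_of_seq (s : seq nat) : multiindex :=
  [fsfun j in [fset k in s]%fset => count_mem j s | 0%N].

Lemma mi_of_seqE s j : mi_of_seq s j = count_mem j s.
Proof.
rewrite fsfunE inE /=; case: (boolP (j \in s)) => // /count_memPn -> //.
Qed.

Definition seq_of_mi (a : multiindex) : seq nat := flatten [seq nseq (a j) j | j <- finsupp a].

Lemma count_seq_of_mi a j : count_mem j (seq_of_mi a) = a j.
Proof.
rewrite /seq_of_mi count_flatten -map_comp sumnE big_map.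
under eq_bigr do rewrite /= count_nseq /=.
have [ja|ja] := boolP (j \in finsupp a).
  rewrite (bigD1_seq j) ?fset_uniq //= eqxx mul1n big1 ?addn0 // => i ij.
  by rewrite (negbTE ij).
rewrite big_seq big1; last by move=> i ia; rewrite (_ : (i == j) = false) //; apply/eqP => ij; rewrite -ij ia in ja.
by apply/esym/eqP; rewrite -memNfinsupp.
Qed.

Lemma size_seq_of_mi a : size (seq_of_mi a) = mdeg a.
Proof.
rewrite /seq_of_mi size_flatten /shape -map_comp sumnE big_map.
by apply: eq_bigr => j _; rewrite /= size_nseq.
Qed.

Lemma mem_seq_of_mi a j : (j \in seq_of_mi a) = (j \in finsupp a).
Proof. by rewrite -has_pred1 has_count count_seq_of_mi mem_finsupp lt0n. Qed.

Lemma mem_finsupp_count (a : multiindex) s : (forall j, count_mem j s = a j) ->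
  forall j, (j \in finsupp a) = (j \in s).
Proof. by move=> h j; rewrite mem_finsupp -h -lt0n -has_count has_pred1. Qed.

Lemma mdeg_count (a : multiindex) s : (forall j, count_mem j s = a j) -> mdeg a = size s.
Proof.
move=> h; rewrite -size_seq_of_mi; apply: perm_size; apply/allP => j _ /=.
by rewrite count_seq_of_mi h.
Qed.

End multi_indices.

Section chaos_span.
Context (R : realType) (X : completeNormedModType R) (ip : inner_product X) (g : gaussian ip).
Local Notation P := (glaw g).

Lemma white_noise_gvec j x : gidx g j -> white_noise g (gvec g j) x = ip x (gw g j).
Proof.
move=> jI; apply: cvg_lim => //; apply: cvg_near_cst; exists j.+1 => // n /= jn.
rewrite (bigD1 (Ordinal jn)) /=; last exact: mem_set.
rewrite gvec_ortho // eqxx mulr1 big1 ?addr0.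
  by rewrite /gw innerZr /fv mem_set.
move=> k /andP[/set_mem kI kj]; rewrite gvec_ortho // (_ : (j == k) = false) ?mulr0 //.
by apply/negbTE; rewrite eq_sym.
Qed.

Definition coords (x : X) (j : nat) : R := ip x (gw g j).

(** The two square roots multiply to alpha!, which cancels the factorials by which [hermite] differs
    from [He 1]. *)
Lemma Phi_wick (a : multiindex) (s : seq nat) r x : admissible g a ->
  (forall j, count_mem j s = a j) -> all (fun j => j < r)%N s ->
  Num.sqrt (mfact a)%:R * Phi g a x = wick r (coords x) s.
Proof.
move=> ha hs hr; rewrite /Phi mulrA -expr2 sqr_sqrtr // /mfact natr_prod -big_split /=.
have E : \prod_(j <- finsupp a) ((a j)`!%:R * hermite (a j) (white_noise g (gvec g j) x)) =
   \prod_(j <- finsupp a) (He 1 (a j)).[coords x j].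
  rewrite big_seq [RHS]big_seq; apply: eq_bigr => j ja.
  rewrite hermiteE white_noise_gvec; last exact: ha.
  by rewrite mulrC divfK // pnatr_eq0 -lt0n fact_gt0.
rewrite {}E /wick -(big_mkord xpredT (fun j => (He 1 (count_mem j s)).[coords x j])).
rewrite [RHS](bigID (fun j => j \in finsupp a)) /= [X in _ * X]big1 ?mulr1; last first.
  by move=> j; rewrite memNfinsupp => /eqP aj; rewrite hs aj /= hornerC.
rewrite -[RHS]big_filter; under [RHS]eq_bigr do rewrite hs.
apply: perm_big; apply: uniq_perm; rewrite ?fset_uniq ?filter_uniq ?iota_uniq //.
move=> j; rewrite mem_filter; case: (boolP (j \in finsupp a)) => //= ja.
rewrite (mem_finsupp_count hs) in ja.
by rewrite mem_index_iota; move/allP: hr => /(_ j ja) ->.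
Qed.

Definition cpair := {p : nat * (nat -> R) | csupp g p.2}.
(** With p = (r, c) this is He_n(W_h) for h = [hc g r c], of variance |h|^2 by [csupp]. *)
Definition He_D n (p : cpair) : borel X -> R := He_at g n (zc g (sval p).1 (sval p).2).
Definition Hspan n := lspan (He_D n).

Lemma He_D_isum n (p : cpair) x :
  He_D n p x = isum (sval p).1 (sval p).2 n (wick (sval p).1 (coords x)).
Proof.
case: p => -[r c] /= hc; rewrite isum_wick /He_D /He_at /= cov_zc //.
by rewrite inner_zc.
Qed.

Lemma He_D_L2 n p : L2 P (He_D n p).
Proof. exact/tame_L2/tame_He_at. Qed.

Lemma Hspan_L2 n f : Hspan n f -> L2 P f.
Proof. by move=> [s ->]; apply: L2_sum => p _; apply: L2Z; exact: He_D_L2. Qed.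

(** Polarization: the alternating sum over subsets A of the He_n(W_h), h being the sum of the basis
    vectors indexed by A, is n! times the Wick product. *)
Lemma wick_Hspan n r (s : seq nat) : size s = n -> all (fun j => j < r)%N s ->
  (forall j, j \in s -> gidx g j) -> Hspan n (fun x => wick r (coords x) s).
Proof.
move=> sn sr sI.
have hr k : (k < n)%N -> (nth 0%N s k < r)%N.
  by rewrite -sn => ks; move/(all_nthP 0%N): sr; apply.
pose i (k : 'I_n) : 'I_r := Ordinal (hr k (ltn_ord k)).
have iE : [seq val (i k) | k <- enum 'I_n] = s.
  rewrite (eq_map (g := fun k : 'I_n => nth 0%N s (val k))) // map_comp val_enum_ord -sn.
  by rewrite -[RHS](mkseq_nth 0%N).
have hc (A : {set 'I_n}) : csupp g (subset_weight R i A).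
  move=> j jI; rewrite /subset_weight big1 // => l _.
  rewrite (_ : (_ == _) = false) //; apply/eqP => lj; move: jI; rewrite -lj mem_set //.
  by apply: sI; rewrite -iE; apply/mapP; exists l; rewrite ?mem_enum.
pose pA (A : {set 'I_n}) : cpair := exist _ (r, subset_weight R i A) (hc A).
rewrite (_ : (fun x => _) = fun x => n`!%:R^-1 * \sum_(A : {set 'I_n}) (-1) ^+ (n - #|A|) * He_D n (pA A) x).
  have sH := lspan_lsubspace (He_D n).
  by apply: subspaceZ => //; apply: subspace_sum => // A _; apply: subspaceZ => //; exact: lspan_gen.
apply/funext => x; under eq_bigr do rewrite He_D_isum.
rewrite (polarization i (@wick_perm R r (coords x))) iE mulrA mulVf ?mul1r //.
Qed.

Definition Phi_span n : set (X -> R) := [set f | exists s : seq (R * multiindex),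
  (forall p, p \in s -> admissible g p.2 /\ mdeg p.2 = n) /\ f = fun x => \sum_(p <- s) p.1 * Phi g p.2 x].

Lemma mfact_gt0 a : 0 < Num.sqrt ((mfact a)%:R : R).
Proof. by rewrite sqrtr_gt0 ltr0n prodn_gt0 // => j; exact: fact_gt0. Qed.

Lemma Phi_Hspan a : admissible g a -> Hspan (mdeg a) (Phi g a).
Proof.
move=> ha; have hs := count_seq_of_mi a.
pose r := (\max_(j <- seq_of_mi a) j).+1.
have sr : all (fun j => j < r)%N (seq_of_mi a).
  by apply/allP => j js; rewrite ltnS leq_bigmax_seq.
rewrite (_ : Phi g a = fun x => (Num.sqrt (mfact a)%:R)^-1 * wick r (coords x) (seq_of_mi a)); last first.
  apply/funext => x; rewrite -(Phi_wick _ ha hs sr) mulrA mulVf ?mul1r //.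
  by rewrite gt_eqF // mfact_gt0.
apply: subspaceZ; first exact: lspan_lsubspace.
apply: wick_Hspan => //; first exact: size_seq_of_mi.
by move=> j; rewrite mem_seq_of_mi; exact: ha.
Qed.

Lemma Phi_span_sub n : Phi_span n `<=` Hspan n.
Proof.
move=> f [s [hs ->]]; have sH := lspan_lsubspace (He_D n).
rewrite (_ : (fun x => _) = fun x => \sum_(i < size s) (nth (0, [fsfun]) s i).1 * Phi g (nth (0, [fsfun]) s i).2 x); last first.
  by apply/funext => x; rewrite (big_nth (0, [fsfun])) big_mkord.
apply: subspace_sum => // i _; apply: subspaceZ => //.
have [ha <-] := hs _ (mem_nth (0, [fsfun]) (ltn_ord i)).
exact: Phi_Hspan.
Qed.

(** [isum_wick] expands He_n(W_h) into Wick products of index lists, each of which is a multiple of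
    a [Phi]. *)
Lemma Hspan_sub n : Hspan n `<=` Phi_span n.
Proof.
have sP : lsubspace (Phi_span n).
  split; first by exists [::]; split=> //; apply/funext => x; rewrite big_nil.
  move=> a f h [s [hs ->]] [t [ht ->]]; exists ([seq (a * p.1, p.2) | p <- s] ++ t); split.
    move=> p; rewrite mem_cat => /orP[/mapP[q qs ->]|]; [exact: (hs q qs)|exact: ht].
  apply/funext => x; rewrite big_cat big_map mulr_sumr /=; congr (_ + _).
  by apply: eq_bigr => p _; rewrite mulrA.
apply: lspan_sub => // -[[r c] /= hc].
rewrite (_ : He_D _ _ = fun x => \sum_(t : {ffun 'I_n -> 'I_r})
    (\prod_k c (t k)) * wick r (coords x) (ffun_seq t)); last first.
  by apply/funext => x; rewrite He_D_isum.
apply: subspace_sum => // t _.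
(* Lists with an inadmissible index have weight 0 by [csupp]. *)
have [tI|] := boolP [forall k, (val (t k)) \in gidx g]; last first.
  rewrite negb_forall => /existsP[k /negbTE kI].
  rewrite (_ : (fun x => _) = fun=> 0); first by case: sP.
  by apply/funext => x; rewrite (bigD1 k) //= hc // !mul0r.
have mt j : j \in ffun_seq t -> gidx g j.
  by move=> /mapP[k _ ->]; apply: set_mem; move/forallP: tI; exact.
pose a := mi_of_seq (ffun_seq t).
have ha j : count_mem j (ffun_seq t) = a j by rewrite mi_of_seqE.
have aa : admissible g a by move=> j; rewrite (mem_finsupp_count ha); exact: mt.
apply: subspaceZ => //.
rewrite (_ : (fun x => _) = fun x => Num.sqrt (mfact a)%:R * Phi g a x).
  apply: subspaceZ => //; exists [:: (1, a)]; split.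
    move=> p; rewrite inE => /eqP -> /=; split=> //.
    by rewrite (mdeg_count ha) size_map size_enum_ord.
  by apply/funext => x; rewrite big_seq1 mul1r.
apply/funext => x; apply/esym/Phi_wick => //.
by apply/allP => j /mapP[k _ ->]; exact: ltn_ord.
Qed.

(** The two spans coincide, hence so do their closures; this makes the He_n(W_h) available as
    generators on which to compare the operators. *)
Lemma chaosP n f : chaos g n f <-> lclos P (Hspan n) f.
Proof.
split=> [[/L2P Lf hf]|[Lf cf]].
  split=> // e /hf [s [hs h]]; exists (fun x => \sum_(p <- s) p.1 * Phi g p.2 x).
    by apply: Phi_span_sub; exists s.
  have Lp : L2 P (fun x => \sum_(p <- s) p.1 * Phi g p.2 x).
    by apply: (@Hspan_L2 n); apply: Phi_span_sub; exists s.
  by move: h; rewrite /l2norm LnormE ?lte_fin //; exact: L2B.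
split; first exact/L2P.
move=> e /cf [v Vv h]; have [s [hs vE]] := Hspan_sub Vv; exists s; split=> //.
rewrite /l2norm LnormE; last by apply: L2B => //; rewrite -vE; exact: Hspan_L2 Vv.
by rewrite lte_fin; move: h; rewrite vE.
Qed.

Lemma chaos_L2 n f : chaos g n f -> L2 P f.
Proof. by move=> /chaosP/lclos_L2. Qed.

Lemma chaos_lsubspace n : lsubspace (chaos g n).
Proof.
have sW := lclos_lsubspace (@Hspan_L2 n) (lspan_lsubspace (He_D n)).
rewrite (_ : chaos g n = lclos P (Hspan n)) //.
by apply/seteqP; split=> f /chaosP.
Qed.

Lemma chaos_orth n m f h : n != m -> chaos g n f -> chaos g m h -> dot P f h = 0.
Proof.
move=> nm /chaosP cf /chaosP ch.
apply: (lclos_orth (@Hspan_L2 n) (@Hspan_L2 m) _ cf ch) => {f h cf ch} _ _ [s ->] [t ->].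
have L2s k (u : seq (R * cpair)) : L2 P (fun x => \sum_(p <- u) p.1 * He_D k p.2 x).
  by apply: L2_sum => p _; apply: L2Z; exact: He_D_L2.
rewrite (@dot_suml _ _ _ P _ _ (fun p x => p.1 * He_D n p.2 x)) => [|p|//]; last by apply: L2Z; exact: He_D_L2.
apply: big1 => p _; rewrite dotC (@dot_suml _ _ _ P _ _ (fun p x => p.1 * He_D m p.2 x)) => [|q|]; last first.
- by apply: L2Z; exact: He_D_L2.
- by apply: L2Z; exact: He_D_L2.
apply: big1 => q _; rewrite dotZl ?dotZr //; try exact: He_D_L2; last by apply: L2Z; exact: He_D_L2.
by rewrite /He_D He_orth ?mulr0 // eq_sym.
Qed.

End chaos_span.

Lemma He_recX (R : realType) (v : R) k : 'X * He v k = He v k.+1 + (k%:R * v) *: He v k.-1.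
Proof. by case: k => [|k]; [rewrite mul0r scale0r addr0 mulr1|rewrite HeSS subrK]. Qed.

(** The three-term recurrence only uses sums and products, which [mcvg] respects, so argument and
    variance may vary together. *)
Lemma mcvg_He d (T : measurableType d) (R : realType) (P : probability T R)
  (f_ : nat -> T -> R) f (c : nat -> R) v n :
  mcvg P f_ f -> c m @[m --> \oo] --> v ->
  mcvg P (fun m x => (He (c m) n).[f_ m x]) (fun x => (He v n).[f x]).
Proof.
move=> cf cc; elim/ltn_ind: n => -[|[|n]] IH.
- under eq_fun do under eq_fun do rewrite /= hornerC.
  by under [X in mcvg _ _ X]eq_fun do rewrite /= hornerC; apply: mcvg_cst; exact: cvg_cst.
- under eq_fun do under eq_fun do rewrite /= hornerX.
  by under [X in mcvg _ _ X]eq_fun do rewrite /= hornerX.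
have E w y : (He w n.+2).[y] = y * (He w n.+1).[y] + (- (n.+1%:R * w)) * (He w n).[y].
  by rewrite HeSS hornerD hornerN hornerZ hornerM hornerX mulNr.
under eq_fun do under eq_fun do rewrite E.
under [X in mcvg _ _ X]eq_fun do rewrite E.
apply: mcvgD; first by apply: mcvgM => //; exact: IH.
apply: mcvgM; last exact: IH.
apply: mcvg_cst; apply: cvgN; apply: cvgM => //; exact: cvg_cst.
Qed.

(** * Limits of Gaussian functionals and the chaos expansion *)

Section gaussian_limits.
Context (R : realType) (X : completeNormedModType R) (ip : inner_product X) (g : gaussian ip).
Local Notation P := (glaw g).
Local Notation E f := (Rintegral P setT (f : borel X -> R)).
Implicit Types z : X.

(** The double factorial (2k - 1)!!, the moment of order 2k of a standard normal variable. *)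
Fixpoint gauss_moment k : R := if k is k'.+1 then k'.*2.+1%:R * gauss_moment k' else 1.

Lemma even_moment z k : E (fun x => ip x z ^+ (k * 2)) = gauss_moment k * cov g z z ^+ k.
Proof.
elim: k => [|k IH]; first by rewrite Rintegral_cst // (_ : fine (P setT) = 1) ?probability_setT // !mulr1.
by rewrite mulSn -[(2 + _)%N]addnC addn2 moment_rec_inner IH /= muln2 exprS; ring.
Qed.

Lemma N2_inner z k : N2 P (fun x => ip x z ^+ k) ^+ 2 = gauss_moment k * cov g z z ^+ k.
Proof.
rewrite sqr_N2 -even_moment; apply: eq_Rintegral => x _.
by rewrite exprM expr2.
Qed.

Lemma cvg_moment (u : nat -> R) k : u m @[m --> \oo] --> 0 ->
  gauss_moment k.+1 * u m ^+ k.+1 @[m --> \oo] --> 0.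
Proof.
move=> cu; rewrite -[X in _ --> X](_ : gauss_moment k.+1 * 0 ^+ k.+1 = 0); last by rewrite expr0n mulr0.
apply: cvgM; first exact: cvg_cst.
by apply: (@cvg_comp _ _ _ u (fun y => y ^+ k.+1)) cu _; exact: exprn_continuous.
Qed.

Lemma gauss_mcvg (z_ : nat -> X) z : cov g (z_ m - z) (z_ m - z) @[m --> \oo] --> 0 ->
  mcvg P (fun m x => ip x (z_ m)) (fun x => ip x z).
Proof.
move=> cz; split; [by move=> m; exact: tame_inner|exact: tame_inner|move=> k].
apply: sqr_cvg0; first by move=> n; exact: N2_ge0.
under eq_fun do under eq_fun do rewrite -innerBr.
under eq_fun do rewrite N2_inner.
exact: (@cvg_moment (fun m => cov g (z_ m - z) (z_ m - z))).
Qed.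

(** Z need not be a functional <., z>. The increments are, and each of their even moments is a
    constant times a power of their variance, so convergence of the variances gives the Cauchy
    bounds of [mcvg_of_cauchy]. *)
Lemma gauss_mcvg_lim (c : nat -> R) (v : R) (Z : borel X -> R) : csupp g c ->
  \sum_(k < m) c k ^+ 2 @[m --> \oo] --> v -> L2 P Z ->
  N2 P (fun x => ip x (zc g m c) - Z x) @[m --> \oo] --> 0 ->
  mcvg P (fun m x => ip x (zc g m c)) Z.
Proof.
move=> hc cv LZ cZ; apply: mcvg_of_cauchy => //; first by move=> m; exact: tame_inner.
move=> k e e0.
pose s m := \sum_(k < m) c k ^+ 2.
have nd : nondecreasing_seq s by apply/nondecreasing_seqP => m; rewrite /s big_ord_recr lerDl sqr_ge0.
have sv m : s m <= v by rewrite -(cvg_lim _ cv) //; apply: nondecreasing_cvgn_le => //; apply/cvg_ex; exists v.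
have c0 : (fun m => v - s m) @ \oo --> 0.
  by rewrite -(subrr v); apply: cvgB => //; exact: cvg_cst.
have /cvgrPdist_le /(_ e e0) [M _ hM] := @cvg_moment _ k c0.
have gm n : 0 <= gauss_moment n by elim: n => //= n IH; rewrite mulr_ge0.
have key m l : (M <= m)%N -> (m <= l)%N ->
    E (fun x => `|ip x (zc g l c) - ip x (zc g m c)| ^+ (k.+1 * 2)) <= e.
  move=> Mm ml.
  rewrite (_ : E _ = gauss_moment k.+1 * (s l - s m) ^+ k.+1); last first.
    rewrite -(cov_zcB hc ml) -even_moment; apply: eq_Rintegral => x _.
    by rewrite innerBr -normrX mulnC exprM ger0_norm // -exprM exprn_even_ge0 // oddM.
  have := hM M (leqnn _); rewrite [X in X -> _]/= -/(gauss_moment k.+1) sub0r normrN ger0_norm; last first.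
    by rewrite mulr_ge0 ?(gm k.+1) // exprn_ge0 // subr_ge0.
  apply: le_trans; rewrite ler_wpM2l ?(gm k.+1) // lerXn2r ?nnegrE ?subr_ge0 //; first exact: nd.
  by have := sv l; have := nd _ _ Mm; lra.
exists M => m l Mm Ml; have [ml|/ltnW lm] := leqP m l; first exact: key.
by under eq_Rintegral do rewrite distrC; exact: key.
Qed.

(** In the recurrence for He_(n+2)(a + Y), integration by parts turns the term with factor Y into (n
    + 1) var(Y) times the mean of He_n(a + Y), which lowers u by the variance of Y. *)
Lemma mean_He z a u n : E (fun x => (He u n).[a + ip x z]) = (He (u - cov g z z) n).[a].
Proof.
have tY (p : {poly R}) : tame P (fun x => p.[a + ip x z]).
  by apply: tame_horner; apply: tameD; [exact: tame_cst|exact: tame_inner].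
elim/ltn_ind: n => -[|[|n]] IH.
- rewrite /= hornerC; under eq_Rintegral do rewrite hornerC.
  by rewrite Rintegral_cst // (_ : fine (P setT) = 1) ?probability_setT // mulr1.
- rewrite /= hornerX; under eq_Rintegral do rewrite hornerX.
  rewrite RintegralD //; last exact: integrable_tame (tame_inner g z); last first.
    by apply: integrable_tame; exact: tame_cst.
  by rewrite mean_inner addr0 Rintegral_cst // (_ : fine (P setT) = 1) ?probability_setT // mulr1.
pose p := He u n.+1 \Po ('X + a%:P).
have pE x : p.[ip x z] = (He u n.+1).[a + ip x z].
  by rewrite /p horner_comp hornerD hornerX hornerC addrC.
have dpE x : p^`().[ip x z] = n.+1%:R * (He u n).[a + ip x z].
  rewrite /p deriv_comp deriv_He derivD derivX derivC addr0 mulr1 comp_polyZ hornerZ.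
  by rewrite horner_comp hornerD hornerX hornerC addrC.
have := stein1_inner g z p.
under eq_Rintegral do rewrite pE.
under [in RHS]eq_Rintegral do rewrite dpE.
rewrite RintegralZl //; last exact/integrable_tame/tY.
rewrite (IH n) // => st.
rewrite (_ : E _ = a * E (fun x => (He u n.+1).[a + ip x z]) + E (fun x => ip x z * (He u n.+1).[a + ip x z])
   - (n.+1%:R * u) * E (fun x => (He u n).[a + ip x z])).
  by rewrite (IH n.+1) // (IH n) // st HeSS hornerD hornerN hornerZ hornerM hornerX; ring.
have i1 := integrable_tame (tY (He u n.+1)); have i0 := integrable_tame (tY (He u n)).
have i2 := integrable_tame (tameM (tame_inner g z) (tY (He u n.+1))).
have i3 := integrable_tame (tameZ a (tY (He u n.+1))).
have i4 := integrable_tame (tameZ (n.+1%:R * u) (tY (He u n))).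
have i5 := integrable_tame (tameD (tameZ a (tY (He u n.+1))) (tameM (tame_inner g z) (tY (He u n.+1)))).
rewrite -!RintegralZl // -RintegralD // -RintegralB //.
by apply: eq_Rintegral => x _; rewrite HeSS hornerD hornerN hornerZ hornerM hornerX; ring.
Qed.

Lemma mean_He_lim (c : nat -> R) (v : R) (Z : borel X -> R) a u n : csupp g c ->
  \sum_(k < m) c k ^+ 2 @[m --> \oo] --> v ->
  mcvg P (fun m x => ip x (zc g m c)) Z ->
  E (fun x => (He u n).[a + Z x]) = (He (u - v) n).[a].
Proof.
move=> hc cv cZ.
have c1 : mcvg P (fun m x => a + ip x (zc g m c)) (fun x => a + Z x).
  by apply: mcvgD => //; apply: mcvg_cst; exact: cvg_cst.
have cu0 : (fun _ : nat => u) m @[m --> \oo] --> u by exact: cvg_cst.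
have c2 := mcvg_Rintegral (mcvg_He n c1 cu0).
have c3 : (He (u - \sum_(k < m) c k ^+ 2) n).[a] @[m --> \oo] --> (He (u - v) n).[a].
  have cu : u - \sum_(k < m) c k ^+ 2 @[m --> \oo] --> u - v by apply: cvgB => //; exact: cvg_cst.
  have ca : (fun _ : nat => a) m @[m --> \oo] --> a by exact: cvg_cst.
  have := mcvg_Rintegral (mcvg_He n (mcvg_cst P ca) cu).
  under eq_fun do rewrite Rintegral_cst // (_ : fine (P setT) = 1) ?probability_setT // mulr1.
  by rewrite Rintegral_cst // (_ : fine (P setT) = 1) ?probability_setT // mulr1.
rewrite -(cvg_lim _ c3) //; apply/esym/cvg_lim => //.
apply: cvg_trans c2; apply: near_eq_cvg; apply: nearW => m /=.
by rewrite mean_He cov_zc.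
Qed.

Definition He_all (p : nat * cpair g) : borel X -> R := He_D p.1 p.2.
Local Notation Hall := (lspan He_all).

Lemma Hall_L2 f : Hall f -> L2 P f.
Proof. by move=> [s ->]; apply: L2_sum => p _; apply: L2Z; exact: He_D_L2. Qed.

(** Multiplication by X keeps the span of the [He v k], by [He_recX], so every monomial is a
    combination of them. *)
Lemma pow_Hall n (p : cpair g) : Hall (fun x => ip x (zc g (sval p).1 (sval p).2) ^+ n).
Proof.
set z := zc _ _ _; set v := cov g z z; have sH := lspan_lsubspace He_all.
have [s hs] : exists s : seq (R * nat), 'X^n = \sum_(q <- s) q.1 *: He v q.2.
  elim: n => [|n [s hs]]; first by exists [:: (1, 0%N)]; rewrite big_seq1 scale1r.
  exists ([seq (q.1, q.2.+1) | q <- s] ++ [seq (q.1 * (q.2%:R * v), q.2.-1) | q <- s]).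
  rewrite exprS hs big_cat !big_map mulr_sumr -[RHS]big_split; apply: eq_bigr => q _.
  by rewrite -scalerAr He_recX scalerDr scalerA.
rewrite (_ : (fun x => _) = fun x => \sum_(q <- s) q.1 * He_all (q.2, p) x).
  by apply: subspace_sum => // q _; apply: subspaceZ => //; exact: lspan_gen.
apply/funext => x; rewrite -hornerXn hs horner_sum; apply: eq_bigr => q _.
by rewrite hornerZ.
Qed.

(** Powers of <., z> are dense, and z may be replaced by its projections on the first basis vectors,
    whose functionals are finite combinations and converge in all moments. *)
Lemma Hall_dense : separable_space X -> forall f, L2 P f -> lclos P Hall f.
Proof.
move=> sepX f /(ip_pow_dense sepX) Vf.
apply: (lclosK Hall_L2); apply: lclosS Vf; apply: lspan_sub.
  exact: (lclos_lsubspace Hall_L2 (lspan_lsubspace He_all)).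
move=> [z n]; rewrite /ip_pow /=.
pose c k := Num.sqrt (geig g k) * ip z (fv g k).
have hc : csupp g c by move=> k kI; rewrite /c fv0 ?mulr0.
have c1 : mcvg P (fun m x => ip x (zc g m c)) (fun x => ip x z).
  apply: gauss_mcvg; under eq_fun do rewrite -pi_zc.
  exact: cvg_cov_pi.
have c2 : mcvg P (fun m x => ip x (zc g m c) ^+ n) (fun x => ip x z ^+ n).
  elim: n => [|n IH].
    under eq_fun do under eq_fun do rewrite expr0.
    by under [X in mcvg _ _ X]eq_fun do rewrite expr0; apply: mcvg_cst; exact: cvg_cst.
  under eq_fun do under eq_fun do rewrite exprS.
  by under [X in mcvg _ _ X]eq_fun do rewrite exprS; exact: mcvgM.
apply: (lclos_lim Hall_L2 _ (tame_L2 (mcvg_tame c2)) (mcvg_N2 c2)) => m.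
by apply: (sub_lclos Hall_L2); exact: (pow_Hall n (exist _ (m, c) hc : cpair g)).
Qed.

Lemma Hall_split f : Hall f -> exists N (p : nat -> X -> R),
  (forall n, chaos g n (p n)) /\ f = fun x => \sum_(n < N) p n x.
Proof.
have s0 n : chaos g n (fun=> 0) by have [] := chaos_lsubspace g n.
move=> [s ->]; elim: s => [|[a [k q]] s [N [p [hp sE]]]].
  exists 0%N, (fun _ _ => 0); split=> //; apply/funext => x.
  by rewrite big_nil big_ord0.
exists (maxn N k.+1), (fun n x => (if (n < N)%N then p n x else 0) + (if n == k then a * He_all (k, q) x else 0)); split.
  move=> n; apply: (subspaceD (chaos_lsubspace g n)); first by case: ltnP.
  case: eqP => [->|_] //; apply: (subspaceZ _ (chaos_lsubspace g k)).
  by apply/chaosP; apply: (sub_lclos (@Hspan_L2 _ _ _ g k)); exact: lspan_gen.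
apply/funext => x; rewrite big_cons big_split /= addrC; congr (_ + _).
  have kN : (k < maxn N k.+1)%N by rewrite leq_max ltnSn orbT.
  rewrite (bigD1 (Ordinal kN)) //= eqxx big1 ?addr0 // => n nk.
  by rewrite (_ : (val n == k) = false) //; exact/negbTE.
have /(congr1 (fun f => f x)) /= -> := sE.
by rewrite (big_ord_widen _ (fun n => p n x) (leq_maxl N k.+1)) big_mkcond.
Qed.

(** A partial sum S_N of the projections is the best approximation of f among sums of chaoses of
    degree below N. So it does at least as well as any p in the dense span once N exceeds the
    degrees occurring in p. *)
Lemma chaos_decomposition (u : nat -> X -> R) f : separable_space X -> L2 P f ->
  (forall n, is_chaos_proj g n f (u n)) ->
  N2 P (fun x => \sum_(n < N) u n x - f x) @[N --> \oo] --> 0.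
Proof.
move=> sepX Lf hu.
have cu n : chaos g n (u n) by have [] := hu n.
have Lu n : L2 P (u n) by apply: chaos_L2.
have ou n h : chaos g n h -> dot P (fun x => f x - u n x) h = 0 by have [_] := hu n; apply.
apply/cvgrPdist_lt => e e0.
have [_ /(_ e e0) [p Hp hp]] := Hall_dense sepX Lf.
have [M [q [cq pE]]] := Hall_split Hp.
exists M => // N /= MN; rewrite sub0r normrN ger0_norm ?N2_ge0 // N2BC.
apply: le_lt_trans hp.
(* Padding with zeros up to N lets S_N - p split degree by degree. *)
pose q' n := if (n < M)%N then q n else fun=> 0.
have cq' n : chaos g n (q' n) by rewrite /q'; case: ltnP => // _; have [] := chaos_lsubspace g n.
have pE' : p = fun x => \sum_(n < N) q' n x.
  rewrite pE; apply/funext => x; rewrite (big_ord_widen _ (fun n => q n x) MN) big_mkcond.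
  by apply: eq_bigr => n _; rewrite /q'; case: ltnP.
have Ls : L2 P (fun x => \sum_(n < N) u n x) by apply: L2_sum => n _; exact: Lu.
have Lp : L2 P p by exact: Hall_L2.
apply: pythagoras => //.
rewrite (_ : (fun x => _ - p x) = fun x => \sum_(n < N) (u n x - q' n x)); last first.
  by apply/funext => x; rewrite pE' sumrB.
have cd n : chaos g n (fun x => u n x - q' n x) by apply: (subspaceB (chaos_lsubspace g n)).
rewrite dotC (@dot_suml _ _ _ P _ _ (fun (n : 'I_N) x => u n x - q' n x)) => [|n|]; last first.
- exact: L2B.
- exact: (chaos_L2 (cd n)).
apply: big1 => n _; rewrite dotC.
rewrite (_ : (fun x => f x - _) = fun x => (f x - u n x) - \sum_(k < N | k != n) u k x); last first.
  by apply/funext => x; rewrite (bigD1 n) //= opprD addrA.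
have Ld := chaos_L2 (cd n).
rewrite dotBl ?ou ?sub0r //; [|exact: L2B|by apply: L2_sum].
rewrite [X in - X](_ : _ = 0) ?oppr0 //.
rewrite /dot; under eq_Rintegral do rewrite mulr_suml.
rewrite (_ : Rintegral _ _ _ = dot P (fun x => \sum_(k < N) (if k != n then u k x else 0)) (fun x => u n x - q' n x)); last first.
  by apply: eq_Rintegral => x _; rewrite -mulr_suml big_mkcond.
have Lk (k : 'I_N) : L2 P (fun x => if k != n then u k x else 0) by case: (k != n) => //; exact: L2_cst.
rewrite (@dot_suml _ _ _ P _ _ (fun (k : 'I_N) x => if k != n then u k x else 0)) //.
apply: big1 => k _; case: (boolP (k != n)) => kn.
  exact: (chaos_orth (n := k) (m := n)) (cu k) (cd n).
by rewrite /dot; under eq_Rintegral do rewrite mul0r; rewrite Rintegral_cst // mul0r.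
Qed.

End gaussian_limits.

(** * Symmetric tensors *)

Section multi_sums.
Variables (R : realType) (n : nat).
Implicit Types (G : {ffun 'I_n -> nat} -> R) (S : set {ffun 'I_n -> nat}).

Definition ffun_val r (t : {ffun 'I_n -> 'I_r}) : {ffun 'I_n -> nat} := [ffun k => val (t k)].

(** A finite set of index tuples lies in some cube {0, ..., r - 1}^n, and r may be enlarged, so the
    bound is only required from m on. *)
Lemma esum_ffun_le S G (B : R) (m : nat) : (forall i, 0 <= G i) ->
  (forall r, (m <= r)%N -> \sum_(t : {ffun 'I_n -> 'I_r}) G (ffun_val t) <= B) ->
  (\esum_(i in S) (G i)%:E <= B%:E)%E.
Proof.
move=> G0 GB; apply: ge_ereal_sup => _ [A [fA AS] <-].
rewrite fsbig_finite //= sumEFin lee_fin.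
pose r := maxn m (\max_(i <- fset_set A) \max_(k < n) i k).+1.
apply: le_trans (GB r (leq_maxl _ _)).
have lift_ex i : i \in fset_set A -> exists t : {ffun 'I_n -> 'I_r}, ffun_val t = i.
  move=> iA; have ir k : (i k < r)%N.
    rewrite leq_max ltnS; apply/orP; right.
    by apply: leq_trans (leq_bigmax_seq _ iA isT); exact: (leq_bigmax k).
  by exists [ffun k => Ordinal (ir k)]; apply/ffunP => k; rewrite !ffunE.
apply: (@le_trans _ _ (\sum_(i <- fset_set A) \sum_(t : {ffun 'I_n -> 'I_r}) (ffun_val t == i)%:R * G (ffun_val t))).
  rewrite big_seq [leRHS]big_seq; apply: ler_sum => i /lift_ex [t <-].
  rewrite (bigD1 t) //= eqxx mul1r lerDl sumr_ge0 // => u _.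
  by rewrite mulr_ge0 // ler0n.
rewrite exchange_big /=; apply: ler_sum => t _.
rewrite -mulr_suml ler_piMl //.
rewrite -natr_sum -[leRHS]/(1%:R) ler_nat.
have -> : (\sum_(i <- fset_set A) (ffun_val t == i))%N = count_mem (ffun_val t) (fset_set A).
  by rewrite -sum1_count [RHS]big_mkcond; apply: eq_bigr => i _; rewrite /= eq_sym; case: eqP.
by rewrite count_uniq_mem ?fset_uniq // leq_b1.
Qed.

Lemma esumZ_le S G (c : R) : 0 <= c ->
  (\esum_(i in S) (c * G i)%:E <= c%:E * \esum_(i in S) (G i)%:E)%E.
Proof.
move=> c0; apply: ge_ereal_sup => _ [A hA <-].
rewrite fsbig_finite /=; last by case: hA.
rewrite sumEFin -mulr_sumr EFinM; apply: lee_wpmul2l; first by rewrite lee_fin.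
apply: esum_ge; exists A => //; rewrite fsbig_finite /=; last by case: hA.
by rewrite sumEFin.
Qed.

Lemma sum_prod_sqr r (a : 'I_n -> nat -> R) :
  \sum_(t : {ffun 'I_n -> 'I_r}) (\prod_k a k (ffun_val t k)) ^+ 2 =
  \prod_k \sum_(j < r) a k j ^+ 2.
Proof.
rewrite bigA_distr_bigA; apply: eq_bigr => t _; rewrite -prodrXl.
by apply: eq_bigr => k _; rewrite ffunE.
Qed.

End multi_sums.

Section tensors.
Context (R : realType) (X : completeNormedModType R) (ip : inner_product X) (g : gaussian ip) (n : nat).
Local Notation H := (CM g).
Local Notation hin := (hinner H).
Implicit Types (F G : Defs.form X n).

Lemma hinner_le h k : `|hin h k| <= hnorm H h * hnorm H k.
Proof.
rewrite /hnorm (_ : hin h h = ip (perp_inv ip (gsqrt g) h) (perp_inv ip (gsqrt g) h)) //.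
rewrite (_ : hin k k = ip (perp_inv ip (gsqrt g) k) (perp_inv ip (gsqrt g) k)) //.
rewrite -!norm_inner; exact: inner_le.
Qed.

Lemma sqr_hnorm h : hnorm H h ^+ 2 = hin h h.
Proof. by rewrite sqr_sqrtr // hinner_ge0. Qed.

(** The square of [tensor_norm], kept apart to compute without the extended square root. *)
Definition norm2_form F : \bar R :=
  \esum_(i in [set i : {ffun 'I_n -> nat} | forall k, gidx g (i k)])
    ((F (fun k => cmvec g (i k))) ^+ 2)%:E.

Lemma norm2_form_ge0 F : (0 <= norm2_form F)%E.
Proof. by apply: esum_ge0 => i _; rewrite lee_fin sqr_ge0. Qed.

Lemma tensor_norm_lty F : (tensor_norm g F < +oo)%E <-> (norm2_form F < +oo)%E.
Proof.
have h := norm2_form_ge0 F; rewrite /tensor_norm -/(norm2_form F).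
by case: (norm2_form F) h => [r| |] //= _; split=> // _; rewrite ltry.
Qed.

Lemma CM_cmvec k : gidx g k -> H (cmvec g k).
Proof. by move=> kI; rewrite -cmb_cmvec ?mem_set //; exact: CM_cmb. Qed.

Lemma tensor_norm_lin a F G : (tensor_norm g F < +oo)%E -> (tensor_norm g G < +oo)%E ->
  (tensor_norm g (fun v => (a * F v + G v)%R) < +oo)%E.
Proof.
move=> /tensor_norm_lty hF /tensor_norm_lty hG; apply/tensor_norm_lty.
apply: (@le_lt_trans _ _ ((2 * a ^+ 2)%:E * norm2_form F + 2%:E * norm2_form G)%E); last first.
  rewrite lte_add_pinfty // lte_mul_pinfty // lee_fin.
  exact: mulr_ge0 (ler0n R 2) (sqr_ge0 a).
have h1 := esumZ_le [set i : {ffun 'I_n -> nat} | forall k, gidx g (i k)]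
  (fun i => (F (fun k => cmvec g (i k))) ^+ 2) (mulr_ge0 (ler0n R 2) (sqr_ge0 a)).
have h2 := esumZ_le [set i : {ffun 'I_n -> nat} | forall k, gidx g (i k)]
  (fun i => (G (fun k => cmvec g (i k))) ^+ 2) (ler0n R 2).
apply: (le_trans _ (leeD h1 h2)); rewrite -esumD; last first.
- by move=> i _; rewrite lee_fin (mulr_ge0 (ler0n R 2) (sqr_ge0 _)).
- by move=> i _; rewrite lee_fin (mulr_ge0 (mulr_ge0 (ler0n R 2) (sqr_ge0 _)) (sqr_ge0 _)).
apply: le_esum => i _; rewrite -EFinD lee_fin.
set x := F _; set y := G _; have := sqr_ge0 (a * x - y).
rewrite sqrrB sqrrD !exprMn; lra.
Qed.

Lemma multilinear_lin a F G : multilinear_form g F -> multilinear_form g G ->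
  multilinear_form g (fun v => a * F v + G v).
Proof.
move=> mF mG k b v v1 v2 h1 h2 hk hj.
rewrite (mF k b v v1 v2) // (mG k b v v1 v2) //; ring.
Qed.

Lemma is_tensor_lin a F G : is_tensor g F -> is_tensor g G ->
  is_tensor g (fun v => a * F v + G v).
Proof.
move=> [mF [C1 b1] n1] [mG [C2 b2] n2]; split; [exact: multilinear_lin| |exact: tensor_norm_lin].
exists (`|a| * C1 + C2) => v hv; apply: le_trans (ler_normD _ _) _.
by rewrite normrM mulrDl -mulrA lerD ?b2 // ler_wpM2l // b1.
Qed.

Lemma is_sym_lin a F G : is_sym_tensor g F -> is_sym_tensor g G ->
  is_sym_tensor g (fun v => a * F v + G v).
Proof.
move=> [tF sF] [tG sG]; split; first exact: is_tensor_lin.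
by move=> s v hv; rewrite sF // sG.
Qed.

Lemma is_tensor0 : is_tensor g (n := n) (fun=> 0 : R).
Proof.
split; first by move=> k a v v1 v2 *; rewrite mulr0 addr0.
  by exists 0 => v _; rewrite normr0 mul0r.
apply/tensor_norm_lty; rewrite /norm2_form esum1 // => i _.
by rewrite expr0n.
Qed.

Lemma is_sym0 : is_sym_tensor g (n := n) (fun=> 0 : R).
Proof. by split=> //; exact: is_tensor0. Qed.

Lemma is_tensor_sum I (s : seq I) (a : I -> R) (F : I -> Defs.form X n) :
  (forall i, is_tensor g (F i)) -> is_tensor g (fun v => \sum_(i <- s) a i * F i v).
Proof.
move=> hF; elim: s => [|i s IH].
  by rewrite (_ : (fun v => _) = fun=> 0); [exact: is_tensor0|apply/funext => v; rewrite big_nil].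
rewrite (_ : (fun v => _) = fun v => a i * F i v + \sum_(j <- s) a j * F j v); last first.
  by apply/funext => v; rewrite big_cons.
exact: is_tensor_lin.
Qed.

Lemma is_sym_sum I (s : seq I) (a : I -> R) (F : I -> Defs.form X n) :
  (forall i, is_sym_tensor g (F i)) -> is_sym_tensor g (fun v => \sum_(i <- s) a i * F i v).
Proof.
move=> hF; split; first by apply: is_tensor_sum => i; case: (hF i).
move=> p v hv; apply: eq_bigr => i _; congr (_ * _); by have [_] := hF i; apply.
Qed.

Lemma cmvec_coord h k : gidx g k -> hin h (cmvec g k) = coord g h k.
Proof. by move=> kI; rewrite /coord cmb_cmvec // mem_set. Qed.

Lemma pure_tensor_is_tensor (v : 'I_n -> X) : cm_tuple g v -> is_tensor g (pure_tensor g v).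
Proof.
move=> hv; split.
- move=> k a w w1 w2 h1 h2 hk hj; rewrite /pure_tensor !(bigD1 (P := xpredT) k) //.
  have -> : hin (v k) (w k) = a * hin (v k) (w1 k) + hin (v k) (w2 k).
    by rewrite hk 3!(hinnerC g (v k)) hinner_lin.
  rewrite [LHS]mulrDl -mulrA.
  congr (_ * (_ * _) + _ * _); apply: eq_bigr => j /andP[_ jk]; have [e1 e2] := hj j jk.
    by rewrite e1.
  by rewrite e2.
- exists (\prod_i hnorm H (v i)) => w hw; rewrite /pure_tensor normr_prod -big_split /=.
  by apply: ler_prod => i _; rewrite normr_ge0 hinner_le.
apply/tensor_norm_lty; apply: le_lt_trans (ltry (\prod_k hin (v k) (v k))).
apply: (@le_trans _ _ (\esum_(i in [set i : {ffun 'I_n -> nat} | forall k, gidx g (i k)])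
    ((\prod_k coord g (v k) (i k)) ^+ 2)%:E)).
  apply: le_esum => i iI; rewrite lee_fin /pure_tensor.
  by rewrite (eq_bigr (fun k => coord g (v k) (i k))) // => k _; rewrite cmvec_coord //; exact: iI.
apply: (@esum_ffun_le R n _ _ _ 0%N) => [i|r _]; first exact: sqr_ge0.
rewrite (sum_prod_sqr _ (fun k => coord g (v k))); apply: ler_prod => k _.
by rewrite coord_sum_le andbT sumr_ge0 // => j _; exact: sqr_ge0.
Qed.

Definition hpow (h : X) : Defs.form X n := pure_tensor g (fun=> h).

Lemma hpow_sym h : H h -> is_sym_tensor g (hpow h).
Proof.
move=> hh; split; first by apply: pure_tensor_is_tensor.
move=> s v _; rewrite /hpow /pure_tensor.
by rewrite [RHS](reindex_inj (@perm_inj _ s)).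
Qed.

(** Truncating h to its first m coordinates leaves each coefficient a of the tensor power unchanged
    or makes it 0, so the new coefficient b satisfies (a - b)^2 = a^2 - b^2. *)
Lemma hpow_hc_dist h m : H h ->
  (norm2_form (fun v => - 1 * hpow (hc g m (coord g h)) v + hpow h v)%R <=
   (hin h h ^+ n - (\sum_(j < m) coord g h j ^+ 2) ^+ n)%:E)%E.
Proof.
move=> hh; pose a := coord g h; pose b j := if (j < m)%N then a j else 0.
have bE j : coord g (hc g m a) j = b j.
  rewrite coord_hc /b; case: ltnP => //= _; case: (boolP (j \in gidx g)) => // /negbTE jI.
  by rewrite /a coord_notin.
apply: (@le_trans _ _ (\esum_(i in [set i : {ffun 'I_n -> nat} | forall k, gidx g (i k)])
    ((\prod_k a (i k)) ^+ 2 - (\prod_k b (i k)) ^+ 2)%:E)).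
  apply: le_esum => i iI; rewrite lee_fin /hpow /pure_tensor.
  rewrite (eq_bigr (fun k => b (i k))); last by move=> k _; rewrite cmvec_coord ?bE //; exact: iI.
  rewrite [X in _ + X](eq_bigr (fun k => a (i k))); last by move=> k _; rewrite cmvec_coord //; exact: iI.
  have [ab|->] : \prod_k b (i k) = \prod_k a (i k) \/ \prod_k b (i k) = 0.
    have [/forallP im|] := boolP [forall k, (i k < m)%N].
      by left; apply: eq_bigr => k _; rewrite /b im.
    rewrite negb_forall => /existsP[k /negbTE km]; right.
    by rewrite (bigD1 k) //= /b km mul0r.
  - by rewrite ab; nra.
  - by rewrite mulr0 add0r expr0n subr0.
apply: (@esum_ffun_le _ _ _ _ _ m) => [i|r mr].
  rewrite subr_ge0 -!prodrXl; apply: ler_prod => k _; rewrite sqr_ge0 /b.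
  by case: ifP => _; rewrite ?expr0n ?sqr_ge0 /= ?lexx.
rewrite sumrB (sum_prod_sqr _ (fun=> a)) (sum_prod_sqr _ (fun=> b)) !prodr_const card_ord.
rewrite lerB // ?lerXn2r ?nnegrE ?hinner_ge0 ?sumr_ge0 //; try (by move=> j _; exact: sqr_ge0).
  exact: coord_sum_le.
rewrite (big_ord_widen _ (fun j => a j ^+ 2) mr) big_mkcond; apply: ler_sum => j _.
by rewrite /b; case: ifP => //; rewrite expr0n.
Qed.

End tensors.

(** * The Wiener isomorphism on tensor powers *)

Section wiener_iso.
Context (R : realType) (X : completeNormedModType R) (ip : inner_product X) (g : gaussian ip) (n : nat).
Local Notation P := (glaw g).
Local Notation H := (CM g).
Local Notation hin := (hinner H).
Implicit Types (F G : Defs.form X n).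

Lemma l2normE f : L2 P f -> l2norm P f = (N2 P f)%:E.
Proof. by move=> Lf; rewrite /l2norm LnormE. Qed.

Lemma eval_le F (i : 'I_n -> nat) : (forall k, gidx g (i k)) ->
  ((F (fun k => cmvec g (i k)) ^+ 2)%:E <= norm2_form g F)%E.
Proof.
move=> hi; apply: esum_ge.
exists [set [ffun k => i k]].
  by split; [exact: finite_set1 | move=> _ -> k /=; rewrite ffunE].
rewrite fsbig_set1 lee_fin.
rewrite (_ : (fun k => _) = (fun k => cmvec g ([ffun k => i k] k))) //.
by apply/funext => k; rewrite ffunE.
Qed.

Lemma norm2_form_lty F : is_tensor g F -> (norm2_form g F < +oo)%E.
Proof. by move=> [_ _ /tensor_norm_lty]. Qed.

Variable Psi : Defs.form X n -> X -> R.
Hypothesis PsiP : is_wiener_iso g Psi.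

Lemma Psi_chaos F : is_sym_tensor g F -> chaos g n (Psi F).
Proof. by case: PsiP => h _ _ _ _; exact: h. Qed.

Lemma Psi_L2 F : is_sym_tensor g F -> L2 P (Psi F).
Proof. by move=> /Psi_chaos/chaos_L2. Qed.

Lemma Psi_norm F : is_sym_tensor g F ->
  (N2 P (Psi F) ^+ 2)%:E = (n`!%:R%:E * norm2_form g F)%E.
Proof.
move=> sF; case: PsiP => _ _ /(_ F sF) + _ _; rewrite l2normE; last exact: Psi_L2.
have h0 := norm2_form_ge0 g F; have h1 : (norm2_form g F < +oo)%E by apply: norm2_form_lty; case: sF.
rewrite /tensor_norm -/(norm2_form g F); case: (norm2_form g F) h0 h1 => [r| |] //= r0 _ [->].
by rewrite exprMn !sqr_sqrtr // ?EFinM.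
Qed.

Lemma Psi_sub F G : is_sym_tensor g F -> is_sym_tensor g G ->
  (N2 P (fun x => Psi F x - Psi G x)%R ^+ 2)%:E =
  (n`!%:R%:E * norm2_form g (fun v => -1 * G v + F v)%R)%E.
Proof.
move=> sF sG; have sFG := is_sym_lin (-1) sG sF.
rewrite -Psi_norm //; congr (_ ^+ 2)%:E.
case: PsiP => _ /(_ (-1) G F sG sF) h _ _ _.
have LFG : L2 P (fun x => -1 * Psi G x + Psi F x).
  by apply: L2D; [apply: L2Z|]; exact: Psi_L2.
rewrite (N2_ae _ LFG h); last exact: Psi_L2.
by congr (N2 P _); apply/funext => x; rewrite mulN1r addrC.
Qed.

Lemma Psi0 : (Psi (fun=> 0) : borel X -> R) = (fun=> 0) %[ae P].
Proof.
have s0 := is_sym0 g n; apply: N2_eq0; first exact: Psi_L2.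
apply/eqP; rewrite -sqrf_eq0 -eqe Psi_norm //.
by rewrite [norm2_form _ _](_ : _ = 0%E) ?mule0 // /norm2_form esum1 // => i iI; rewrite expr0n.
Qed.

Lemma Psi_sum I (s : seq I) (a : I -> R) (F : I -> Defs.form X n) :
  (forall i, is_sym_tensor g (F i)) ->
  (Psi (fun v => \sum_(i <- s) a i * F i v) : borel X -> R) =
  (fun x => \sum_(i <- s) a i * Psi (F i) x) %[ae P].
Proof.
move=> hF; elim: s => [|i s IH].
  rewrite (_ : (fun v => _) = (fun=> 0)); last by apply/funext => v; rewrite big_nil.
  by apply: filterS Psi0 => x h _; rewrite h // big_nil.
rewrite (_ : (fun v => _) = fun v => a i * F i v + \sum_(j <- s) a j * F j v); last first.
  by apply/funext => v; rewrite big_cons.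
case: PsiP => _ /(_ (a i) _ _ (hF i) (is_sym_sum s a hF)) h _ _ _.
by apply: filterS2 h IH => x h1 h2 _; rewrite h1 // h2 // big_cons.
Qed.

Definition symt (t : 'I_n -> nat) : Defs.form X n := fun w =>
  n`!%:R^-1 * \sum_(s : {perm 'I_n}) pure_tensor g (fun k => cmvec g (t (s k))) w.

Lemma symt_sym t : (forall k, gidx g (t k)) -> is_sym_tensor g (symt t).
Proof.
move=> tI; split.
  rewrite (_ : symt t = fun w => \sum_(s : {perm 'I_n}) n`!%:R^-1 * pure_tensor g (fun k => cmvec g (t (s k))) w).
    by apply: is_tensor_sum => s; apply: pure_tensor_is_tensor => k; exact: CM_cmvec.
  by apply/funext => w; rewrite /symt mulr_sumr.
move=> p v _; rewrite /symt; congr (_ * _).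
rewrite (reindex_inj (@mulgI _ p)) /=; apply: eq_bigr => s _; rewrite /pure_tensor.
by rewrite [RHS](reindex_inj (@perm_inj _ p)); apply: eq_bigr => k _; rewrite permM.
Qed.

Lemma symt_perm t (p : {perm 'I_n}) : symt (fun k => t (p k)) = symt t.
Proof.
apply/funext => w; rewrite /symt; congr (_ * _).
rewrite [RHS](reindex_inj (@mulIg _ p)) /=; apply: eq_bigr => s _.
by rewrite /pure_tensor; apply: eq_bigr => k _; rewrite permM.
Qed.

(** Psi is prescribed on sorted index lists; sorting permutes the entries of t, to which [symt] is
    insensitive. *)
Lemma Psi_symt r (t : {ffun 'I_n -> 'I_r}) : (forall k, gidx g (t k)) ->
  (Psi (symt (fun k => t k)) : borel X -> R) = (fun x => wick r (coords g x) (ffun_seq t)) %[ae P].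
Proof.
move=> tI; pose u := [tuple val (t k) | k < n].
pose i := [tuple of sort leq u].
have uE : (u : seq nat) = ffun_seq t by rewrite /u /= /ffun_seq.
have /tuple_permP [p ip_] : perm_eq u i by rewrite perm_sym perm_sort.
have tE k : val (t k) = tnth i (p k).
  have := congr1 (fun s => nth 0%N s k) ip_.
  by rewrite -[in LHS]tnth_nth -[in RHS]tnth_nth !tnth_mktuple.
have iI k : gidx g (tnth i k).
  by rewrite -[k](permKV p) -tE; exact: tI.
pose a := mi_of_seq (ffun_seq t).
have ia j : count_mem j i = a j.
  have /seq.permP -> : perm_eq i u by rewrite perm_sort.
  by rewrite mi_of_seqE -uE.
case: PsiP => _ _ _ _ /(_ a i (sort_sorted leq_total u) iI ia) h.
have sE : symt (fun k => t k) = symt (tnth i).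
  by rewrite -(symt_perm (tnth i) p); congr symt; apply/funext => k; rewrite -tE.
rewrite sE; apply: filterS h => x h _; rewrite h //.
apply: Phi_wick; last by apply/allP => j /mapP[k _ ->]; exact: ltn_ord.
- move=> j; rewrite (@mem_finsupp_count a (ffun_seq t)); last by move=> l; rewrite mi_of_seqE.
  by move=> /mapP[k _ ->]; exact: tI.
- by move=> j; rewrite mi_of_seqE.
Qed.

(** Each permutation reindexes the expansion of the product of sums, so the expansion equals its
    average over all permutations; averaging symmetrises the basis tensors. *)
Lemma hpow_hc_symt r (c : nat -> R) (w : 'I_n -> X) : csupp g c ->
  hpow g (n := n) (hc g r c) w = \sum_(t : {ffun 'I_n -> 'I_r} | [forall k, val (t k) \in gidx g])
    (\prod_k c (t k)) * symt (fun k => t k) w.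
Proof.
move=> hcs; rewrite /hpow /pure_tensor.
under eq_bigr do rewrite hinner_hc.
pose A (t : {ffun 'I_n -> 'I_r}) : R := \prod_k (c (t k) * coord g (w k) (t k)).
have E1 : \prod_(k < n) \sum_(j < r) c j * coord g (w k) j = \sum_t A t.
  by rewrite bigA_distr_bigA.
have E2 (s : {perm 'I_n}) : \sum_t A t = \sum_(t : {ffun 'I_n -> 'I_r}) (\prod_k c (t k)) * \prod_k coord g (w k) (t (s k)).
  rewrite (reindex (fun t : {ffun 'I_n -> 'I_r} => [ffun k => t (s k)])) /=; last first.
    exists (fun t => [ffun k => t (s^-1%g k)]) => t _; apply/ffunP => k; rewrite !ffunE ?permK ?permKV //.
  apply: eq_bigr => t _; rewrite /A big_split /= [X in _ = X * _](reindex_inj (@perm_inj _ s)).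
  by congr (_ * _); apply: eq_bigr => k _; rewrite ffunE.
rewrite E1.
have -> : \sum_t A t = n`!%:R^-1 * \sum_(s : {perm 'I_n}) \sum_t A t.
  by rewrite sumr_const card_Sn mulrnAr -[RHS]mulr_natl mulrA mulfV ?mul1r // pnatr_eq0 -lt0n fact_gt0.
rewrite (eq_bigr _ (fun s _ => E2 s)) exchange_big mulr_sumr /=.
rewrite (bigID (fun t : {ffun 'I_n -> 'I_r} => [forall k, val (t k) \in gidx g])) /= addrC big1 ?add0r.
  apply: eq_bigr => t /forallP tI; rewrite -mulr_sumr mulrCA; congr (_ * _).
  rewrite /symt; congr (_ * _); apply: eq_bigr => s _; apply: eq_bigr => k _.
  by rewrite hinnerC cmvec_coord //; apply: set_mem; exact: tI.
move=> t; rewrite negb_forall => /existsP[k /negbTE kI].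
by rewrite -mulr_sumr (bigD1 k) //= hcs // !mul0r mulr0.
Qed.

Lemma Psi_hpow_hc (p : cpair g) :
  (Psi (hpow g (n := n) (hc g (sval p).1 (sval p).2)) : borel X -> R) = He_D n p %[ae P].
Proof.
case: p => -[r c] /= hcs.
pose B (t : {ffun 'I_n -> 'I_r}) := [forall k, val (t k) \in gidx g].
pose G (t : {ffun 'I_n -> 'I_r}) : Defs.form X n := if B t then symt (fun k => t k) else fun=> 0.
have hG t : is_sym_tensor g (G t).
  rewrite /G; case: ifP => [/forallP tI|_]; last exact: is_sym0.
  by apply: symt_sym => k; apply: set_mem; exact: tI.
rewrite (_ : hpow g (n := n) (hc g r c) = fun w => \sum_(t : {ffun 'I_n -> 'I_r}) (\prod_k c (t k)) * G t w); last first.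
  apply/funext => w; rewrite hpow_hc_symt // [RHS](bigID B) /= [X in _ = _ + X]big1 ?addr0.
    by apply: eq_bigr => t Bt; rewrite /G ifT.
  by move=> t Bt; rewrite /G ifN // mulr0.
(* There are finitely many t, so the exceptional null sets can be united. *)
have hP : {ae P, forall x : borel X, setT x -> forall t, B t -> Psi (G t) x = wick r (coords g x) (ffun_seq t)}.
  have : forall t, t \in index_enum {ffun 'I_n -> 'I_r} -> {ae P, forall x : borel X, B t -> Psi (G t) x = wick r (coords g x) (ffun_seq t)}.
    move=> t _; have [Bt|Bt] := boolP (B t); last by apply: aeW.
    have := @Psi_symt r t _; rewrite /G ifT // => h.
    by apply: filterS (h _) => [x hx _|k]; [exact: hx|apply: set_mem; move/forallP: Bt; exact].
  move=> h; have {}h : {ae P, forall x : borel X, forall t, t \in index_enum {ffun 'I_n -> 'I_r} -> B t -> Psi (G t) x = wick r (coords g x) (ffun_seq t)}.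
    elim: (index_enum _) h => [_|t s IH h]; first exact: aeW.
    have h1 := h t (mem_head _ _).
    have {IH}h2 := IH (fun u us => h u (mem_behead (s := t :: s) us)).
    apply: filterS2 h1 h2 => x h1 h2 u; rewrite inE => /orP[/eqP -> //|]; exact: h2.
  by apply: filterS h => x h _ t; apply: h; rewrite mem_index_enum.
apply: filterS2 hP (Psi_sum (index_enum {ffun 'I_n -> 'I_r}) (fun t : {ffun 'I_n -> 'I_r} => \prod_k c (t k)) hG) => x h1 h2 _.
rewrite h2 // He_D_isum /isum /=; apply: eq_bigr => t _.
have [Bt|] := boolP (B t); first by rewrite h1.
by rewrite negb_forall => /existsP[k /negbTE kI]; rewrite (bigD1 k) //= hcs // !mul0r.
Qed.

End wiener_iso.

Lemma cvg_pow (R : realType) (u : nat -> R) (l : R) n :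
  u m @[m --> \oo] --> l -> u m ^+ n @[m --> \oo] --> l ^+ n.
Proof.
move=> ul; elim: n => [|n IH]; first by rewrite expr0; apply: cvg_cst.
under eq_fun do rewrite exprS.
by rewrite exprS; exact: cvgM.
Qed.

Section wiener_iso_hpow.
Context (R : realType) (X : completeNormedModType R) (ip : inner_product X) (g : gaussian ip) (n : nat).
Local Notation P := (glaw g).
Local Notation H := (CM g).
Local Notation hin := (hinner H).
Implicit Types (F G : Defs.form X n).
Variable Psi : Defs.form X n -> X -> R.
Hypothesis PsiP : is_wiener_iso g Psi.

Definition coord_pair h m : cpair g := exist _ (m, coord g h) (csupp_coord h).

(** Z plays the role of W_h. Truncations of h are covered by [Psi_hpow_hc]; their images converge to
    Psi of the tensor power by isometry and [hpow_hc_dist], and to the Hermite polynomial of Z by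
    [mcvg_He]. *)
Lemma Psi_hpow h (Z : borel X -> R) : H h ->
  mcvg P (fun m x => ip x (zc g m (coord g h))) Z ->
  (Psi (hpow g h) : borel X -> R) = (fun x => (He (hin h h) n).[Z x]) %[ae P].
Proof.
move=> hh hZ.
pose u m : borel X -> R := fun x => (He (\sum_(j < m) coord g h j ^+ 2) n).[ip x (zc g m (coord g h))].
have uE m : u m = He_D n (coord_pair h m).
  by apply/funext => x; rewrite /He_D /He_at /= cov_zc //; exact: csupp_coord.
have hu : mcvg P u (fun x => (He (hin h h) n).[Z x]) by apply: mcvg_He hZ (cvg_coord_sum hh).
have Lu m : L2 P (u m) by rewrite uE; exact: He_D_L2.
have LZ : L2 P (fun x => (He (hin h h) n).[Z x]) by apply: tame_L2; exact: mcvg_tame hu.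
have Lh : L2 P (Psi (hpow g h)) by apply: (Psi_L2 PsiP); exact: hpow_sym.
have h1 : N2 P (fun x => Psi (hpow g h) x - u m x) @[m --> \oo] --> 0.
  apply: sqr_cvg0 => [m|]; first exact: N2_ge0.
  apply: (@squeeze0 _ _ (fun m => n`!%:R * (hin h h ^+ n - (\sum_(j < m) coord g h j ^+ 2) ^+ n))).
  - by move=> m; exact: sqr_ge0.
  - move=> m; rewrite uE -lee_fin.
    have sm : is_sym_tensor g (hpow g (n := n) (hc g m (coord g h))).
      by apply: hpow_sym; exact: CM_hc.
    have E : (fun x => Psi (hpow g h) x - He_D n (coord_pair h m) x) =
             (fun x => Psi (hpow g h) x - Psi (hpow g (hc g m (coord g h))) x) %[ae P].
      by apply: filterS (Psi_hpow_hc PsiP (coord_pair h m)) => x hx _; rewrite -hx.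
    rewrite (N2_ae _ _ E); first last.
    + by apply: L2B => //; exact: (Psi_L2 PsiP).
    + by apply: L2B => //; rewrite -uE.
    rewrite (Psi_sub PsiP) //; last exact: hpow_sym.
    by rewrite EFinM lee_wpmul2l ?lee_fin ?ler0n //; exact: hpow_hc_dist.
  - rewrite [X in _ --> X](_ : 0 = n`!%:R * (hin h h ^+ n - hin h h ^+ n)); last by rewrite subrr mulr0.
    apply: cvgM; first exact: cvg_cst.
    apply: cvgB; first exact: cvg_cst.
    by apply: cvg_pow; exact: cvg_coord_sum.
have h2 : (fun m => N2 P (fun x => Psi (hpow g h) x - u m x) +
    N2 P (fun x => u m x - (He (hin h h) n).[Z x])) @ \oo --> (0 : R).
  by rewrite -[0]addr0; exact: cvgD h1 (mcvg_N2 hu).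
apply: N2_small_ae => // e e0.
have /cvgrPdist_lt /(_ e e0) [m _ /(_ m (leqnn m))] := h2.
rewrite sub0r normrN ger0_norm => [/ltW he|]; last by rewrite addr_ge0 // N2_ge0.
exact: le_trans (N2_tri Lh (Lu m) LZ) he.
Qed.

Definition hcomb (s : seq (R * cpair g)) : Defs.form X n :=
  fun v => \sum_(p <- s) p.1 * hpow g (hc g (sval p.2).1 (sval p.2).2) v.

Lemma hpow_hc_sym (p : cpair g) : is_sym_tensor g (hpow g (n := n) (hc g (sval p).1 (sval p).2)).
Proof. by apply: hpow_sym; exact: CM_hc. Qed.

Lemma hcomb_sym s : is_sym_tensor g (hcomb s).
Proof. by apply: is_sym_sum => p; exact: hpow_hc_sym. Qed.

Lemma Psi_hcomb s : (Psi (hcomb s) : borel X -> R) = (fun x => \sum_(p <- s) p.1 * He_D n p.2 x) %[ae P].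
Proof.
have h0 : {ae P, forall x : borel X, \sum_(p <- s) p.1 * Psi (hpow g (hc g (sval p.2).1 (sval p.2).2)) x = \sum_(p <- s) p.1 * He_D n p.2 x}.
  elim: s => [|p s IH]; first by apply: aeW => x; rewrite !big_nil.
  apply: filterS2 IH (Psi_hpow_hc PsiP p.2) => x h1 h2.
  by rewrite !big_cons h1 h2.
apply: filterS2 h0 (Psi_sum PsiP s (fun p => p.1) (fun p => hpow_hc_sym p.2)) => x h1 h2 _.
by rewrite h2.
Qed.

(** Through the isometry Psi, density of the He_n(W_h) in the chaos becomes density of tensor
    powers; the factor n! >= 1 only helps. *)
Lemma sym_approx F e : is_sym_tensor g F -> 0 < e -> exists s : seq (R * cpair g),
  (norm2_form g (fun v => -1 * hcomb s v + F v)%R <= e%:E)%E.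
Proof.
move=> sF e0; have /chaosP [LF /(_ (Num.sqrt e))] := Psi_chaos PsiP sF.
rewrite sqrtr_gt0 => /(_ e0) [v [s vE] hv]; exists s.
have ss := hcomb_sym s.
have Ls : L2 P (fun x => \sum_(p <- s) p.1 * He_D n p.2 x).
  by apply: (@Hspan_L2 _ _ _ _ n); exists s.
have E : (fun x => Psi F x - Psi (hcomb s) x) = (fun x => Psi F x - v x) %[ae P].
  by apply: filterS (Psi_hcomb s) => x h _; rewrite h // vE.
have hN : N2 P (fun x => Psi F x - Psi (hcomb s) x) ^+ 2 <= e.
  rewrite (N2_ae _ _ E); first last.
  - by apply: L2B => //; rewrite vE.
  - by apply: L2B => //; exact: (Psi_L2 PsiP).
  by rewrite -[leRHS](sqr_sqrtr (ltW e0)) lerXn2r ?nnegrE ?N2_ge0 ?sqrtr_ge0 // ltW.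
apply: (@le_trans _ _ (N2 P (fun x => Psi F x - Psi (hcomb s) x) ^+ 2)%:E); last by rewrite lee_fin.
rewrite (Psi_sub PsiP) // -[leLHS]mul1e lee_wpmul2r ?norm2_form_ge0 // lee_fin.
by rewrite -[1]/(1%:R) ler_nat fact_gt0.
Qed.

End wiener_iso_hpow.

(** * Bounded multilinear forms and basis vectors *)

Section basis_extension.
Context (R : realType) (X : completeNormedModType R) (ip : inner_product X) (g : gaussian ip) (n : nat).
Local Notation H := (CM g).
Local Notation hin := (hinner H).

Lemma hnorm_hc_sub h m : H h ->
  hnorm H (h - hc g m (coord g h)) ^+ 2 = hin h h - \sum_(j < m) coord g h j ^+ 2.
Proof.
move=> hh; set c := coord g h; have hm := CM_hc g m c.
have E1 : hin (hc g m c) h = \sum_(j < m) c j ^+ 2 by rewrite hinner_hc.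
have E2 : hin (hc g m c) (hc g m c) = \sum_(j < m) c j ^+ 2.
  rewrite hinner_hc; apply: eq_bigr => j _; rewrite coord_hc ltn_ord /= expr2.
  by case: ifP => // jI; rewrite /c coord_notin // mulr0.
rewrite sqr_hnorm hinnerBl // hinnerC hinnerBl // E1 (hinnerC g _ (h - _)) hinnerBl // (hinnerC g h) E1 E2.
by rewrite subrr subr0.
Qed.

Variable G : Defs.form X n.
Hypothesis Glin : multilinear_form g G.
Hypothesis Gbnd : exists C : R, forall v, cm_tuple g v -> `|G v| <= C * \prod_i hnorm H (v i).

Definition upd (v : 'I_n -> X) k x : 'I_n -> X := fun j => if j == k then x else v j.

Lemma upd_cm v k x : cm_tuple g v -> H x -> cm_tuple g (upd v k x).
Proof. by move=> hv hx j; rewrite /upd; case: ifP. Qed.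

Lemma upd_lin v k a x y : cm_tuple g v -> H x -> H y ->
  G (upd v k (a *: x + y)) = a * G (upd v k x) + G (upd v k y).
Proof.
move=> hv hx hy; apply: (Glin (k := k)); try exact: upd_cm.
  by rewrite /upd eqxx.
by move=> j /negbTE jk; rewrite /upd jk.
Qed.

Lemma upd0 v k : cm_tuple g v -> G (upd v k 0) = 0.
Proof.
move=> hv; have := upd_lin k 1 hv (CM0 g) (CM0 g).
by rewrite scaler0 addr0 mul1r; lra.
Qed.

(** In slot k the form is linear and bounded, and v k is the limit in H of its finite expansions, on
    which the form vanishes. *)
Lemma upd_eq0 v k : cm_tuple g v -> (forall j, gidx g j -> G (upd v k (cmvec g j)) = 0) -> G v = 0.
Proof.
move=> hv h0; set h := v k.
have vE : v = upd v k h by apply/funext => j; rewrite /upd; case: eqP => [->|].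
have [C hC] := Gbnd.
pose D := C * \prod_(j < n | j != k) hnorm H (v j).
have hD x : H x -> `|G (upd v k x)| <= D * hnorm H x.
  move=> hx; apply: le_trans (hC _ (upd_cm k hv hx)) _.
  have E : \prod_i hnorm H (upd v k x i) = hnorm H x * \prod_(j < n | j != k) hnorm H (v j).
    rewrite (bigD1 k) // {1}/upd eqxx; congr (_ * _).
    by apply: eq_bigr => j /negbTE jk; rewrite /upd jk.
  by rewrite E /D -mulrA (mulrC _ (hnorm H x)).
have hz m : G (upd v k (hc g m (coord g h))) = 0.
  rewrite /hc; elim: m => [|m IH]; first by rewrite big_ord0 upd0.
  rewrite big_ord_recr /= addrC upd_lin //; [|exact: CM_cmb|exact: CM_hc].
  rewrite IH addr0; case: (boolP (m \in gidx g)) => mI.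
    by rewrite cmb_cmvec // h0 ?mulr0 //; exact: set_mem.
  by rewrite cmb_notin ?upd0 ?mulr0 //; exact/negbTE.
have hm m : G v = G (upd v k (h - hc g m (coord g h))).
  rewrite addrC -scaleN1r upd_lin ?hz ?mulr0 ?add0r -?vE //; [exact: CM_hc|exact: hv].
have : G v ^+ 2 = 0; last by move=> /eqP; rewrite sqrf_eq0 => /eqP.
suff h2 : (fun _ : nat => G v ^+ 2) @ \oo --> (0 : R).
  rewrite -[RHS](cvg_lim (@norm_hausdorff _ _) h2); apply/esym/cvg_lim; first exact: norm_hausdorff.
  exact: cvg_cst.
apply: (@squeeze0 _ _ (fun m => D ^+ 2 * (hin h h - \sum_(j < m) coord g h j ^+ 2))).
- by move=> m; exact: sqr_ge0.
- move=> m; have hh : H h by exact: hv.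
  rewrite -hnorm_hc_sub // -exprMn (hm m) -[leLHS]real_normK ?num_real //.
  rewrite lerXn2r ?nnegrE //; first exact: le_trans (normr_ge0 _) (hD _ (CMB hh (CM_hc g m _))).
  by apply: hD; apply: CMB => //; exact: CM_hc.
rewrite [X in _ --> X](_ : 0 = D ^+ 2 * (hin h h - hin h h)); last by rewrite subrr mulr0.
apply: cvgM; first exact: cvg_cst.
apply: cvgB; first exact: cvg_cst.
by apply: cvg_coord_sum; exact: hv.
Qed.

Lemma basis_eq0 : (forall i : 'I_n -> nat, (forall k, gidx g (i k)) -> G (fun k => cmvec g (i k)) = 0) ->
  forall v, cm_tuple g v -> G v = 0.
Proof.
move=> hb.
(* Slots from m on already hold basis vectors; [upd_eq0] reduces a free slot m to that situation. *)
suff h m v : cm_tuple g v -> (forall k : 'I_n, (m <= k)%N -> exists2 j, gidx g j & v k = cmvec g j) -> G v = 0.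
  move=> v hv; apply: (h n) => // k; rewrite leqNgt ltn_ord //.
elim: m v => [|m IH] v hv hk.
  have /choice [i hi] : forall k : 'I_n, exists j, gidx g j /\ v k = cmvec g j.
    by move=> k; have [j] := hk k (leq0n k); exists j.
  rewrite (_ : v = fun k => cmvec g (i k)); last by apply/funext => k; case: (hi k).
  by apply: hb => k; case: (hi k).
have [mn|nm] := ltnP m n; last first.
  by apply: IH => // k mk; have := ltn_ord k; rewrite ltnNge (leq_trans nm mk).
apply: (@upd_eq0 v (Ordinal mn)) => // j jI.
apply: IH => [|k mk]; first by apply: upd_cm => //; exact: CM_cmvec.
rewrite /upd; case: eqP => [_|/eqP km]; first by exists j.
by apply: hk; rewrite ltn_neqAle mk andbT eq_sym.
Qed.

End basis_extension.

(** * Comparison of the two operators *)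

Section tensor_powers.
Context (R : realType) (X : completeNormedModType R) (ip : inner_product X).
Variables (mu nu : gaussian ip) (T : X -> X) (n : nat).
Variable Tn : Defs.form X n -> Defs.form X n.
Hypothesis TnP : is_tensor_power mu nu T Tn.
Implicit Types (F G : Defs.form X n).

Lemma Tn0 : form_eq nu (Tn (fun=> 0)) (fun=> 0).
Proof.
move=> v hv; case: TnP => _ /(_ 1 _ _ (is_tensor0 mu n) (is_tensor0 mu n) v hv) + _ _.
rewrite (_ : (fun _ : 'I_n -> X => 1 * 0 + 0) = (fun=> 0)); last by apply/funext => w; rewrite mul1r addr0.
by rewrite mul1r; lra.
Qed.

Lemma Tn_sum I (s : seq I) (a : I -> R) (F : I -> Defs.form X n) : (forall i, is_tensor mu (F i)) ->
  form_eq nu (Tn (fun v => \sum_(i <- s) a i * F i v)) (fun v => \sum_(i <- s) a i * Tn (F i) v).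
Proof.
move=> hF v hv; elim: s => [|i s IH].
  rewrite (_ : (fun w => _) = (fun=> 0)); last by apply/funext => w; rewrite big_nil.
  by rewrite Tn0 // big_nil.
rewrite (_ : (fun w => _) = fun w => a i * F i w + \sum_(j <- s) a j * F j w); last first.
  by apply/funext => w; rewrite big_cons.
case: TnP => _ /(_ (a i) _ _ (hF i) (is_tensor_sum s a hF) v hv) -> _ _.
by rewrite IH big_cons.
Qed.

Definition Thcomb (s : seq (R * cpair mu)) : Defs.form X n :=
  fun v => \sum_(p <- s) p.1 * hpow nu (T (hc mu (sval p.2).1 (sval p.2).2)) v.

Lemma Tn_hcomb s : form_eq nu (Tn (hcomb s)) (Thcomb s).
Proof.
move=> v hv; rewrite (Tn_sum s (fun p => p.1)) //; last first.
  by move=> p; case: (hpow_hc_sym n p.2).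
apply: eq_bigr => p _; congr (_ * _); case: TnP => _ _ _ /(_ _ _ v hv); apply => k.
exact: CM_hc.
Qed.

Lemma norm2_form_eq F G : form_eq nu F G -> norm2_form nu F = norm2_form nu G.
Proof.
move=> FG; rewrite /norm2_form; apply: eq_esum => i iI; rewrite FG // => k.
by apply: CM_cmvec; exact: iI.
Qed.

Lemma Tn_norm2 : exists2 C : R, 0 <= C & forall F, is_tensor mu F ->
  (norm2_form nu (Tn F) <= C%:E * norm2_form mu F)%E.
Proof.
case: TnP => hT _ [C hC] _; exists (C ^+ 2) => [|F tF]; first exact: sqr_ge0.
have := hC F tF; have := norm2_form_lty (hT F tF); have := norm2_form_lty tF.
have := norm2_form_ge0 nu (Tn F); have := norm2_form_ge0 mu F.
rewrite /tensor_norm -!/(norm2_form _ _).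
case: (norm2_form mu F) => [a| |] //; case: (norm2_form nu (Tn F)) => [b| |] //=.
rewrite !lee_fin => a0 b0 _ _ h.
rewrite -[leLHS](sqr_sqrtr b0) -[in leRHS](sqr_sqrtr a0) -exprMn lerXn2r ?nnegrE ?sqrtr_ge0 //.
exact: le_trans (sqrtr_ge0 _) h.
Qed.

Hypothesis T_bounded : bounded_op (CM mu) (CM nu) T.

Lemma Thcomb_sym s : is_sym_tensor nu (Thcomb s).
Proof.
apply: is_sym_sum => p; apply: hpow_sym; case: T_bounded => h _ _; apply: h; exact: CM_hc.
Qed.

Lemma Tn_approx C F e s : (forall F, is_tensor mu F -> (norm2_form nu (Tn F) <= C%:E * norm2_form mu F)%E) ->
  0 <= C -> is_tensor mu F -> (norm2_form mu (fun v => -1 * hcomb s v + F v)%R <= e%:E)%E ->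
  (norm2_form nu (fun v => -1 * Thcomb s v + Tn F v)%R <= (C * e)%:E)%E.
Proof.
move=> hC C0 tF he; have [ts _] := hcomb_sym n s.
rewrite (@norm2_form_eq _ (Tn (fun v => -1 * hcomb s v + F v))); last first.
  move=> v hv; case: TnP => _ /(_ (-1) _ _ ts tF v hv) -> _ _.
  by rewrite Tn_hcomb.
apply: le_trans (hC _ (is_tensor_lin (-1) ts tF)) _.
by rewrite EFinM lee_wpmul2l // lee_fin.
Qed.

Variable Psimu : Defs.form X n -> X -> R.
Hypothesis PsimuP : is_wiener_iso mu Psimu.

(** Combinations of tensor powers of h are sent to combinations of tensor powers of T h, which are
    symmetric, and they approximate F. Boundedness transfers the approximation to the coefficients
    of [Tn F], and a bounded form is determined by its coefficients. *)
Lemma Tn_sym F : is_sym_tensor mu F -> is_sym_tensor nu (Tn F).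
Proof.
move=> sF; have [tF _] := sF; have [tTF _ _ _] := TnP; have tT := tTF F tF.
split=> // p v hv; have [mT [B bT] _] := tT.
apply/eqP; rewrite -subr_eq0; apply/eqP.
pose G : Defs.form X n := fun v => Tn F (fun k => v (p k)) - Tn F v.
rewrite -[LHS]/(G v).
apply: (@basis_eq0 _ _ _ nu n G) hv => {v}.
- move=> k a v v1 v2 h1 h2 hk hj; rewrite /G (mT k a v v1 v2) //.
  rewrite (mT ((p^-1)%g k) a (fun k => v (p k)) (fun k => v1 (p k)) (fun k => v2 (p k))).
  + by ring.
  + by move=> j; exact: h1.
  + by move=> j; exact: h2.
  + by rewrite permKV.
  + by move=> j jk; apply: hj; apply: contra jk => /eqP <-; rewrite permK.
- exists (B + B) => v hv; rewrite /G; apply: le_trans (ler_normB _ _) _; rewrite mulrDl lerD ?bT //.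
  apply: le_trans (bT _ (fun k => hv (p k))) _.
  by rewrite [in leRHS](reindex_inj (@perm_inj _ p)).
move=> i iI; have [C C0 hC] := Tn_norm2.
apply/eqP; rewrite -sqrf_eq0 eq_le sqr_ge0 andbT; apply/ler_addgt0Pr => e e0; rewrite add0r.
(* The value of G is a difference x - y with x^2, y^2 <= C e', so its square is at most 4 C e' <= e;
   C + 1 avoids a division by 0. *)
pose e' := e / (4 * (C + 1)).
have C1 : 0 < C + 1 by rewrite ltr_pwDr.
have e'0 : 0 < e' by rewrite divr_gt0 // mulr_gt0.
have [s hs] := sym_approx PsimuP sF e'0.
have hD := Tn_approx hC C0 tF hs.
pose D : Defs.form X n := fun v => -1 * Thcomb s v + Tn F v.
have D1 : D (fun k => cmvec nu (i k)) ^+ 2 <= C * e'.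
  by rewrite -lee_fin; apply: le_trans (eval_le D iI) hD.
have D2 : D (fun k => cmvec nu (i (p k))) ^+ 2 <= C * e'.
  by rewrite -lee_fin; apply: le_trans (eval_le D (fun k => iI (p k))) hD.
have hS : Thcomb s (fun k => cmvec nu (i (p k))) = Thcomb s (fun k => cmvec nu (i k)).
  have [_ ss] := Thcomb_sym s; apply: (ss p (fun k => cmvec nu (i k))) => k.
  by apply: CM_cmvec; exact: iI.
have -> : G (fun k => cmvec nu (i k)) = D (fun k => cmvec nu (i (p k))) - D (fun k => cmvec nu (i k)).
  by rewrite /G /D hS; ring.
have Ce : 4 * (C * e') <= e.
  rewrite /e' [leLHS](_ : _ = e * (C / (C + 1))); last by field; rewrite gt_eqF.
  by rewrite ler_piMr ?(ltW e0) // ler_pdivrMr // mul1r lerDl.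
set x := D _ in D1 *; set y := D _ in D2 *.
have := sqr_ge0 (x + y); rewrite sqrrD sqrrB; lra.
Qed.

Variable Psinu : Defs.form X n -> X -> R.
Hypothesis PsinuP : is_wiener_iso nu Psinu.
Variable Gam : (X -> R) -> X -> R.
Hypothesis Gam_L2 : forall f, L2 (glaw mu) f -> L2 (glaw nu) (Gam f).
Hypothesis Gam_lin : forall a f h, L2 (glaw mu) f -> L2 (glaw mu) h ->
    (Gam (fun x => a * f x + h x) : borel X -> R)
      = (fun x => a * Gam f x + Gam h x) %[ae glaw nu].
Hypothesis Gam_bnd : exists C : R, forall f, L2 (glaw mu) f ->
    N2 (glaw nu) (Gam f) <= C * N2 (glaw mu) f.
Hypothesis Gam_He : forall p : cpair mu, (Gam (He_D n p) : borel X -> R) =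
   Psinu (hpow nu (T (hc mu (sval p).1 (sval p).2))) %[ae glaw nu].

Lemma Gam_sub C f h : (forall f, L2 (glaw mu) f -> N2 (glaw nu) (Gam f) <= C * N2 (glaw mu) f) ->
  L2 (glaw mu) f -> L2 (glaw mu) h ->
  N2 (glaw nu) (fun x => Gam f x - Gam h x) <= C * N2 (glaw mu) (fun x => f x - h x).
Proof.
move=> hC Lf Lh; have L1 : L2 (glaw mu) (fun x => -1 * h x + f x) by apply: L2D => //; exact: L2Z.
have := hC _ L1.
have -> : (fun x => f x - h x) = (fun x => -1 * h x + f x) by apply/funext => x; rewrite mulN1r addrC.
congr (_ <= _); apply: N2_ae; [exact: Gam_L2|by apply: L2B; exact: Gam_L2|].
by apply: filterS (Gam_lin (-1) Lh Lf) => x hx _; rewrite hx // mulN1r addrC.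
Qed.

(** [Gam] acts on functions rather than on classes; boundedness makes it respect almost everywhere
    equality. *)
Lemma Gam_ext f h : L2 (glaw mu) f -> L2 (glaw mu) h -> f = h %[ae glaw mu] ->
  (Gam f : borel X -> R) = Gam h %[ae glaw nu].
Proof.
move=> Lf Lh fh; have [C hC] := Gam_bnd.
apply: N2_sub_eq0; try exact: Gam_L2.
apply/eqP; rewrite eq_le N2_ge0 andbT.
by apply: le_trans (Gam_sub hC Lf Lh) _; rewrite (ae_N2_sub Lf Lh fh) mulr0.
Qed.

Lemma Gam0 : (Gam (fun=> 0) : borel X -> R) = (fun=> 0) %[ae glaw nu].
Proof.
have L0 := L2_cst (glaw mu) (0 : R); have [C hC] := Gam_bnd.
apply: N2_eq0; first exact: Gam_L2.
by apply/eqP; rewrite eq_le N2_ge0 andbT; apply: le_trans (hC _ L0) _; rewrite N2_cst normr0 mulr0.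
Qed.

Lemma Gam_sum I (s : seq I) (a : I -> R) (F : I -> X -> R) : (forall i, L2 (glaw mu) (F i)) ->
  (Gam (fun x => \sum_(i <- s) a i * F i x) : borel X -> R) =
  (fun x => \sum_(i <- s) a i * Gam (F i) x) %[ae glaw nu].
Proof.
move=> hF; elim: s => [|i s IH].
  rewrite (_ : (fun v => _) = (fun=> 0)); last by apply/funext => v; rewrite big_nil.
  by apply: filterS Gam0 => x h _; rewrite h // big_nil.
rewrite (_ : (fun v => _) = fun v => a i * F i v + \sum_(j <- s) a j * F j v); last first.
  by apply/funext => v; rewrite big_cons.
have Ls : L2 (glaw mu) (fun x => \sum_(j <- s) a j * F j x) by apply: L2_sum => j _; exact: L2Z.
by apply: filterS2 (Gam_lin (a i) (hF i) Ls) IH => x h1 h2 _; rewrite h1 // h2 // big_cons.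
Qed.

(** Both sides are continuous in F and agree, by [Gam_He], on combinations of tensor powers, which
    are dense. *)
Lemma tensor_power_Gam F : is_sym_tensor mu F ->
  (Psinu (Tn F) : borel X -> R) = Gam (Psimu F) %[ae glaw nu].
Proof.
move=> sF; have sT := Tn_sym sF; have [tF _] := sF.
have [C C0 hC] := Tn_norm2; have [K hK] := Gam_bnd.
have LT := Psi_L2 PsinuP sT; have LF := Psi_L2 PsimuP sF.
apply: N2_small_ae => [||e e0]; [exact: LT|exact: Gam_L2|].
(* With u = e / (2 B) the errors are (C + 1) u on the side of Psinu and |K| u on the side of [Gam],
   together B u = e / 2. The sign of K is unknown, hence its absolute value. *)
pose B := `|K| + C + 1.
have B0 : 0 < B by have := normr_ge0 K; rewrite /B; lra.
(* Dividing by n! compensates the factor in the isometry. *)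
pose d := (e / (2 * B)) ^+ 2 / n`!%:R.
have nf : 0 < n`!%:R :> R by rewrite ltr0n fact_gt0.
have d0 : 0 < d by rewrite divr_gt0 // exprn_gt0 // divr_gt0 // mulr_gt0.
have [s hs] := sym_approx PsimuP sF d0.
have ss := hcomb_sym n s; have sS := Thcomb_sym s.
have hD := Tn_approx hC C0 tF hs.
have LS := Psi_L2 PsinuP sS; have Ls := Psi_L2 PsimuP ss.
have eB : 0 < e / (2 * B) by rewrite divr_gt0 // mulr_gt0.
have h1 : N2 (glaw mu) (fun x => Psimu F x - Psimu (hcomb s) x) <= e / (2 * B).
  rewrite -(@ler_pXn2r _ 2) // ?nnegrE ?N2_ge0 ?(ltW eB) // -lee_fin (Psi_sub PsimuP) //.
  apply: le_trans (lee_wpmul2l _ hs) _; first by rewrite lee_fin ltW.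
  by rewrite -EFinM lee_fin /d mulrC divfK ?gt_eqF.
(* C bounds squared norms; C <= (C + 1)^2 spares a square root. *)
have h2 : N2 (glaw nu) (fun x => Psinu (Tn F) x - Psinu (Thcomb s) x) <= (C + 1) * (e / (2 * B)).
  rewrite -(@ler_pXn2r _ 2) // ?nnegrE ?N2_ge0 ?(mulr_ge0 (addr_ge0 C0 ler01) (ltW eB)) // -lee_fin (Psi_sub PsinuP) //.
  apply: le_trans (lee_wpmul2l _ hD) _; first by rewrite lee_fin ltW.
  rewrite -EFinM lee_fin /d mulrCA [X in C * X]mulrC divfK ?gt_eqF // [leRHS]exprMn ler_wpM2r ?sqr_ge0 //.
  by rewrite sqrrD expr1n mulr1; nra.
have h3 : N2 (glaw nu) (fun x => Gam (Psimu (hcomb s)) x - Gam (Psimu F) x) <= `|K| * (e / (2 * B)).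
  rewrite N2BC; apply: le_trans (Gam_sub hK LF Ls) _.
  apply: (@le_trans _ _ (`|K| * N2 (glaw mu) (fun x => Psimu F x - Psimu (hcomb s) x))).
    by rewrite ler_wpM2r ?N2_ge0 ?ler_norm.
  by rewrite ler_wpM2l.
have E : (Psinu (Thcomb s) : borel X -> R) = Gam (Psimu (hcomb s)) %[ae glaw nu].
  have Lc : L2 (glaw mu) (fun x => \sum_(p <- s) p.1 * He_D n p.2 x).
    by apply: L2_sum => p _; apply: L2Z; exact: He_D_L2.
  have g1 := Gam_ext Ls Lc (Psi_hcomb PsimuP s).
  have g2 := Gam_sum s (fun p => p.1) (fun p => He_D_L2 n p.2).
  have hT (p : R * cpair mu) : is_sym_tensor nu (hpow nu (n := n) (T (hc mu (sval p.2).1 (sval p.2).2))).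
    by apply: hpow_sym; case: T_bounded => h _ _; apply: h; exact: CM_hc.
  have g3 := Psi_sum PsinuP s (fun p => p.1) hT.
  have g4 : {ae glaw nu, forall x : borel X, \sum_(p <- s) p.1 * Psinu (hpow nu (T (hc mu (sval p.2).1 (sval p.2).2))) x =
      \sum_(p <- s) p.1 * Gam (He_D n p.2) x}.
    elim: (s) => [|p t IH]; first by apply: aeW => x; rewrite !big_nil.
    by apply: filterS2 IH (Gam_He p.2) => x k1 k2; rewrite !big_cons k1 k2.
  apply: filterS2 (filterI g1 g2) (filterI g3 g4) => x [k1 k2] [k3 k4] _.
  by rewrite k1 // k2 // k3.
have h0 : N2 (glaw nu) (fun x => Psinu (Thcomb s) x - Gam (Psimu (hcomb s)) x) = 0.
  by apply: ae_N2_sub E; [exact: LS|exact: Gam_L2].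
have k1 := N2_tri LT LS (Gam_L2 LF).
have k2 := N2_tri LS (Gam_L2 Ls) (Gam_L2 LF).
have -> : e = (2 * B) * (e / (2 * B)) by field; rewrite gt_eqF.
have K0 := normr_ge0 K.
move: (h2) (h3) k1 k2 h0 eB; rewrite /B.
set u := e / _; move=> ? ? ? ? ? ?; nra.
Qed.

End tensor_powers.

(* Unlike [ge0_le_integral], no measurability: the norm |T pi_m x - L x| need
   not be known to be measurable. *)
Lemma ge0_integral_mono d (T : measurableType d) (R : realType) (P : {measure set T -> \bar R})
  (f g : T -> \bar R) : (forall x, (0 <= f x)%E) -> (forall x, (f x <= g x)%E) ->
  (\int[P]_x f x <= \int[P]_x g x)%E.
Proof.
move=> f0 fg; have g0 x : (0 <= g x)%E by exact: le_trans (f0 x) (fg x).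
rewrite !ge0_integralTE //; apply: ge_ereal_sup => _ [h hf <-].
by apply: ereal_sup_ubound; exists h => // x; exact: le_trans (hf x) (fg x).
Qed.

(** * Measurable extensions and the integral operator *)

Section extensions.
Context (R : realType) (X : completeNormedModType R) (ip : inner_product X) (g : gaussian ip).
Local Notation P := (glaw g).
Local Notation pi := (proj_span ip (gidx g) (gvec g)).

(** By Cauchy-Schwarz the scalar error is at most |z| |A pi_m x - L x|, so the vector-valued L^2
    limit gives the limit of the functionals. *)
Lemma ext_infty_lim (A L : X -> X) (z : X) (w : nat -> X) : is_ext_infty g A L ->
  (forall m x, ip (A (pi m x)) z = ip x (w m)) ->
  L2 P (fun x : borel X => ip (L x) z) /\
  N2 P (fun x : borel X => ip x (w m) - ip (L x) z) @[m --> \oo] --> 0.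
Proof.
move=> [mL _ hL] hw.
pose D m : borel X -> R := fun x => ip x (w m) - ip (L x) z.
have mLz : measurable_fun [set: borel X] (fun x : borel X => ip (L x) z).
  exact: (measurableT_comp (@measurable_inner _ _ ip z) mL).
have mD m : measurable_fun setT (D m) by apply: measurable_funB => //; exact: measurable_inner.
pose I m := (\int[P]_x (`|A (pi m x) - L x| ^+ 2)%R%:E)%E.
have I0 m : (0 <= I m)%E by apply: integral_ge0 => x _; rewrite lee_fin sqr_ge0.
have DI m : (\int[P]_x (D m x ^+ 2)%:E <= (`|z| ^+ 2)%:E * I m)%E.
  have [z0|z0] := eqVneq z 0.
    rewrite integral0_eq; first by rewrite z0 normr0 expr0n mul0e.
    by move=> x _; rewrite /D -hw z0 !inner0r subrr expr0n.
  have z2 : 0 < `|z| ^+ 2 by rewrite exprn_gt0 // normr_gt0.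
  (* The constant is taken out of the integral of [D m], which is measurable; this needs a division
     by |z|^2. *)
  rewrite (_ : (fun x => _) = fun x : borel X => ((`|z| ^+ 2)%:E * (D m x ^+ 2 / `|z| ^+ 2)%:E)%E); last first.
    by apply/funext => x; rewrite -EFinM mulrC divfK // gt_eqF.
  rewrite ge0_integralZl //; last 2 first.
  - by apply/measurable_EFinP; apply: measurable_funM => //; exact: measurable_funX.
  - by move=> x _; rewrite lee_fin divr_ge0 ?sqr_ge0.
  apply: lee_wpmul2l; first by rewrite lee_fin ltW.
  apply: ge0_integral_mono => x; first by rewrite lee_fin divr_ge0 ?sqr_ge0.
  rewrite lee_fin ler_pdivrMr // /D -hw -innerBl -exprMn.
  rewrite -[leLHS]real_normK ?num_real // lerXn2r ?nnegrE ?normr_ge0 ?mulr_ge0 //.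
  exact: inner_le.
have zI : ((`|z| ^+ 2)%:E * I m)%E @[m --> \oo] --> 0%E.
  by rewrite -[X in _ --> X](mule0 (`|z| ^+ 2)%:E); apply: cvgeZl.
have fin_D m : (I m < +oo)%E -> L2 P (D m).
  move=> Im; split => //; apply/integrableP; split.
    by apply/measurable_EFinP; exact: measurable_funX.
  rewrite (eq_integral (fun x => (D m x ^+ 2)%:E)); last first.
    by move=> x _; rewrite /= ger0_norm // sqr_ge0.
  apply: le_lt_trans (DI m) _; rewrite lte_mul_pinfty //.
have Iw m : L2 P (fun x : borel X => ip x (w m)) by apply: tame_L2; exact: tame_inner.
(* Integrals tending to 0 are eventually finite, and one finite value already puts the limit in
   L^2. *)
have Ifin : \forall m \near \oo, (I m < +oo)%E.
  have := cvg_is_fine hL; apply: filterS => m; by rewrite fin_numElt => /andP[].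
have LLz : L2 P (fun x : borel X => ip (L x) z).
  case: Ifin => m _ /(_ m (leqnn m)) /fin_D LD.
  rewrite (_ : (fun x => _) = fun x : borel X => ip x (w m) - D m x); first exact: L2B.
  by apply/funext => x; rewrite /D subKr.
split=> //; apply: sqr_cvg0 => [m|]; first exact: N2_ge0.
rewrite (_ : (fun m => _) = fine \o (fun m => \int[P]_x (D m x ^+ 2)%:E)%E); last first.
  by apply/funext => m /=; rewrite -dotxxP ?sqr_N2 //; apply: L2B.
apply: fine_cvg.
apply: (@squeeze_cvge _ _ _ _ (fun=> 0%E) _ (fun m => (`|z| ^+ 2)%:E * I m)%E) => //; last exact: cvg_cst.
by apply: nearW => m; rewrite DI andbT; apply: integral_ge0 => x _; rewrite lee_fin sqr_ge0.
Qed.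

Lemma horner_exp_bound (p : {poly R}) : exists M K : R,
  [/\ 0 < M, 0 < K & forall t, `|p.[t]| <= M * expR (K * `|t|)].
Proof.
elim/poly_ind: p => [|p c [M [K [M0 K0 hp]]]].
  by exists 1, 1; split=> // t; rewrite horner0 normr0 mul1r expR_ge0.
exists (M + `|c|), (K + 1); split; [by rewrite ltr_pwDl|by rewrite addr_gt0|move=> t].
rewrite hornerMXaddC; apply: le_trans (ler_normD _ _) _; rewrite mulrDl; apply: lerD.
  rewrite normrM mulrDl mul1r expRD mulrA ler_pM //.
  by apply: le_trans (expR_ge1Dx _); rewrite lerDr.
by rewrite ler_peMr // -expR0 ler_expR mulr_ge0 // addr_ge0 // ltW.
Qed.

(** Gives access to the integral formula, which is assumed for exponentially bounded functions. *)
Lemma exp_bounded_He n (z : X) : exp_bounded (He_at g n z).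
Proof.
split; first by apply: tame_measurable; exact: tame_He_at.
have [M [K [M0 K0 hp]]] := horner_exp_bound (He (cov g z z) n).
exists M, (K * (`|z| + 1)); split=> //; first by rewrite mulr_gt0 // ltr_pwDr.
move=> x; apply: le_trans (hp _) _; rewrite ler_pM2l // ler_expR -mulrA ler_pM2l //.
apply: le_trans (inner_le _ _ _) _; rewrite mulrDl mul1r mulrC lerDl //.
Qed.

End extensions.

Section Gamma_hermite.
Context (R : realType) (X : completeNormedModType R) (ip : inner_product X).
Variables (mu nu : gaussian ip) (T : X -> X).
Hypothesis T_bounded : bounded_op (CM mu) (CM nu) T.
Variable D : integral_data mu nu T.

Lemma Gamma_He n (p : cpair mu) (Psinu : Defs.form X n -> X -> R) : is_wiener_iso nu Psinu ->
  (Gamma D (He_D n p) : borel X -> R) =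
   Psinu (hpow nu (T (hc mu (sval p).1 (sval p).2))) %[ae glaw nu].
Proof.
move=> PsiP; case: p => -[r c] /= hcs; set h := hc mu r c; pose z := zc mu r c.
have hh : CM mu h by exact: CM_hc.
have [hT _ _] := T_bounded; have hTh := hT _ hh.
have [[hTs _ _] Tadj] := TstarP D.
have [[[hTd _ _] Tdsa _] Tdsq] := TdefectP D.
(* Taking adjoints turns the functionals under the limit into the finite approximations of W_(Th),
   and next of W_(Dh) for the defect operator. *)
have wS m x : ip (Tstar D (proj_span ip (gidx nu) (gvec nu) m x)) z = ip x (zc nu m (coord nu (T h))).
  rewrite [LHS]inner_zc_CM; last by apply: hTs; exact: CM_pi.
  rewrite -/h hinnerC -(Tadj h) //; last exact: CM_pi.
  by rewrite hinnerC hinner_pi.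
have wD m x : ip (Tdefect D (proj_span ip (gidx mu) (gvec mu) m x)) z = ip x (zc mu m (coord mu (Tdefect D h))).
  rewrite [LHS]inner_zc_CM; last by apply: hTd; exact: CM_pi.
  by rewrite Tdsa ?hinner_pi //; exact: CM_pi.
have [LS cS] := ext_infty_lim (Tstar_inftyP D) wS.
have [LD cD] := ext_infty_lim (Tdefect_inftyP D) wD.
have mS := gauss_mcvg_lim (csupp_coord (T h)) (cvg_coord_sum hTh) LS cS.
have mD := gauss_mcvg_lim (csupp_coord (Tdefect D h)) (cvg_coord_sum (hTd _ hh)) LD cD.
(* The squared defect is the identity minus T^* T, so |Dh|^2 = |h|^2 - |Th|^2. *)
have E : cov mu z z - hinner (CM mu) (Tdefect D h) (Tdefect D h) = hinner (CM nu) (T h) (T h).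
  have hhE : hinner (CM mu) h h = \sum_(k < r) c k ^+ 2.
    rewrite hinner_hc; apply: eq_bigr => k _; rewrite coord_hc ltn_ord /= expr2.
    by case: ifP => // kI; rewrite hcs // mulr0.
  rewrite -Tdsa ?Tdsq //; last exact: hTd.
  rewrite hinnerBl //; last exact: hTs (hTh).
  by rewrite (hinnerC _ (Tstar D _)) -(Tadj h) // cov_zc // hhE subKr.
have := Psi_hpow PsiP hTh mS; have := Gamma_integral D (exp_bounded_He mu n z).
apply: filterS2 => x h1 h2 _; rewrite h2 // h1 // -E.
rewrite -(mean_He_lim _ _ _ (csupp_coord (Tdefect D h)) (cvg_coord_sum (hTd _ hh)) mD).
congr Rintegral; apply/funext => y; rewrite /He_at innerDl //.
Qed.

End Gamma_hermite.

Section assembly.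
Context (R : realType) (X : completeNormedModType R) (ip : inner_product X).

(** He_0 = 1, so f is a limit of constants; the mean of f is as close to each of them as f is, hence
    is the constant. *)
Lemma chaos0_cst (g : gaussian ip) f : chaos g 0 f -> exists c : R, (f : borel X -> R) = cst c %[ae glaw g].
Proof.
move=> /chaosP [Lf hf]; exists (dot (glaw g) f (fun=> 1)).
have L1 c : L2 (glaw g) (fun=> c) by exact: L2_cst.
apply: N2_small_ae => [||e e0]; [exact: Lf|exact: L1|].
have [v [s vE]] := hf (e / 2) (divr_gt0 e0 (ltr0n _ 2)).
have {vE}-> : v = fun=> \sum_(p <- s) p.1.
  by rewrite vE; apply/funext => x; apply: eq_bigr => p _; rewrite /He_D /He_at /= hornerC mulr1.
set c := \sum_(p <- s) _ => hc.
apply: le_trans (N2_tri Lf (L1 c) (L1 _)) _; rewrite [leRHS]splitr lerD ?(ltW hc) //.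
rewrite N2_cst; apply: le_trans (ltW hc).
have -> : c - dot (glaw g) f (fun=> 1) = dot (glaw g) (fun x => c - f x) (fun=> 1).
  rewrite dotBl //; congr (_ - _); rewrite /dot.
  rewrite (_ : (fun x => _) = cst (c * 1)) // Rintegral_cst //.
  by rewrite (_ : fine (glaw g setT) = 1) ?probability_setT // !mulr1.
apply: le_trans (dot_le (L2B (L1 c) Lf) (L1 1)) _.
by rewrite N2_cst normr1 mulr1 N2BC.
Qed.

Variables (mu nu : gaussian ip) (T : X -> X).
Hypothesis T_bounded : bounded_op (CM mu) (CM nu) T.
Variables (d : series_data mu nu T) (D : integral_data mu nu T).

Lemma GammaL2 f : L2 (glaw mu) f -> L2 (glaw nu) (Gamma D f).
Proof. by move=> /L2P Lf; apply/L2P; exact: Gamma_l2. Qed.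

Lemma Gamma_lin2 a f h : L2 (glaw mu) f -> L2 (glaw mu) h ->
  (Gamma D (fun x => a * f x + h x) : borel X -> R)
    = (fun x => a * Gamma D f x + Gamma D h x) %[ae glaw nu].
Proof. by move=> /L2P Lf /L2P Lh; exact: Gamma_linear. Qed.

Lemma Gamma_bnd : exists C : R, forall f, L2 (glaw mu) f ->
    N2 (glaw nu) (Gamma D f) <= C * N2 (glaw mu) f.
Proof.
have [C hC] := Gamma_bounded D; exists C => f Lf.
by rewrite -lee_fin EFinM -!l2normE //; [apply: hC; exact/L2P|exact: GammaL2].
Qed.

(** In degree 0 the integral formula evaluates [Gamma] on a constant; in positive degree
    [tensor_power_Gam] applies to the tensor of f. *)
Lemma Gamma_tilde_chaos n f : chaos mu n f ->
  L2 (glaw nu) (Gamma_tilde_n d n f) /\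
  (Gamma_tilde_n d n f : borel X -> R) = Gamma D f %[ae glaw nu].
Proof.
move=> cf; have Lf := chaos_L2 cf.
case: n cf => [|n] cf.
  rewrite /Gamma_tilde_n; set c := xget _ _.
  have fc : (f : borel X -> R) = cst c %[ae glaw mu].
    by have := xgetPex 0 (chaos0_cst cf); rewrite -/c.
  split; first exact: L2_cst.
  have Lc := L2_cst (glaw mu) c.
  have h1 := Gam_ext GammaL2 Gamma_lin2 Gamma_bnd Lf Lc fc.
  have /(Gamma_integral D) h2 : exp_bounded (cst c : X -> R).
    split; first exact: measurable_cst.
    exists (`|c| + 1), 1; split=> //.
    move=> x /=; rewrite mul1r; apply: (@le_trans _ _ (`|c| + 1)); first by rewrite lerDl.
    by rewrite ler_peMr // -?expR0 ?ler_expR // addr_ge0.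
  apply: filterS2 h1 h2 => x h1 h2 _; rewrite h1 // h2 //.
  by rewrite Rintegral_cst // (_ : fine (glaw mu setT) = 1) ?probability_setT // mulr1.
have n0 : (0 < n.+1)%N by [].
rewrite /Gamma_tilde_n; set F := wiener_mu_inv _ _.
have [_ _ _ /(_ f cf) hF _] := wiener_muP d n0.
(* Surjectivity of Psi_n provides a preimage, so [xget] does not return its default. *)
have [sF FE] : is_sym_tensor mu F /\ (wiener_mu d F : borel X -> R) = f %[ae glaw mu].
  by have := xgetPex (fun=> 0) hF.
have TnP := tensor_powerP d n0; have muP := wiener_muP d n0; have nuP := wiener_nuP d n0.
split; first by apply: (Psi_L2 nuP); exact: (Tn_sym TnP T_bounded muP).
have h1 := tensor_power_Gam TnP T_bounded muP nuP GammaL2 Gamma_lin2 Gamma_bnd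
  (fun p => Gamma_He T_bounded D p nuP) sF.
have h2 := Gam_ext GammaL2 Gamma_lin2 Gamma_bnd (Psi_L2 muP sF) Lf FE.
by apply: filterS2 h1 h2 => x h1 h2 _; rewrite h1 // h2.
Qed.

End assembly.

Theorem proposition4p11 (R : realType) (X : completeNormedModType R)
    (ip : inner_product X) (sepX : separable_space X) (mu nu : gaussian ip)
    (T : X -> X) (T_bounded : bounded_op (CM mu) (CM nu) T)
    (T_contraction : opnorm (CM mu) (CM nu) T <= 1)
    (d : series_data mu nu T) (m : integral_data mu nu T) :
  forall f : X -> R, l2 (glaw mu) f -> is_Gamma_tilde d f (Gamma m f).
Proof.
move=> f lf; split; first exact: Gamma_l2.
have Lf : L2 (glaw mu) f by exact/L2P.
pose u n := chaos_proj d n f.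
have hu n : is_chaos_proj mu n f (u n) by exact: chaos_projP.
have cu n : chaos mu n (u n) by case: (hu n).
have Lu n : L2 (glaw mu) (u n) by exact: chaos_L2 (cu n).
have LG n : L2 (glaw nu) (Gamma_tilde_n d n (u n)) by case: (Gamma_tilde_chaos T_bounded d m (cu n)).
have LS N : L2 (glaw mu) (fun x => \sum_(n < N) u n x) by apply: L2_sum.
have [C hC] := Gamma_bnd m.
(* The partial sums of the series are almost everywhere [Gamma] of the partial sums of the chaos
   expansion, so the single constant C serves all degrees at once. *)
have hS N : N2 (glaw nu) (fun x => \sum_(n < N) Gamma_tilde_n d n (u n) x - Gamma m f x) <=
    C * N2 (glaw mu) (fun x => \sum_(n < N) u n x - f x).
  apply: le_trans (Gam_sub (@GammaL2 _ _ _ _ _ _ m) (@Gamma_lin2 _ _ _ _ _ _ m) hC (LS N) Lf).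
  rewrite le_eqVlt; apply/orP; left; apply/eqP; apply: N2_ae.
  - by apply: L2B; [apply: L2_sum|exact: GammaL2].
  - by apply: L2B; exact: GammaL2.
  have h : {ae glaw nu, forall x : borel X, Gamma m (fun x => \sum_(n < N) u n x) x = \sum_(n < N) Gamma_tilde_n d n (u n) x}.
    elim: N => [|N IH].
      rewrite (_ : (fun x => _) = fun=> 0); last by apply/funext => x; rewrite big_ord0.
      apply: filterS (Gam0 (@GammaL2 _ _ _ _ _ _ m) (Gamma_bnd m)) => x h.
      by rewrite h // big_ord0.
    have [_ h1] := Gamma_tilde_chaos T_bounded d m (cu N).
    have h2 := Gamma_lin2 m 1 (Lu N) (LS N).
    rewrite (_ : (fun x => _) = fun x => 1 * u N x + \sum_(n < N) u n x); last first.
      by apply/funext => x; rewrite big_ord_recr /= mul1r addrC.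
    apply: filterS2 IH (filterI h1 h2) => x k1 [k2 k3].
    by rewrite k3 // big_ord_recr /= k1 k2 // mul1r addrC.
  by apply: filterS h => x hx _; rewrite hx.
have hlim := chaos_decomposition sepX Lf hu.
rewrite (_ : (fun N => _) = fun N => (N2 (glaw nu) (fun x => \sum_(n < N) Gamma_tilde_n d n (u n) x - Gamma m f x))%:E); last first.
  by apply/funext => N; rewrite l2normE //; apply: L2B; [apply: L2_sum|exact: GammaL2].
apply: cvg_EFin; first exact: nearW.
apply: (@squeeze0 _ _ (fun N => C * N2 (glaw mu) (fun x => \sum_(n < N) u n x - f x))) => //.
  by move=> N; exact: N2_ge0.
by rewrite -[X in _ --> X](mulr0 C); apply: cvgM => //; exact: cvg_cst.
Qed.
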